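(* For every integer $n\ge 1$ there is a positive integer $m_n$, depending only on $n$, such that the following holds for every $0<\alpha\le 1$. If $f\in C^{2,\alpha}(\mathbb{R}^n)$ is non-negative, then there exist functions $g_1,\dots,g_{m_n}\in C^{1,\frac{\alpha}{2}}(\mathbb{R}^n)$ such that $$f=\sum_{j=1}^{m_n}g_j^2 .$$ Similarly, if $f\in C^{3,\alpha}(\mathbb{R}^n)$ is non-negative, then $f=\sum_{j=1}^{m_n}g_j^2$ for some functions $g_1,\dots,g_{m_n}\in C^{1,\frac{1+\alpha}{2}}(\mathbb{R}^n)$.
   Context: All functions are real-valued. For an integer $k\ge 0$ and $0<\alpha\le 1$, $C^{k,\alpha}(\mathbb{R}^n)$ denotes the set of $k$-times continuously differentiable functions $f$ on $\mathbb{R}^n$ such that for every multi-index $\beta$ with $|\beta|=k$, $$[\partial^\beta f]_{\alpha}=\sup_{x\ne y}\frac{|\partial^\beta f(x)-\partial^\beta f(y)|}{|x-y|^\alpha}<\infty.$$ No boundedness of $f$ or of its derivatives is required. *)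

(* Defs.v *)
From HB Require Import structures.
From mathcomp Require Import all_boot all_order all_algebra.
From mathcomp Require Import all_classical all_reals all_analysis.

Set Implicit Arguments.
Unset Strict Implicit.
Unset Printing Implicit Defensive.

Import Order.TTheory GRing.Theory Num.Theory.
Import numFieldNormedType.Exports.

Local Open Scope classical_set_scope.
Local Open Scope ring_scope.

(* The library norm on 'rV[R]_n is the sup norm (with the same topology). *)
Definition enorm (R : realType) (n : nat) (x : 'rV[R]_n) : R :=
  Num.sqrt (\sum_(i < n) x 0 i ^+ 2).

Definition pderiv (R : realType) (n : nat) (i : 'I_n) (f : 'rV[R]_n -> R) :
    'rV[R]_n -> R :=
  fun x => 'D_(delta_mx 0 i) f x.

(* The derivative along the last index of the word [s] is taken first. *)
Definition pderivs (R : realType) (n : nat) (s : seq 'I_n)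
    (f : 'rV[R]_n -> R) : 'rV[R]_n -> R :=
  foldr (@pderiv R n) f s.

(* All partial derivatives of order at most k, in any order of
   differentiation, exist and are continuous. The existence clause is needed
   because 'D_v is a total operator. *)
Definition contdiff (R : realType) (n k : nat) (f : 'rV[R]_n -> R) : Prop :=
  (forall (s : seq 'I_n) (i : 'I_n) (x : 'rV[R]_n), (size s < k)%N ->
     derivable (pderivs s f) x (delta_mx 0 i)) /\
  (forall s : seq 'I_n, (size s <= k)%N -> continuous (pderivs s f)).

Definition multiindex (n : nat) := {ffun 'I_n -> nat}.

Definition mdegree (n : nat) (b : multiindex n) : nat := (\sum_(i < n) b i)%N.

Definition mderiv (R : realType) (n : nat) (b : multiindex n)
    (f : 'rV[R]_n -> R) : 'rV[R]_n -> R :=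
  pderivs (flatten [seq nseq (b i) i | i <- enum 'I_n]) f.

Definition holder_seminorm (R : realType) (n : nat) (a : R)
    (g : 'rV[R]_n -> R) : \bar R :=
  ereal_sup [set (`|g p.1 - g p.2| / (enorm (p.1 - p.2) `^ a))%:E
            | p in [set p : 'rV[R]_n * 'rV[R]_n | p.1 != p.2]].

Definition holder_space (R : realType) (n k : nat) (a : R) :
    set ('rV[R]_n -> R) :=
  [set f | contdiff k f /\
    forall b : multiindex n, mdegree b = k ->
      (holder_seminorm a (mderiv b f) < +oo)%E].
Arguments holder_space R n k a : clear implicits.

(* Main.v *)
Require Import Defs.
From mathcomp Require Import all_boot all_order all_algebra.
From mathcomp Require Import all_classical all_reals all_analysis.
From mathcomp Require Import ring lra zify.

Set Implicit Arguments.
Unset Strict Implicit.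
Unset Printing Implicit Defensive.

Import Order.TTheory GRing.Theory Num.Theory.
Import numFieldNormedType.Exports.

Local Open Scope classical_set_scope.
Local Open Scope ring_scope.

(* Write beta = k + alpha (k = 2 or 3) and g = beta / 2 - 1. Call a scale r
   admissible at c when f c <= r^beta and every pure second derivative of f at c
   is at most r^(beta - 2). Then h z = r^(-beta) f (c + r z) has all derivatives
   up to order k bounded near 0, uniformly in c and r, because f >= 0: summing h
   over sign changes of the coordinates cancels the odd Taylor terms. If r / 8 is
   not admissible, then h 0 or some second derivative h_ll 0 is bounded below.
   In the first case sqrt h is smooth near 0. In the second case h is convex in
   z_l; if X is its critical point on each line parallel to e_l and
   F z = h (z with z_l := X z), then h - F = (z_l - X z)^2 H with H >= c / 2, so
   h - F is the square of a C^{1,g} function, and F is a nonnegative function of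
   n - 1 variables of the same class as f, to which induction applies.

   Space is covered by dyadic cubes adapted to the admissible scale. They get
   finitely many colours such that equally coloured cells are disjoint, so that a
   partition of unity with squares and the local roots glue into a fixed number
   of global functions: r^(1 + g) u ((x - c) / r) has first order Taylor
   remainder bounded independently of r. The induction needs uniform constants,
   and therefore runs over families of functions f : I -> V -> R with one
   constant for all indices. *)

(** * The class C^{k,a} of a family *)

(** Only the top seminorm of [f] is controlled; [f] and its lower derivatives may be unbounded.
    Division by r^beta at scale r leaves that seminorm unchanged, and nonnegativity supplies the
    missing bounds. The exponent 1 + g = beta / 2 is what a square root inherits from a function of
    size r^beta.

    The obstacle in the induction is regularity. X solves h_l = 0 and is only of class
    C^{k-1,alpha}, yet F must be of class C^{k,alpha}. It is, because the derivative of X enters the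
    gradient of F multiplied by h_l, which vanishes at the critical point. The root (z_l - X z) sqrt
    H must keep its sign, since its absolute value has a corner where z_l = X z. H is only known to
    be of class C^g, so the gradient of the root is obtained from h_m - F_m and not from H.

    F lives on a ball, whereas the induction needs a function on the whole space; a cut-off repairs
    this, and the projection that forgets z_l keeps the number of variables smaller. The number of
    squares depends on the number of colours and of variables alone, hence not on alpha. *)

Section Norm.
Variables (R : realType) (n : nat).
Implicit Types (x y : 'rV[R]_n).

Lemma coord_le_norm x l : `|x 0 l| <= `|x|.
Proof.
rewrite [leRHS]/Num.Def.normr /= mx_normrE.
by apply/bigmax_geP; right; exists (0, l).
Qed.

Lemma norm_le_coord x (c : R) : 0 <= c -> (forall l, `|x 0 l| <= c) -> `|x| <= c.
Proof.
move=> c0 h; rewrite /Num.Def.normr /= mx_normrE.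
by apply/bigmax_leP; split=> // -[i j] _ /=; rewrite ord1.
Qed.

Definition subst_coord (l : 'I_n) (t : R) x : 'rV[R]_n :=
  \row_m if m == l then t else x 0 m.

Lemma norm_delta_mx l : `|'e_l : 'rV[R]_n| = 1.
Proof.
apply/eqP; rewrite eq_le; apply/andP; split.
  by apply: norm_le_coord => // m; rewrite mxE eqxx /=; case: (_ == _); rewrite ?normr1 ?normr0.
by apply: le_trans (coord_le_norm _ l); rewrite mxE !eqxx normr1.
Qed.

End Norm.

Section Power.
Variables (R : realType) (a : R).
Hypotheses (a0 : 0 < a) (a1 : a <= 1).
Implicit Types d e K : R.

Lemma powR_mono d e : 0 <= d -> d <= e -> d `^ a <= e `^ a.
Proof.
by move=> d0 de; apply: ge0_ler_powR; rewrite ?nnegrE ?(ltW a0) // (le_trans d0).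
Qed.

Lemma powR_ge_id d : 0 <= d -> d <= 1 -> d <= d `^ a.
Proof.
rewrite le_eqVlt => /predU1P[<- _|d0 d1]; first exact: powR_ge0.
by apply: ger1_powR; rewrite ?d0.
Qed.

Lemma powR_ge1 d : 1 <= d -> 1 <= d `^ a.
Proof. by move=> d1; have := powR_mono ler01 d1; rewrite powR1. Qed.

Lemma powR_scale K d : 1 <= K -> 0 <= d -> (K * d) `^ a <= K * d `^ a.
Proof.
move=> K1 d0; rewrite powRM //; last exact: le_trans K1.
by apply: ler_wpM2r; [exact: powR_ge0 | exact: ler1_powR].
Qed.

Lemma powR_small e : 0 < e -> exists2 d, 0 < d & forall t, 0 <= t <= d -> t `^ a <= e.
Proof.
move=> e0; exists (e `^ a^-1); first exact: powR_gt0.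
move=> t /andP[t0 td]; apply: le_trans (powR_mono t0 td) _.
by rewrite -powRrM mulVf ?gt_eqF // powRr1 // ltW.
Qed.

Lemma powR_expo b d : a <= b -> 0 <= d <= 1 -> d `^ b <= d `^ a.
Proof.
move=> ab /andP[]; rewrite le_eqVlt => /predU1P[<- _|d0 d1].
  by rewrite !powR0 // gt_eqF // (lt_le_trans a0).
by apply: ger_powR; rewrite ?d0.
Qed.

End Power.

(* Combines a bound for distances d >= 1 with one for d <= 1, where w = d^a. *)
Lemma split_le (R : realType) (d w v z A B : R) : 0 <= A -> 0 <= B -> 0 <= v -> 0 <= w ->
  (1 <= d -> 1 <= w) -> z <= A * v -> (d <= 1 -> z <= B * (v * w)) ->
  z <= (A + B) * (v * w).
Proof.
move=> A0 B0 v0 w0 dw zA zB; case: (leP d 1) => d1.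
  by apply: le_trans (zB d1) _; apply: ler_wpM2r; [rewrite mulr_ge0|rewrite lerDr].
have w1 := dw (ltW d1).
apply: le_trans zA _; apply: (le_trans (_ : _ <= (A + B) * v)).
  by apply: ler_wpM2r => //; rewrite lerDl.
by apply: ler_wpM2l; [rewrite addr_ge0|rewrite ler_peMr].
Qed.

(** The sum of the separate constants dominates each of them. Constants found direction by
    direction, or word by word, become a single one in this way. *)
Lemma fin_unif (R : realType) (T : finType) (P : T -> R -> Prop) :
  (forall t M M', M <= M' -> P t M -> P t M') ->
  (forall t, exists2 M : R, 0 <= M & P t M) -> exists2 M : R, 0 <= M & forall t, P t M.
Proof.
move=> mono ex.
have [M hM] := choice (fun t => (let: ex_intro2 x h1 h2 := ex t in ex_intro (fun x => 0 <= x /\ P t x) x (conj h1 h2))).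
exists (\sum_t M t); first by apply: sumr_ge0 => t _; case: (hM t).
move=> t; apply: mono (proj2 (hM t)).
by rewrite (bigD1 t) //= lerDl; apply: sumr_ge0 => s _; case: (hM s).
Qed.

Section Class.
Variables (R : realType) (n : nat).
Local Notation V := 'rV[R]_n.

Definition lin (p : 'I_n -> R) (h : V) : R := \sum_l p l * h 0 l.

Lemma lin_le p h (B : R) : 0 <= B -> (forall l, `|p l| <= B) -> `|lin p h| <= n%:R * B * `|h|.
Proof.
move=> B0 pB; apply: le_trans (ler_norm_sum _ _ _) _.
apply: (le_trans (_ : _ <= \sum_(l < n) B * `|h|)).
  by apply: ler_sum => l _; rewrite normrM ler_pM // coord_le_norm.
by rewrite sumr_const card_ord -mulrA mulr_natl.
Qed.

Lemma linDl p q h : lin (fun l => p l + q l) h = lin p h + lin q h.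
Proof. by rewrite /lin -big_split /=; apply: eq_bigr => l _; rewrite mulrDl. Qed.

Lemma linZl c p h : lin (fun l => c * p l) h = c * lin p h.
Proof. by rewrite /lin big_distrr /=; apply: eq_bigr => l _; rewrite mulrA. Qed.

Lemma lin0l h : lin (fun=> 0) h = 0.
Proof. by rewrite /lin big1 // => l _; rewrite mul0r. Qed.

Lemma linBr p h h' : lin p (h - h') = lin p h - lin p h'.
Proof. by rewrite /lin -sumrB; apply: eq_bigr => l _; rewrite !mxE mulrBr. Qed.

Lemma linZr p c h : lin p (c *: h) = c * lin p h.
Proof. by rewrite /lin big_distrr /=; apply: eq_bigr => l _; rewrite mxE mulrCA. Qed.

Lemma lin_delta p t l : lin p (t *: 'e_l) = p l * t.
Proof.
rewrite /lin (bigD1 l) //= !mxE !eqxx mulr1 big1 ?addr0 // => m ml.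
by rewrite !mxE eqxx (negPf ml) /= !mulr0.
Qed.

Section Defs.
Variables (I : Type) (a : R) (U : set V).
Implicit Types (f : I -> V -> R) (M : R).

Definition bounded_on f M := forall i x, U x -> `|f i x| <= M.

Definition holder_on f M := forall i x y, U x -> U y ->
  `|f i y - f i x| <= M * `|y - x| `^ a.

Definition taylor_on f (p : 'I_n -> I -> V -> R) M := forall i x y, U x -> U y ->
  `|f i y - f i x - lin (fun l => p l i x) (y - x)| <= M * (`|y - x| * `|y - x| `^ a).

(* C^{k,a} on an arbitrary set U, in the style of Whitney: the derivatives [p] are
   data rather than limits, so no openness of U is needed. *)
Fixpoint Cka (k : nat) f : Prop :=
  if k is k'.+1 then
    exists (p : 'I_n -> I -> V -> R) (M : R),
      [/\ forall l, Cka k' (p l), 0 <= M, bounded_on f M & taylor_on f p M]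
  else exists M, [/\ 0 <= M, bounded_on f M & holder_on f M].

Lemma Cka_bnd k f : Cka k f -> exists2 M : R, 0 <= M & bounded_on f M.
Proof. by case: k => [[M [? ? _]]|k [p [M [_ ? ? _]]]]; exists M. Qed.

Lemma Cka_bnd_fin k (T : finType) (p : T -> I -> V -> R) :
  (forall l, Cka k (p l)) -> exists2 M : R, 0 <= M & forall l, bounded_on (p l) M.
Proof.
move=> h; apply: fin_unif => [t M M' MM' b i x Ux|t]; last exact: Cka_bnd (h t).
by apply: le_trans (b i x Ux) MM'.
Qed.

Lemma Cka_eq k f g : (forall i x, U x -> f i x = g i x) -> Cka k f -> Cka k g.
Proof.
move=> fg; case: k => [[M [M0 b h]]|k [p [M [hp M0 b t]]]].
  exists M; split=> // [i x Ux|i x y Ux Uy]; rewrite -!fg //; [exact: b|exact: h].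
exists p, M; split=> // [i x Ux|i x y Ux Uy]; rewrite -!fg //; [exact: b|exact: t].
Qed.

End Defs.

Lemma Cka_sub I (a : R) k (U U' : set V) (f : I -> V -> R) : (U' `<=` U) -> Cka a U k f -> Cka a U' k f.
Proof.
move=> UU; elim: k f => [|k ih] f.
  move=> [M [M0 b h]]; exists M; split=> // [i x /UU|i x y /UU Ux /UU Uy]; [exact: b|exact: h].
move=> [p [M [hp M0 b h]]]; exists p, M; split=> // [l|i x /UU|i x y /UU Ux /UU Uy].
- by apply: ih; exact: hp.
- exact: b.
- exact: h.
Qed.

Lemma Cka_reindex I I' (r : I' -> I) (a : R) k (U : set V) (f : I -> V -> R) :
  Cka a U k f -> Cka a U k (fun i => f (r i)).
Proof.
elim: k f => [|k ih] f.
  by move=> [M [M0 b h]]; exists M; split=> // [i x|i x y]; [exact: b|exact: h].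
move=> [p [M [hp M0 b h]]]; exists (fun l i => p l (r i)), M; split=> // [l|i x|i x y].
- by apply: ih; exact: hp.
- exact: b.
- exact: h.
Qed.

Section Closure.
Variables (I : Type) (a : R) (U : set V).
Hypotheses (a0 : 0 < a) (a1 : a <= 1).
Implicit Types (f g : I -> V -> R) (M : R).
Local Notation Cka := (@Cka I a U).

(** Nearby points use the Taylor bound and the bound on the gradient, distant ones the bound on [f].
    The two estimates are kept together because a product of two increments must be of order 1 + a:
    one factor is estimated linearly, the other with exponent [a]. *)
Lemma Cka_lip k f : Cka k.+1 f -> exists2 L : R, 0 <= L &
  forall i x y, U x -> U y -> `|f i y - f i x| <= L * `|y - x| /\
    `|f i y - f i x| <= L * `|y - x| `^ a.
Proof.
move=> [p [M [hp M0 b t]]]; have [N N0 hN] := Cka_bnd_fin hp.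
have nN0 : 0 <= n%:R * N by rewrite mulr_ge0.
exists (2 * M + (n%:R * N + M)); first by lra.
move=> i x y Ux Uy.
have big : `|f i y - f i x| <= 2 * M.
  by apply: le_trans (ler_normB _ _) _; have := b i x Ux; have := b i y Uy; lra.
have d0 : 0 <= `|y - x| by [].
have small : `|y - x| <= 1 -> `|f i y - f i x| <= (n%:R * N + M) * `|y - x|.
  move=> d1; have := t i x y Ux Uy.
  have := lin_le (y - x) N0 (fun l => hN l i x Ux).
  have w1 : `|y - x| `^ a <= 1 by have := powR_mono a0 d0 d1; rewrite powR1.
  have : `|y - x| * `|y - x| `^ a <= `|y - x| by rewrite ler_piMr.
  move: (lin _ _) (f i y - f i x) => s z dd sl zs.
  have := ler_normD (z - s) s; rewrite subrK => zn.
  apply: le_trans zn _; rewrite mulrDl addrC; apply: lerD => //.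
  by apply: le_trans zs _; apply: ler_wpM2l.
have M2 : 0 <= 2 * M by lra.
have NM0 : 0 <= n%:R * N + M by lra.
split.
  have := @split_le _ `|y - x| `|y - x| 1 _ _ _ M2 NM0 ler01 d0 id.
  by rewrite mul1r mulr1; exact.
have := @split_le _ `|y - x| (`|y - x| `^ a) 1 _ _ _ M2 NM0 ler01 (powR_ge0 _ _) (powR_ge1 a0 (d := _)).
rewrite mul1r mulr1; apply=> // d1; apply: le_trans (small d1) _.
by apply: ler_wpM2l => //; exact: powR_ge_id.
Qed.

Lemma Cka_down k f : Cka k.+1 f -> Cka k f.
Proof.
elim: k f => [|k ih] f hf.
  have [M M0 b] := Cka_bnd hf; have [L L0 hL] := Cka_lip hf.
  exists (M + L); split=> //; first by rewrite addr_ge0.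
    by move=> i x Ux; apply: le_trans (b i x Ux) _; rewrite lerDl.
  move=> i x y Ux Uy; have [_ h] := hL i x y Ux Uy.
  by apply: le_trans h _; apply: ler_wpM2r; rewrite ?powR_ge0 ?lerDr.
move: hf => [p [M [hp M0 b t]]]; exists p, M; split=> // l; exact: ih (hp l).
Qed.

Lemma Cka_le k m f : (k <= m)%N -> Cka m f -> Cka k f.
Proof.
move=> /subnKC <-; elim: (m - k)%N => [|j ih]; first by rewrite addn0.
by rewrite addnS => /Cka_down.
Qed.

Lemma Cka_cst k (c : I -> R) (B : R) : (forall i, `|c i| <= B) -> Cka k (fun i _ => c i).
Proof.
move=> cB.
have cB' i : `|c i| <= `|B| by apply: le_trans (cB i) _; exact: ler_norm.
elim: k c {cB} cB' => [|k ih] c cB.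
  exists `|B|; split; [by []|by move=> i x _; exact: cB|move=> i x y _ _].
  by rewrite subrr normr0 mulr_ge0 // powR_ge0.
exists (fun _ _ _ => 0), `|B|; split; [|by []|by move=> i x _; exact: cB|move=> i x y _ _].
  by move=> l; apply: (ih (fun=> 0)) => i; rewrite normr0.
by rewrite lin0l subr0 subrr normr0 !mulr_ge0 // powR_ge0.
Qed.

Lemma Cka_add k f g : Cka k f -> Cka k g -> Cka k (fun i x => f i x + g i x).
Proof.
elim: k f g => [|k ih] f g.
  move=> [M [M0 b h]] [N [N0 b' h']]; exists (M + N); split; first by rewrite addr_ge0.
    by move=> i x Ux; apply: le_trans (ler_normD _ _) _; apply: lerD; [exact: b|exact: b'].
  move=> i x y Ux Uy.
  have -> : f i y + g i y - (f i x + g i x) = (f i y - f i x) + (g i y - g i x) by ring.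
  by apply: le_trans (ler_normD _ _) _; rewrite mulrDl; apply: lerD; [exact: h|exact: h'].
move=> [p [M [hp M0 b t]]] [q [N [hq N0 b' t']]].
exists (fun l i x => p l i x + q l i x), (M + N); split; first by move=> l; apply: ih; [exact: hp|exact: hq].
- by rewrite addr_ge0.
- by move=> i x Ux; apply: le_trans (ler_normD _ _) _; apply: lerD; [exact: b|exact: b'].
move=> i x y Ux Uy; rewrite linDl.
have := t i x y Ux Uy; have := t' i x y Ux Uy.
move: (lin _ _) (lin _ _) => u v h1 h2.
have -> : f i y + g i y - (f i x + g i x) - (u + v) = (f i y - f i x - u) + (g i y - g i x - v) by ring.
by apply: le_trans (ler_normD _ _) _; rewrite mulrDl lerD.
Qed.

Lemma Cka_mul k f g : Cka k f -> Cka k g -> Cka k (fun i x => f i x * g i x).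
Proof.
elim: k f g => [|k ih] f g.
  move=> [M [M0 b h]] [N [N0 b' h']]; exists (M * N + (M * N + N * M)).
  split; first by rewrite !addr_ge0 ?mulr_ge0.
    move=> i x Ux; rewrite normrM; apply: (le_trans (_ : _ <= M * N)).
      by apply: ler_pM => //; [exact: b|exact: b'].
    by rewrite lerDl addr_ge0 ?mulr_ge0.
  move=> i x y Ux Uy.
  have -> : f i y * g i y - f i x * g i x =
    f i y * (g i y - g i x) + g i x * (f i y - f i x) by ring.
  apply: le_trans (ler_normD _ _) _; rewrite !normrM.
  apply: (le_trans (_ : _ <= M * (N * `|y - x| `^ a) + N * (M * `|y - x| `^ a))).
    by apply: lerD; apply: ler_pM => //; [exact: b|exact: h'|exact: b'|exact: h].
  rewrite !mulrA -mulrDl; apply: ler_wpM2r; first exact: powR_ge0.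
  by rewrite lerDr mulr_ge0.
move=> hf hg; have [L L0 hL] := Cka_lip hf; have [K K0 hK] := Cka_lip hg.
have fk := Cka_down hf; have gk := Cka_down hg.
move: hf hg => [p [M [hp M0 b t]]] [q [N [hq N0 b' t']]].
exists (fun l i x => f i x * q l i x + g i x * p l i x), (M * N + (M * N + N * M + L * K)).
have MN0 : 0 <= M * N by rewrite mulr_ge0.
have LK0 : 0 <= L * K by rewrite mulr_ge0.
split.
- by move=> l; apply: Cka_add; apply: ih => //; [exact: hq|exact: hp].
- lra.
- move=> i x Ux; rewrite normrM; apply: (le_trans (_ : _ <= M * N)).
    by apply: ler_pM => //; [exact: b|exact: b'].
  lra.
move=> i x y Ux Uy; rewrite linDl !linZl.
have := t i x y Ux Uy; have := t' i x y Ux Uy.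
have [+ _] := hL i x y Ux Uy; have [_ +] := hK i x y Ux Uy.
have := b i x Ux; have := b' i x Ux.
move: (lin (fun l => q l i x) _) (lin (fun l => p l i x) _) => u v h1 h2 h3 h4 h5 h6.
(* The product rule leaves the two Taylor remainders and the product of the increments; this last
   term is where [Cka_lip] is needed. *)
have -> : f i y * g i y - f i x * g i x - (f i x * u + g i x * v) =
  f i x * (g i y - g i x - u) + g i x * (f i y - f i x - v) +
  (f i y - f i x) * (g i y - g i x) by ring.
apply: le_trans (ler_normD _ _) _.
apply: (le_trans (_ : _ <= (M * N + N * M) * (`|y - x| * `|y - x| `^ a) + L * K * (`|y - x| * `|y - x| `^ a))).
  apply: lerD.
    apply: le_trans (ler_normD _ _) _; rewrite !normrM mulrDl -!mulrA.
    by apply: lerD; apply: ler_pM.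
  by rewrite normrM mulrACA; apply: ler_pM.
rewrite -mulrDl; apply: ler_wpM2r => //; lra.
Qed.

Lemma Cka_scale k (c : I -> R) (B : R) f : (forall i, `|c i| <= B) -> Cka k f ->
  Cka k (fun i x => c i * f i x).
Proof. by move=> cB; apply: Cka_mul; exact: Cka_cst cB. Qed.

Lemma Cka_sub2 k f g : Cka k f -> Cka k g -> Cka k (fun i x => f i x - g i x).
Proof.
move=> hf hg; apply: (@Cka_eq _ _ _ _ (fun i x => f i x + (-1) * g i x)).
  by move=> i x _; rewrite mulN1r.
apply: Cka_add => //; apply: (@Cka_scale _ (fun=> -1) 1) => // i.
by rewrite normrN1.
Qed.

Lemma Cka_prod k (T : eqType) (s : seq T) (P : pred T) (f : T -> I -> V -> R) :
  (forall t, P t -> Cka k (f t)) -> Cka k (fun i x => \prod_(t <- s | P t) f t i x).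
Proof.
move=> h; elim: s => [|t s ih].
  apply: (@Cka_eq _ _ _ _ (fun _ _ => 1)); first by move=> i x _; rewrite big_nil.
  by apply: (@Cka_cst _ (fun=> 1) 1) => i; rewrite normr1.
case Pt: (P t).
  apply: (@Cka_eq _ _ _ _ (fun i x => f t i x * \prod_(t <- s | P t) f t i x)).
    by move=> i x _; rewrite big_cons Pt.
  by apply: Cka_mul => //; exact: h.
by apply: Cka_eq ih => i x _; rewrite big_cons Pt.
Qed.

(** The gradient of 1 / f is - p / f^2, which contains the inverse one class lower, so induction on
    [k] closes. *)
Lemma Cka_inv k (c : R) f : 0 < c -> (forall i x, U x -> c <= `|f i x|) -> Cka k f ->
  Cka k (fun i x => (f i x)^-1).
Proof.
move=> c0; elim: k f => [|k ih] f fc.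
  move=> [M [M0 b h]]; exists (c^-1 + M * (c^-1 * c^-1)).
  have ci0 : 0 <= c^-1 by rewrite invr_ge0 ltW.
  have fi i x : U x -> `|(f i x)^-1| <= c^-1.
    by move=> Ux; rewrite normfV lef_pV2 ?posrE ?fc // (lt_le_trans c0) ?fc.
  split; first by rewrite addr_ge0 ?mulr_ge0.
    by move=> i x Ux; apply: le_trans (fi i x Ux) _; rewrite lerDl !mulr_ge0.
  move=> i x y Ux Uy.
  have fx0 : f i x != 0 by rewrite -normr_gt0 (lt_le_trans c0) ?fc.
  have fy0 : f i y != 0 by rewrite -normr_gt0 (lt_le_trans c0) ?fc.
  have -> : (f i y)^-1 - (f i x)^-1 = (f i y - f i x) * (- ((f i y)^-1 * (f i x)^-1)).
    by field; rewrite fx0 fy0.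
  rewrite normrM normrN normrM.
  apply: (le_trans (_ : _ <= M * `|y - x| `^ a * (c^-1 * c^-1))).
    by apply: ler_pM => //; [exact: h|apply: ler_pM => //; exact: fi].
  rewrite mulrAC; apply: ler_wpM2r; first exact: powR_ge0.
  by rewrite lerDr.
move=> hf; have [L L0 hL] := Cka_lip hf; have gk := ih _ fc (Cka_down hf).
move: hf => [p [M [hp M0 b t]]].
have ci0 : 0 <= c^-1 by rewrite invr_ge0 ltW.
have fi i x : U x -> `|(f i x)^-1| <= c^-1.
  by move=> Ux; rewrite normfV lef_pV2 ?posrE ?fc // (lt_le_trans c0) ?fc.
exists (fun l i x => - ((f i x)^-1 * (f i x)^-1) * p l i x), (c^-1 + (M * (c^-1 * c^-1) + L * L * (c^-1 * c^-1 * c^-1))).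
split.
- move=> l; apply: Cka_mul; last exact: hp.
  apply: (@Cka_eq _ _ _ _ (fun i x => (-1) * ((f i x)^-1 * (f i x)^-1))).
    by move=> i x _; rewrite mulN1r.
  by apply: (@Cka_scale _ (fun=> -1) 1) => [i|]; [rewrite normrN1|exact: Cka_mul].
- by rewrite !addr_ge0 ?mulr_ge0.
- by move=> i x Ux; apply: le_trans (fi i x Ux) _; rewrite lerDl !addr_ge0 ?mulr_ge0.
move=> i x y Ux Uy; rewrite linZl.
have := t i x y Ux Uy; have [h1 h2] := hL i x y Ux Uy.
have fx0 : f i x != 0 by rewrite -normr_gt0 (lt_le_trans c0) ?fc.
have fy0 : f i y != 0 by rewrite -normr_gt0 (lt_le_trans c0) ?fc.
move: (lin _ _) => u h3.
have -> : (f i y)^-1 - (f i x)^-1 - - ((f i x)^-1 * (f i x)^-1) * u =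
  - (f i y - f i x - u) * ((f i x)^-1 * (f i x)^-1) +
  (f i y - f i x) * (f i y - f i x) * ((f i x)^-1 * (f i x)^-1 * (f i y)^-1).
  by field; rewrite fx0 fy0.
apply: le_trans (ler_normD _ _) _.
apply: (le_trans (_ : _ <= M * (`|y - x| * `|y - x| `^ a) * (c^-1 * c^-1) + L * L * (`|y - x| * `|y - x| `^ a) * (c^-1 * c^-1 * c^-1))).
  apply: lerD; rewrite normrM ?normrN.
    apply: ler_pM => //; rewrite normrM; apply: ler_pM => //; exact: fi.
  apply: ler_pM => //; last by rewrite !normrM; do ! apply: ler_pM => //; exact: fi.
  by rewrite normrM mulrACA; apply: ler_pM.
rewrite -(mulrAC M) -(mulrAC (L * L)) -mulrDl; apply: ler_wpM2r => //.
by rewrite lerDr.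
Qed.

(** The gradient p / (2 sqrt f) needs the inverse of the root one class lower, which the lower bound
    [c] keeps under control. *)
Lemma Cka_sqrt k (c : R) f : 0 < c -> (forall i x, U x -> c <= f i x) -> Cka k f ->
  Cka k (fun i x => Num.sqrt (f i x)).
Proof.
move=> c0; pose r := Num.sqrt c.
have r0 : 0 < r by rewrite sqrtr_gt0.
elim: k f => [|k ih] f fc hf.
  have [M [M0 b h]] := hf.
  have sf i x : U x -> r <= Num.sqrt (f i x) by move=> Ux; rewrite ler_wsqrtr ?fc.
  have sq i x : U x -> Num.sqrt (f i x) ^+ 2 = f i x.
    by move=> Ux; rewrite sqr_sqrtr // (le_trans (ltW c0)) ?fc.
  exists (1 + M + M / r); split.
  - by rewrite !addr_ge0 // divr_ge0 // ltW.
  - move=> i x Ux; have := b i x Ux; have := sq i x Ux; have := sf i x Ux.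
    have : 0 <= M / r by rewrite divr_ge0 // ltW.
    move: (M / r) (Num.sqrt _) => q s q0 rs se; rewrite -se ger0_norm ?sqr_ge0 // ger0_norm; last lra.
    nra.
  move=> i x y Ux Uy; have hh := h i x y Ux Uy.
  rewrite -(sq i x) // -(sq i y) // subr_sqr normrM in hh.
  move: (sf i x Ux) (sf i y Uy) hh.
  move: (Num.sqrt (f i x)) (Num.sqrt (f i y)) => s' s rs' rs hh.
  rewrite (@ger0_norm _ (s + s')) in hh; last by lra.
  apply: (le_trans (_ : _ <= M / r * `|y - x| `^ a)).
    rewrite -mulrA mulrCA mulrC ler_pdivlMr //; apply: le_trans hh.
    by apply: ler_wpM2l => //; lra.
  by apply: ler_wpM2r => //; lra.
have [L L0 hL] := Cka_lip hf; have gk := ih _ fc (Cka_down hf).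
have [G G0 bG] := Cka_bnd gk.
move: hf => [p [M [hp M0 b t]]].
have sf i x : U x -> r <= Num.sqrt (f i x) by move=> Ux; rewrite ler_wsqrtr ?fc.
have sq i x : U x -> Num.sqrt (f i x) ^+ 2 = f i x.
  by move=> Ux; rewrite sqr_sqrtr // (le_trans (ltW c0)) ?fc.
have ri0 : 0 <= r^-1 by rewrite invr_ge0 ltW.
exists (fun l i x => 2^-1 * (Num.sqrt (f i x))^-1 * p l i x), (G + (M * r^-1 + L * L * (r^-1 * r^-1 * r^-1))).
split.
- move=> l; apply: Cka_mul; last exact: hp.
  apply: (@Cka_scale _ (fun=> 2^-1) 1).
    by move=> _; rewrite ger0_norm ?invr_ge0 // invf_le1 //; lra.
  apply: (@Cka_inv _ r) => // i x Ux; apply: le_trans (sf i x Ux) _; exact: ler_norm.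
- by rewrite !addr_ge0 ?mulr_ge0.
- by move=> i x Ux; apply: le_trans (bG i x Ux) _; rewrite lerDl !addr_ge0 ?mulr_ge0.
move=> i x y Ux Uy; rewrite linZl.
have := t i x y Ux Uy; have [h1 h2] := hL i x y Ux Uy.
move: (lin _ _) => u h3.
have h4 : `|f i y - f i x| * `|f i y - f i x| <= L * L * (`|y - x| * `|y - x| `^ a).
  by rewrite mulrACA; apply: ler_pM.
have := sf i x Ux; have := sf i y Uy; have := sq i x Ux; have := sq i y Uy.
move: (Num.sqrt (f i y)) (Num.sqrt (f i x)) => s s' es es' rs rs'.
rewrite -es -es' in h3 h4.
have s0 : 0 < s by lra.
have s0' : 0 < s' by lra.
have e1 : s - s' = (s ^+ 2 - s' ^+ 2) * (s + s')^-1 by field; rewrite gt_eqF // addr_gt0.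
(* Follows from s - s' = (s^2 - s'^2) / (s + s'): beyond the remainder of [f], the error is
   quadratic in the increment of [f]. *)
have -> : s - s' - 2^-1 * s'^-1 * u = (s ^+ 2 - s' ^+ 2 - u) * (2^-1 * s'^-1) -
   (s ^+ 2 - s' ^+ 2) * (s ^+ 2 - s' ^+ 2) * ((s + s')^-1 * (s + s')^-1 * (2^-1 * s'^-1)).
  by field; rewrite (gt_eqF s0') gt_eqF // addr_gt0.
have i1 : `|(2^-1 * s'^-1)| <= r^-1.
  rewrite ger0_norm; last by rewrite mulr_ge0 // invr_ge0 ltW.
  rewrite -invfM lef_pV2 ?posrE //; nra.
have i2 : `|(s + s')^-1| <= r^-1.
  rewrite ger0_norm; last by rewrite invr_ge0; lra.
  rewrite lef_pV2 ?posrE; lra.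
apply: le_trans (ler_normB _ _) _.
apply: (le_trans (_ : _ <= M * (`|y - x| * `|y - x| `^ a) * r^-1 + L * L * (`|y - x| * `|y - x| `^ a) * (r^-1 * r^-1 * r^-1))).
  apply: lerD; rewrite normrM.
    by apply: ler_pM.
  apply: ler_pM => //; first by rewrite normrM.
  by rewrite !normrM -!normrM; rewrite normrM; apply: ler_pM => //; rewrite normrM; apply: ler_pM.
rewrite -(mulrAC M) -(mulrAC (L * L)) -mulrDl; apply: ler_wpM2r => //.
by rewrite lerDr.
Qed.


End Closure.
End Class.

(** * Change of exponent, substitution, extension by zero and truncated powers *)

Section Operations.
Variables (R : realType) (n : nat).
Local Notation V := 'rV[R]_n.

(** Lowering the exponent weakens the condition only for distances at most 1; beyond that the bounds
    on [f] and on its gradient take over. *)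
Lemma Cka_expo I (a b : R) (U : set V) k (f : I -> V -> R) :
  0 < b -> b <= a -> a <= 1 -> Cka a U k f -> Cka b U k f.
Proof.
move=> b0 ba a1.
elim: k f => [|k ih] f.
  move=> [M [M0 bd h]]; exists (2 * M + M); split; first lra.
    by move=> i x Ux; apply: le_trans (bd i x Ux) _; lra.
  move=> i x y Ux Uy; have := h i x y Ux Uy.
  have := ler_normB (f i y) (f i x); have := bd i x Ux; have := bd i y Uy.
  have d0 : 0 <= `|y - x| by [].
  case: (leP `|y - x| 1) => d1.
    have : `|y - x| `^ a <= `|y - x| `^ b by apply: powR_expo => //; rewrite d0.
    have := powR_ge0 `|y - x| a; have := powR_ge0 `|y - x| b.
    move: (`|y - x| `^ a) (`|y - x| `^ b) => v w; nra.
  have := powR_ge1 b0 (ltW d1).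
  move: (`|y - x| `^ a) (`|y - x| `^ b) => v w; nra.
move=> [p [M [hp M0 bd h]]].
have [N N0 bp] := Cka_bnd_fin hp.
have nN0 : 0 <= n%:R * N by rewrite mulr_ge0.
exists p, (2 * M + (n%:R * N + M)); split.
- by move=> l; apply: ih; exact: hp.
- lra.
- by move=> i x Ux; apply: le_trans (bd i x Ux) _; lra.
move=> i x y Ux Uy; have := h i x y Ux Uy.
have := lin_le (y - x) N0 (fun l => bp l i x Ux).
have := bd i x Ux; have := bd i y Uy.
have := ler_normB (f i y - f i x) (lin (fun l => p l i x) (y - x)).
have := ler_normB (f i y) (f i x).
have d0 : 0 <= `|y - x| by [].
move: (lin _ _) (f i y - f i x) => u v.
case: (leP `|y - x| 1) => d1.
  have : `|y - x| `^ a <= `|y - x| `^ b by apply: powR_expo => //; rewrite d0.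
  have := powR_ge0 `|y - x| b.
  move: (`|y - x| `^ a) (`|y - x| `^ b) => s t t0 st _ _ _ _ _ hh.
  apply: le_trans hh _; apply: (le_trans (_ : _ <= M * (`|y - x| * t))).
    by do 2 (apply: ler_wpM2l => //).
  by apply: ler_wpM2r; [exact: mulr_ge0|lra].
have := powR_ge1 b0 (ltW d1).
move: (`|y - x| `^ a) (`|y - x| `^ b) => s t t1 h1 h2 h3 h4 h5 _.
apply: le_trans h2 _; apply: (le_trans (_ : _ <= (2 * M + n%:R * N) * `|y - x|)).
  have : 2 * M <= 2 * M * `|y - x| by rewrite ler_peMr ?mulr_ge0 // ltW.
  lra.
apply: ler_pM; rewrite ?addr_ge0 ?mulr_ge0 //; first lra.
by rewrite ler_peMr.
Qed.

(** The distinguished coordinate will depend on the index [i]. As it takes finitely many values, one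
    constant still serves all indices. *)
Lemma Cka_select I (T : finType) (l : I -> T) (a : R) (U : set V) k (f : T -> I -> V -> R) :
  (forall t, Cka a U k (f t)) -> Cka a U k (fun i x => f (l i) i x).
Proof.
elim: k f => [|k ih] f hf.
  have /fin_unif [|M M0 hM] t : exists2 M : R, 0 <= M & bounded_on U (f t) M /\ holder_on a U (f t) M.
      by case: (hf t) => M [M0 b h]; exists M.
    move=> t M M' MM' [b h]; split=> [i x Ux|i x y Ux Uy].
      exact: le_trans (b i x Ux) MM'.
    by apply: le_trans (h i x y Ux Uy) _; apply: ler_wpM2r => //; exact: powR_ge0.
  exists M; split=> //; first by move=> i x Ux; apply: (proj1 (hM _)).
  by move=> i x y Ux Uy; apply: (proj2 (hM _)).
have [p hp] := choice (hf : forall t, exists p, exists M, _).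
have /fin_unif [|M M0 hM] t : exists2 M : R, 0 <= M & bounded_on U (f t) M /\ taylor_on a U (f t) (p t) M.
    by case: (hp t) => M [_ M0 b h]; exists M.
  move=> t M M' MM' [b h]; split=> [i x Ux|i x y Ux Uy].
    exact: le_trans (b i x Ux) MM'.
  by apply: le_trans (h i x y Ux Uy) _; apply: ler_wpM2r => //; rewrite mulr_ge0 ?powR_ge0.
exists (fun m i x => p (l i) m i x), M; split=> //.
- by move=> m; apply: (ih (fun t => p t m)) => t; case: (hp t) => ? [h _ _ _]; exact: h.
- by move=> i x Ux; apply: (proj1 (hM _)).
- by move=> i x y Ux Uy; apply: (proj2 (hM _)).
Qed.

Lemma subst_coord_lip (l : 'I_n) (t s L : R) (x y : V) : 0 <= L -> `|s - t| <= L * `|y - x| ->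
  `|subst_coord l s y - subst_coord l t x| <= (1 + L) * `|y - x|.
Proof.
move=> L0 h; apply: norm_le_coord; first by rewrite mulr_ge0 // addr_ge0.
move=> m; rewrite !mxE; case: eqP => _.
  by apply: le_trans h _; apply: ler_wpM2r => //; lra.
have := coord_le_norm (y - x) m; rewrite !mxE => hm; apply: le_trans hm _.
by rewrite ler_peMl //; lra.
Qed.

Lemma lin_subst_coord (u : 'I_n -> R) (l : 'I_n) (t s : R) (x y : V) :
  lin u (subst_coord l s y - subst_coord l t x) =
  lin (fun m => (m != l)%:R * u m) (y - x) + u l * (s - t).
Proof.
rewrite /lin (bigD1 l) //= addrC; congr (_ + _); last by rewrite !mxE eqxx.
rewrite [RHS](bigD1 l) //= eqxx !mul0r add0r; apply: eq_bigr => m ml.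
by rewrite !mxE (negPf ml) mul1r.
Qed.

Section Subst.
Variables (I : Type) (a : R) (U W : set V).
Hypotheses (a0 : 0 < a) (a1 : a <= 1).
Variables (l : I -> 'I_n) (X : I -> V -> R) (L : R).
Hypotheses (L0 : (0 : R) <= L)
  (XL : forall i x y, W x -> W y -> `|X i y - X i x| <= L * `|y - x|)
  (WU : forall i x, W x -> U (subst_coord (l i) (X i x) x)).

(** The Lipschitz bound on [X] is a hypothesis of its own: at k = 0 the class of [X] gives exponent
    [a] only, and composition with [f] would leave exponent a^2. *)
Lemma Cka_subst k (f : I -> V -> R) : Cka a W k X -> Cka a U k f ->
  Cka a W k (fun i x => f i (subst_coord (l i) (X i x) x)).
Proof.
have L1 : 1 <= 1 + L by rewrite lerDl.
have PL i x y : W x -> W y -> `|subst_coord (l i) (X i y) y - subst_coord (l i) (X i x) x| <= (1 + L) * `|y - x|.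
  by move=> Wx Wy; apply: subst_coord_lip => //; exact: XL.
have Pa i x y : W x -> W y -> `|subst_coord (l i) (X i y) y - subst_coord (l i) (X i x) x| `^ a <= (1 + L) * `|y - x| `^ a.
  move=> Wx Wy; apply: le_trans (powR_mono a0 _ (PL i x y Wx Wy)) _ => //.
  exact: powR_scale.
elim: k f => [|k ih] f hX.
  move=> [M [M0 b h]]; exists (M * (1 + L)); split; first by rewrite mulr_ge0 //; lra.
    move=> i x Wx; apply: le_trans (b _ _ (WU _ Wx)) _; by rewrite ler_peMr.
  move=> i x y Wx Wy; apply: le_trans (h _ _ _ (WU i Wx) (WU i Wy)) _.
  by rewrite -mulrA; apply: ler_wpM2l => //; exact: Pa.
move=> [p [M [hp M0 b t]]]; have [N N0 bN] := Cka_bnd_fin hp.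
have hXk := Cka_down a0 a1 hX.
move: hX => [q [K [hq K0 bK tK]]].
(* Chain rule: coordinate [l i] is overwritten by [X], so that partial derivative of [f] is dropped
   and returns multiplied by the gradient [q] of [X]. *)
exists (fun m i x => (m != l i)%:R * p m i (subst_coord (l i) (X i x) x) +
   p (l i) i (subst_coord (l i) (X i x) x) * q m i x), (M * (1 + L) * (1 + L) + N * K).
split.
- move=> m; apply: Cka_add.
    apply: (Cka_scale a0 a1 (B := 1)) => [i|]; last by apply: ih => //; exact: hp.
    by rewrite normr_nat; case: (_ == _) => //=.
  apply: Cka_mul => //; last exact: hq.
  apply: (ih (fun i x => p (l i) i x)) => //.
  by apply: (@Cka_select _ _ l _ _ _ p) => m'; exact: hp.
- by rewrite addr_ge0 ?mulr_ge0 //; lra.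
- move=> i x Wx; apply: le_trans (b _ _ (WU _ Wx)) _.
  have M1 : M <= M * (1 + L) by rewrite ler_peMr.
  apply: le_trans M1 _; rewrite -[leLHS]addr0; apply: lerD; last by rewrite mulr_ge0.
  by rewrite ler_peMr // mulr_ge0 //; lra.
move=> i x y Wx Wy; have := t i _ _ (WU i Wx) (WU i Wy).
rewrite lin_subst_coord linDl linZl.
have := tK i x y Wx Wy; have := bN (l i) i _ (WU i Wx).
move: (lin (fun m => q m i x) (y - x)) (lin (fun m => (m != l i)%:R * _) (y - x)) => u v h1 h2 h3.
rewrite (_ : _ - _ - _ = f i (subst_coord (l i) (X i y) y) - f i (subst_coord (l i) (X i x) x) -
   (v + p (l i) i (subst_coord (l i) (X i x) x) * (X i y - X i x)) +
   p (l i) i (subst_coord (l i) (X i x) x) * (X i y - X i x - u)); last by ring.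
apply: le_trans (ler_normD _ _) _; rewrite mulrDl; apply: lerD.
  apply: le_trans h3 _; rewrite -!mulrA; apply: ler_wpM2l => //.
  rewrite (_ : (1 + L) * ((1 + L) * _) = ((1 + L) * `|y - x|) * ((1 + L) * `|y - x| `^ a)); last by ring.
  apply: ler_pM => //; [exact: PL|exact: Pa].
rewrite normrM -[N * K * _]mulrA.
exact: ler_pM (normr_ge0 _) (normr_ge0 _) h1 h2.
Qed.

End Subst.

Definition diag_affine (D v x : V) : V := \row_m (D 0 m * x 0 m + v 0 m).

Lemma diag_affine_lip (D v x y : V) (K : R) : 1 <= K -> `|D| <= K ->
  `|diag_affine D v y - diag_affine D v x| <= K * `|y - x|.
Proof.
move=> K1 DK; apply: norm_le_coord; first by rewrite mulr_ge0 //; lra.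
move=> m; rewrite !mxE.
rewrite (_ : _ - _ = D 0 m * (y - x) 0 m); last by rewrite !mxE; ring.
rewrite normrM; apply: ler_pM => //; last exact: coord_le_norm.
exact: le_trans (coord_le_norm _ _) DK.
Qed.

Lemma lin_diag_affine u (D v x y : V) :
  lin u (diag_affine D v y - diag_affine D v x) = lin (fun m => D 0 m * u m) (y - x).
Proof. by rewrite /lin; apply: eq_bigr => m _; rewrite !mxE; ring. Qed.

Lemma Cka_diag_affine I (a : R) (U W : set V) (D v : I -> V) (K : R) k (f : I -> V -> R) :
  0 < a -> a <= 1 -> (forall i, `|D i| <= K) ->
  (forall i x, W x -> U (diag_affine (D i) (v i) x)) ->
  Cka a U k f -> Cka a W k (fun i x => f i (diag_affine (D i) (v i) x)).
Proof.
move=> a0 a1 DK' WU.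
wlog K1 : K DK' / 1 <= K => [wl|].
  apply: (wl (1 + `|K|)); last by rewrite lerDl.
  move=> i; apply: le_trans (DK' i) _; apply: le_trans (ler_norm _) _; lra.
move: DK' => DK.
have K0 : 0 <= K by lra.
elim: k f => [|k ih] f.
  move=> [M [M0 b h]]; exists (M * K); split; first by rewrite mulr_ge0.
    move=> i x Wx; apply: le_trans (b _ _ (WU _ _ Wx)) _; by rewrite ler_peMr.
  move=> i x y Wx Wy; apply: le_trans (h _ _ _ (WU i _ Wx) (WU i _ Wy)) _.
  rewrite -mulrA; apply: ler_wpM2l => //.
  apply: le_trans (powR_mono a0 _ (diag_affine_lip _ _ _ K1 (DK i))) _ => //.
  exact: powR_scale.
move=> [p [M [hp M0 b t]]].
exists (fun m i x => D i 0 m * p m i (diag_affine (D i) (v i) x)), (M * K * K); split.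
- move=> m; apply: (Cka_scale a0 a1 (B := K)) => [i|].
    exact: le_trans (coord_le_norm _ _) (DK i).
  by apply: ih; exact: hp.
- by rewrite !mulr_ge0.
- move=> i x Wx; apply: le_trans (b _ _ (WU _ _ Wx)) _.
  by rewrite -mulrA ler_peMr // mulr_ege1.
move=> i x y Wx Wy; have := t i _ _ (WU i _ Wx) (WU i _ Wy).
rewrite lin_diag_affine => h; apply: le_trans h _.
rewrite -!mulrA; apply: ler_wpM2l => //.
rewrite (_ : K * (K * _) = (K * `|y - x|) * (K * `|y - x| `^ a)); last by ring.
apply: ler_pM => //; rewrite ?powR_ge0 //; first exact: diag_affine_lip.
apply: le_trans (powR_mono a0 _ (diag_affine_lip _ _ _ K1 (DK i))) _ => //.
exact: powR_scale.
Qed.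

(** The Taylor estimate is divided by t, and t tends to 0. Since [p] is data on an arbitrary set,
    this is how a gradient is shown to vanish off the support of a cut-off function. *)
Lemma taylor_grad0 I (a : R) (U : set V) (f : I -> V -> R) p (M : R) l i x : 0 < a ->
  0 <= M -> taylor_on a U f p M -> U x -> f i x = 0 ->
  (forall d : R, 0 < d -> exists t, [/\ t != 0, `|t| <= d, U (x + t *: 'e_l) & f i (x + t *: 'e_l) = 0]) ->
  p l i x = 0.
Proof.
move=> a0 M0 tf Ux fx h; apply/eqP; rewrite -normr_le0; apply/ler_addgt0Pl => e e0; rewrite addr0.
have M1 : 0 < M + 1 by lra.
have [d d0 hd] := powR_small a0 (divr_gt0 e0 M1).
have [t [t0 td Ut ft]] := h d d0.
have := tf i x _ Ux Ut; rewrite ft fx [x + _]addrC addrK subr0 sub0r.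
rewrite lin_delta normrN normrM normrZ norm_delta_mx mulr1 [`|p l i x| * _]mulrC mulrCA.
rewrite ler_pM2l ?normr_gt0 // => hp; apply: le_trans hp _.
apply: (le_trans (_ : _ <= (M + 1) * (e / (M + 1)))); last by rewrite mulrC divfK // gt_eqF.
apply: ler_pM => //; rewrite ?powR_ge0 ?hd ?normr_ge0 //; lra.
Qed.

(** A pair of points avoids [B] and contributes nothing, or lies in [U], or joins [B] to the outside
    of [U] and has distance at least [d], where bounds suffice. The hypothesis on small steps along
    the axes makes the gradient vanish on the part of [U] outside [B]. *)
Lemma Cka_extend I (a : R) (U B : set V) (d : R) k (f : I -> V -> R) : 0 < a -> 0 < d ->
  (forall i x, ~ B x -> f i x = 0) ->
  (forall x y, B x -> ~ U y -> d <= `|y - x|) ->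
  (forall x l e, U x -> ~ B x -> 0 < e -> exists t, [/\ t != 0, `|t| <= e,
     U (x + t *: 'e_l) & ~ B (x + t *: 'e_l)]) ->
  Cka a U k f -> Cka a setT k f.
Proof.
move=> a0 d0 + dist op.
have BU x : B x -> U x.
  by move=> Bx; apply: contrapT => /(dist _ _ Bx); rewrite subrr normr0 leNgt d0.
have da0 : 0 < d `^ a by exact: powR_gt0.
elim: k f => [|k ih] f f0.
  move=> [M [M0 b h]].
  have b' i x : `|f i x| <= M.
    by case: (pselect (U x)) => Ux; [exact: b|rewrite f0 ?normr0 // => /BU].
  have Md : 0 <= M / d `^ a by rewrite divr_ge0 // ltW.
  exists (M + M / d `^ a); split=> [|i x _|i x y _ _].
  - exact: addr_ge0.
  - by apply: le_trans (b' i x) _; rewrite lerDl.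
  have far : d <= `|y - x| -> M <= M / d `^ a * `|y - x| `^ a.
    move=> dd; rewrite -mulrA ler_peMr // mulrC ler_pdivlMr // mul1r.
    by apply: powR_mono => //; exact: ltW.
  have w0 := powR_ge0 `|y - x| a; rewrite mulrDl.
  have Mw0 : 0 <= M * `|y - x| `^ a by rewrite mulr_ge0.
  have Mw1 : 0 <= M / d `^ a * `|y - x| `^ a by rewrite mulr_ge0.
  case: (pselect (B x)) => Bx; case: (pselect (B y)) => By.
  - by apply: le_trans (h _ _ _ (BU _ Bx) (BU _ By)) _; lra.
  - case: (pselect (U y)) => Uy.
      by apply: le_trans (h _ _ _ (BU _ Bx) Uy) _; lra.
    have := far (dist _ _ Bx Uy); rewrite (f0 _ y) // sub0r normrN.
    by have := b' i x; lra.
  - case: (pselect (U x)) => Ux.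
      by apply: le_trans (h _ _ _ Ux (BU _ By)) _; lra.
    have := far; rewrite distrC => /(_ (dist _ _ By Ux)).
    rewrite (f0 _ x) // subr0.
    by have := b' i y; rewrite distrC; lra.
  - rewrite !f0 // subrr normr0; lra.
move=> [p [M [hp M0 b t]]]; have [N N0 bN] := Cka_bnd_fin hp.
pose q l i x := if `[< B x >] then p l i x else 0.
have qp l i x : U x -> q l i x = p l i x.
  move=> Ux; rewrite /q; case: asboolP => // Bx; apply/esym.
  apply: (taylor_grad0 a0 M0 t Ux) => [|e e0]; first exact: f0.
  by have [s [? ? ? ?]] := op x l e Ux Bx e0; exists s; split=> //; exact: f0.
have b' i x : `|f i x| <= M.
  by case: (pselect (U x)) => Ux; [exact: b|rewrite f0 ?normr0 // => /BU].
have q0 l i x : ~ B x -> q l i x = 0 by rewrite /q; case: asboolP.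
have Md : 0 <= M / (d * d `^ a) by rewrite divr_ge0 // mulr_ge0 // ltW.
have Nd : 0 <= n%:R * N / d `^ a by rewrite divr_ge0 ?mulr_ge0 // ltW.
exists q, (M + (M / (d * d `^ a) + n%:R * N / d `^ a)); split.
- move=> l; apply: ih; first by move=> i x; exact: q0.
  by apply: Cka_eq (hp l) => i x Ux; rewrite qp.
- by rewrite !addr_ge0.
- by move=> i x _; apply: le_trans (b' i x) _; rewrite lerDl addr_ge0.
move=> i x y _ _.
have near : U x -> U y -> `|f i y - f i x - lin (fun l => q l i x) (y - x)| <= M * (`|y - x| * `|y - x| `^ a).
  move=> Ux Uy; rewrite (_ : (fun l => q l i x) = (fun l => p l i x)); first exact: t.
  by apply: funext => l; rewrite qp.
have far : d <= `|y - x| -> M <= M / (d * d `^ a) * (`|y - x| * `|y - x| `^ a).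
  move=> dd; rewrite -mulrA ler_peMr // mulrC ler_pdivlMr ?mul1r ?mulr_gt0 //.
  by apply: ler_pM; rewrite ?powR_ge0 ?powR_mono // ltW.
have w0 := powR_ge0 `|y - x| a; rewrite [leRHS]mulrDl [X in _ <= _ + X]mulrDl.
have Mw0 : 0 <= M * (`|y - x| * `|y - x| `^ a) by rewrite mulr_ge0.
have Mw1 : 0 <= M / (d * d `^ a) * (`|y - x| * `|y - x| `^ a) by rewrite mulr_ge0.
have Mw2 : 0 <= n%:R * N / d `^ a * (`|y - x| * `|y - x| `^ a) by rewrite mulr_ge0.
have q00 : ~ B x -> lin (fun l => q l i x) (y - x) = 0.
  move=> Bx; rewrite (_ : (fun l => q l i x) = (fun=> 0)) ?lin0l //.
  by apply: funext => l; exact: q0.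
case: (pselect (B x)) => Bx; case: (pselect (B y)) => By.
- by apply: le_trans (near (BU _ Bx) (BU _ By)) _; lra.
- case: (pselect (U y)) => Uy.
    by apply: le_trans (near (BU _ Bx) Uy) _; lra.
  have dd := dist _ _ Bx Uy; have := far dd; rewrite (f0 _ y) // sub0r.
  have : `|lin (fun l => q l i x) (y - x)| <= n%:R * N / d `^ a * (`|y - x| * `|y - x| `^ a).
    apply: le_trans (lin_le (B := N) (y - x) N0 _) _.
      by move=> l; rewrite qp; [apply: bN|]; exact: BU.
    rewrite -!mulrA; do 2 (apply: ler_wpM2l => //).
    rewrite mulrCA ler_peMr // mulrC ler_pdivlMr // mul1r.
    by apply: powR_mono => //; exact: ltW.
  have := b' i x; move: (lin _ _) => u h1 h2 h3.
  apply: le_trans (ler_normB _ _) _; rewrite normrN; lra.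
- case: (pselect (U x)) => Ux.
    by apply: le_trans (near Ux (BU _ By)) _; lra.
  have := far; rewrite distrC => /(_ (dist _ _ By Ux)).
  rewrite (f0 _ x) // q00 // !subr0.
  by have := b' i y; rewrite distrC; lra.
- by rewrite !f0 // q00 // !subr0 normr0; lra.
Qed.

Lemma Cka_coord I (a : R) (U : set V) k l (B : R) : 0 < a -> a <= 1 -> (forall x, U x -> `|x| <= B) ->
  Cka a U k (fun (_ : I) x => x 0 l).
Proof.
move=> a0 a1 UB.
suff : Cka a U k.+1 (fun (_ : I) (x : V) => x 0 l) by exact: Cka_down.
exists (fun m _ _ => (m == l)%:R), `|B|; split.
- move=> m; apply: (@Cka_cst _ _ _ _ _ _ (fun=> (m == l)%:R) 1) => _.
  by rewrite normr_nat; case: (_ == _).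
- by [].
- by move=> i x Ux; apply: le_trans (coord_le_norm _ _) _; apply: le_trans (UB x Ux) (ler_norm _).
move=> i x y Ux Uy.
rewrite /lin (bigD1 l) //= eqxx mul1r big1 => [|m ml]; last by rewrite (negPf ml) mul0r.
by rewrite addr0 !mxE subrr normr0 !mulr_ge0 // powR_ge0.
Qed.

Lemma exprn_taylor (B : R) m (u v : R) : 0 <= u <= B -> 0 <= v <= B -> 1 <= B ->
  `|v ^+ m.+2 - u ^+ m.+2 - m.+2%:R * u ^+ m.+1 * (v - u)| <= m.+2%:R ^+ 2 * B ^+ m * (v - u) ^+ 2.
Proof.
move=> /andP[u0 uB] /andP[v0 vB] B1.
elim: m => [|m ih].
  rewrite (_ : v ^+ 2 - _ - _ = (v - u) ^+ 2); last by ring.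
  rewrite ger0_norm ?sqr_ge0 // expr0 mulr1 ler_peMl ?sqr_ge0 //; lra.
have uB' : u ^+ m.+1 <= B ^+ m.+1 by apply: lerXn2r; rewrite ?nnegrE //; lra.
have B0 : 0 <= B ^+ m by rewrite exprn_ge0 //; lra.
rewrite (_ : v ^+ m.+3 - _ - _ = v * (v ^+ m.+2 - u ^+ m.+2 - m.+2%:R * u ^+ m.+1 * (v - u)) +
   m.+2%:R * u ^+ m.+1 * (v - u) ^+ 2); last by rewrite !exprS -(@natr1 _ m.+2); ring.
apply: le_trans (ler_normD _ _) _.
apply: (le_trans (_ : _ <= B * (m.+2%:R ^+ 2 * B ^+ m * (v - u) ^+ 2) + m.+2%:R * B ^+ m.+1 * (v - u) ^+ 2)).
  apply: lerD; rewrite normrM.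
    by apply: ler_pM => //; rewrite ger0_norm.
  rewrite (ger0_norm (sqr_ge0 _)); apply: ler_wpM2r; first exact: sqr_ge0.
  rewrite ger0_norm ?mulr_ge0 ?exprn_ge0 //.
  by apply: ler_wpM2l.
rewrite (exprS B m) (_ : _ + _ = (m.+2%:R ^+ 2 + m.+2%:R) * (B * B ^+ m) * (v - u) ^+ 2); last by ring.
apply: ler_wpM2r; first exact: sqr_ge0.
apply: ler_wpM2r; first by rewrite mulr_ge0 //; lra.
have m0 : 0 <= m.+2%:R :> R by [].
by rewrite -(@natr1 _ m.+2); nra.
Qed.

Lemma pos_exprn_taylor (B : R) m (u v : R) : `|u| <= B -> `|v| <= B -> 1 <= B ->
  `|Num.max 0 v ^+ m.+2 - Num.max 0 u ^+ m.+2 - m.+2%:R * Num.max 0 u ^+ m.+1 * (v - u)|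
    <= 2 * m.+2%:R ^+ 2 * B ^+ m * (v - u) ^+ 2.
Proof.
rewrite (ler_norml u) (ler_norml v) => /andP[uB1 uB2] /andP[vB1 vB2] B1.
have maxB w : - B <= w -> w <= B -> 0 <= Num.max 0 w <= B.
  by move=> w1 w2; case: (leP 0 w) => ?; apply/andP; split; lra.
have := @exprn_taylor B m _ _ (maxB _ uB1 uB2) (maxB _ vB1 vB2) B1.
have Bm : 0 <= B ^+ m by rewrite exprn_ge0 //; lra.
have c0 : 0 <= m.+2%:R ^+ 2 * B ^+ m by rewrite mulr_ge0 // sqr_ge0.
have mm : m.+2%:R <= m.+2%:R ^+ 2 :> R by rewrite expr2 ler_peMl // ler1n.
case: (leP 0 v) => v0; case: (leP 0 u) => u0 hh.
- apply: le_trans hh _; rewrite -2!(mulrA 2); move: (m.+2%:R ^+ 2 * B ^+ m) c0 => c c0.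
  by have := mulr_ge0 c0 (sqr_ge0 (v - u)); lra.
- move: hh; rewrite !expr0n /= !mulr0 !mul0r !subr0 => hh.
  apply: le_trans hh _; rewrite -2!(mulrA 2); have : v ^+ 2 <= (v - u) ^+ 2 by nra.
  move: (m.+2%:R ^+ 2 * B ^+ m) c0 => c c0 h.
  have h3 : 0 <= c * ((v - u) ^+ 2 - v ^+ 2) by apply: mulr_ge0 => //; rewrite subr_ge0.
  by have := mulr_ge0 c0 (sqr_ge0 (v - u)); lra.
- rewrite !expr0n /= in hh *.
  rewrite (_ : 0 - _ - _ = (0 - u ^+ m.+2 - m.+2%:R * u ^+ m.+1 * (0 - u)) - m.+2%:R * u ^+ m.+1 * v); last by ring.
  apply: le_trans (ler_normB _ _) _.
  have um : u ^+ m.+1 <= u * B ^+ m.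
    by rewrite exprS; apply: ler_wpM2l => //; apply: lerXn2r; rewrite ?nnegrE //; lra.
  have h2 : `|m.+2%:R * u ^+ m.+1 * v| <= m.+2%:R ^+ 2 * B ^+ m * (u * - v).
    rewrite normrM (ltr0_norm v0) ger0_norm ?mulr_ge0 ?exprn_ge0 //.
    rewrite [leRHS]mulrA; apply: ler_wpM2r; first lra.
    rewrite -mulrA [X in _ <= _ * X]mulrC; apply: ler_pM => //; exact: exprn_ge0.
  apply: le_trans (lerD hh h2) _.
  rewrite -2!(mulrA 2); move: (m.+2%:R ^+ 2 * B ^+ m) c0 => c c0.
  have h3 : 0 <= c * ((v - u) ^+ 2 - (0 - u) ^+ 2) by apply: mulr_ge0 => //; nra.
  have h4 : 0 <= c * ((v - u) ^+ 2 - u * - v) by apply: mulr_ge0 => //; nra.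
  lra.
- rewrite !expr0n /= !(mulr0, mul0r, subr0, subrr) normr0.
  by rewrite mulr_ge0 ?sqr_ge0 // -mulrA mulr_ge0.
Qed.

(** Truncated powers take the place of smooth cut-offs: each derivative lowers the exponent by one,
    and after [k] of them a positive power is left, still Lipschitz in the bounded function [f]. *)
Lemma Cka_posX I (a : R) (U : set V) k m (f : I -> V -> R) : 0 < a -> a <= 1 -> (k <= m)%N ->
  Cka a U k f -> Cka a U k (fun i x => Num.max 0 (f i x) ^+ m.+1).
Proof.
move=> a0 a1; elim: k m f => [|k ih] m f km hf.
  suff h : Cka a U 0 (fun i x => Num.max 0 (f i x)).
    by apply: Cka_eq (Cka_prod a0 a1 (iota 0 m.+1) (P := predT) (fun _ _ => h)) => i x _;
      rewrite big_const_seq count_predT size_iota iter_mulr_1.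
  case: hf => M [M0 b h]; exists M; split=> // [i x Ux|i x y Ux Uy].
    have := b i x Ux; rewrite !ler_norml => /andP[h1 h2].
    by case: (leP 0 (f i x)) => ?; apply/andP; split; lra.
  apply: le_trans (h i x y Ux Uy); move: (f i x) (f i y) => u v.
  by case: (leP 0 u) => ?; case: (leP 0 v) => ?; rewrite ?subr0 ?sub0r ?normrN ?subrr ?normr0 //;
    rewrite ler_norml; have := ler_norm (v - u); have := lerNnormlW (lexx `|v - u|); move=> *; apply/andP; split; lra.
case: m km => // m km; have [L L0 hL] := Cka_lip a0 a1 hf.
have hk := Cka_down a0 a1 hf; have h1 := ih m f km hk.
have [G G0 bG] := Cka_bnd h1.
case: hf => p [M [hp M0 b t]].
pose B := 1 + M.
have B1 : 1 <= B by rewrite /B; lra.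
have bB i x : U x -> `|f i x| <= B by move=> Ux; have := b i x Ux; rewrite /B; lra.
have Bm : 0 <= B ^+ m by rewrite exprn_ge0 //; lra.
have maxB i x : U x -> `|Num.max 0 (f i x)| <= B.
  move=> Ux; have := bB i x Ux; rewrite !ler_norml => /andP[? ?].
  by case: (leP 0 (f i x)) => ?; apply/andP; split; lra.
have Bn k' : 0 <= B ^+ k' by rewrite exprn_ge0 //; lra.
exists (fun l i x => m.+2%:R * Num.max 0 (f i x) ^+ m.+1 * p l i x),
  (B ^+ m.+2 + (2 * m.+2%:R ^+ 2 * B ^+ m * (L * L) + m.+2%:R * B ^+ m.+1 * M)); split.
- move=> l; apply: Cka_mul => //; last exact: hp.
  by apply: (Cka_scale a0 a1 (c := fun=> m.+2%:R) (B := m.+2%:R)) => // i; rewrite normr_nat.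
- by rewrite !addr_ge0 // !mulr_ge0.
- move=> i x Ux; apply: (le_trans (_ : _ <= B ^+ m.+2)); last by rewrite lerDl addr_ge0 // !mulr_ge0.
  by rewrite normrX; apply: lerXn2r; rewrite ?nnegrE ?maxB //; lra.
move=> i x y Ux Uy; rewrite linZl.
have [l1 l2] := hL i x y Ux Uy.
have sq : (f i y - f i x) ^+ 2 <= L * L * (`|y - x| * `|y - x| `^ a).
  by rewrite expr2; apply: le_trans (ler_norm _) _; rewrite normrM mulrACA; apply: ler_pM.
have := t i x y Ux Uy; move: (lin _ _) => u hu.
have := @pos_exprn_taylor B m _ _ (bB i x Ux) (bB i y Uy) B1.
have mp : `|m.+2%:R * Num.max 0 (f i x) ^+ m.+1| <= m.+2%:R * B ^+ m.+1.
  by rewrite normrM normr_nat normrX; apply: ler_wpM2l => //; apply: lerXn2r; rewrite ?nnegrE ?maxB //; lra.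
move: (Num.max 0 (f i x)) (Num.max 0 (f i y)) mp => s r mp hh.
rewrite (_ : _ - _ - _ = (r ^+ m.+2 - s ^+ m.+2 - m.+2%:R * s ^+ m.+1 * (f i y - f i x)) +
  m.+2%:R * s ^+ m.+1 * (f i y - f i x - u)); last by ring.
apply: le_trans (ler_normD _ _) _.
apply: (le_trans (_ : _ <= 2 * m.+2%:R ^+ 2 * B ^+ m * (L * L * (`|y - x| * `|y - x| `^ a)) +
   m.+2%:R * B ^+ m.+1 * (M * (`|y - x| * `|y - x| `^ a)))).
  apply: lerD.
    by apply: le_trans hh _; apply: ler_wpM2l => //; rewrite !mulr_ge0 // sqr_ge0.
  by rewrite normrM; apply: ler_pM.
by rewrite !mulrA -!mulrDl -!mulrA ler_wpM2r // lerDr.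
Qed.

(** Serves constructions that differ between two kinds of indices: a classical case distinction on
    the index merges the gradients at every level of the recursion. *)
Lemma Cka_merge I (P : I -> Prop) (a : R) (U : set V) k (f : I -> V -> R) :
  Cka a U k (fun (j : {i | P i}) => f (sval j)) ->
  Cka a U k (fun (j : {i | ~ P i}) => f (sval j)) -> Cka a U k f.
Proof.
have both T (u : {i | P i} -> T) (v : {i | ~ P i} -> T) : exists w : I -> T,
    (forall j, w (sval j) = u j) /\ (forall j, w (sval j) = v j).
  exists (fun i => match pselect (P i) with left h => u (exist _ i h) | right h => v (exist _ i h) end).
  by split=> -[i h] /=; case: pselect => // h'; rewrite (Prop_irrelevance h' h).
have cover (Q : I -> Prop) : (forall j : {i | P i}, Q (sval j)) -> (forall j : {i | ~ P i}, Q (sval j)) -> forall i, Q i.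
  by move=> h1 h2 i; case: (pselect (P i)) => h; [exact: (h1 (exist _ i h))|exact: (h2 (exist _ i h))].
elim: k f => [|k ih] f.
  move=> [M [M0 b h]] [N [N0 b' h']]; exists (M + N); split; first exact: addr_ge0.
    apply: cover => j x Ux; [apply: le_trans (b j x Ux) _|apply: le_trans (b' j x Ux) _]; lra.
  apply: cover => j x y Ux Uy; [apply: le_trans (h j x y Ux Uy) _|apply: le_trans (h' j x y Ux Uy) _];
    by apply: ler_wpM2r; rewrite ?powR_ge0 //; lra.
move=> [p [M [hp M0 b h]]] [q [N [hq N0 b' h']]].
have [w hw] := choice (fun l => both _ (p l) (q l)).
have e1 j x : (fun l => w l (sval j) x) = (fun l => p l j x).
  by apply: funext => l; rewrite (proj1 (hw l)).
have e2 j x : (fun l => w l (sval j) x) = (fun l => q l j x).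
  by apply: funext => l; rewrite (proj2 (hw l)).
exists w, (M + N); split.
- move=> l; apply: ih.
    by apply: Cka_eq (hp l) => j x _; rewrite (proj1 (hw l)).
  by apply: Cka_eq (hq l) => j x _; rewrite (proj2 (hw l)).
- exact: addr_ge0.
- apply: cover => j x Ux; [apply: le_trans (b j x Ux) _|apply: le_trans (b' j x Ux) _]; lra.
have W0 (x y : V) : 0 <= `|y - x| * `|y - x| `^ a by rewrite mulr_ge0 ?powR_ge0.
apply: cover => j x y Ux Uy; rewrite ?e1 ?e2.
  by apply: le_trans (h j x y Ux Uy) _; apply: ler_wpM2r; [exact: W0|lra].
by apply: le_trans (h' j x y Ux Uy) _; apply: ler_wpM2r; [exact: W0|lra].
Qed.

End Operations.

(** * Jets and Taylor expansion *)

Section Derivatives.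
Variable R : realType.

Lemma is_deriveP (V : normedModType R) (u : V -> R) (x v : V) (c : R) :
  is_derive x v u c <-> forall e : R, 0 < e -> exists2 d : R, 0 < d &
    forall s : R, `|s| <= d -> `|u (x + s *: v) - u x - c * s| <= e * `|s|.
Proof.
split.
  move=> [du dc] e e0; move: (du); rewrite /derivable => cv.
  have : (fun h => h^-1 *: ((u \o shift x) (h *: v) - u x)) @ 0^' --> c.
    by rewrite -dc; exact: cv.
  move=> /cvgrPdist_le /(_ e e0); rewrite near_withinE => /nbhs_normP [d /= d0 hd].
  exists (d / 2); first by rewrite divr_gt0.
  move=> s sd; case: (eqVneq s 0) => [->|s0].
    by rewrite scale0r addr0 subrr mulr0 subr0 normr0 mulr0.
  have := hd s; rewrite /= sub0r normrN => /(_ _ s0) h.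
  have {}h : `|c - s^-1 *: (u (s *: v + x) - u x)| <= e.
    by apply: h; apply: le_lt_trans sd _; rewrite ltr_pdivrMr // ltr_pMr // ltr1n.
  rewrite -(ler_pM2r (x := `|s|)) ?normr_gt0 // -normrM in h.
  rewrite (_ : u _ - u x - c * s = - ((c - s^-1 *: (u (s *: v + x) - u x)) * s)).
    by rewrite normrN.
  by rewrite [x + _]addrC /GRing.scale /=; field.
move=> h.
have cv : (fun h => h^-1 *: ((u \o shift x) (h *: v) - u x)) @ 0^' --> c.
  apply/cvgrPdist_le => e e0; have [d d0 hd] := h e e0.
  near=> s.
  have s0 : s != 0 by near: s; exact: nbhs_dnbhs_neq.
  have sd : `|s| <= d by near: s; exact: dnbhs0_le.
  have := hd s sd; rewrite [x + _]addrC /= => hs.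
  rewrite -(ler_pM2r (x := `|s|)) ?normr_gt0 // -normrM.
  rewrite (_ : (c - _) * s = - (u (s *: v + x) - u x - c * s)).
    by rewrite normrN.
  by rewrite /GRing.scale /=; field.
split; first by apply/cvg_ex; exists c.
exact: cvg_lim cv.
Unshelve. all: by end_near. Qed.

Lemma is_derive_line (V : normedModType R) (u : V -> R) (x v : V) (p q t c : R) :
  is_derive (x + (p + q * t) *: v) v u c ->
  is_derive t 1 (fun s : R => u (x + (p + q * s) *: v)) (q * c).
Proof.
move=> /is_deriveP h; apply/(@is_deriveP R^o) => e e0.
have q1 : 0 < `|q| + 1 by rewrite ltr_wpDl.
have [d d0 hd] := h (e / (`|q| + 1)) (divr_gt0 e0 q1).
exists (d / (`|q| + 1)); first exact: divr_gt0.
move=> s sd; have := hd (q * s).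
rewrite -(addrA x) -scalerDl (_ : p + q * t + q * s = p + q * (t + s *: (1 : R^o))); last first.
  by rewrite /GRing.scale /=; ring.
rewrite (_ : c * (q * s) = q * c * s); last by ring.
move=> hh; apply: le_trans (hh _) _.
  rewrite normrM; apply: (le_trans (_ : _ <= (`|q| + 1) * `|s|)).
    by apply: ler_wpM2r => //; lra.
  by rewrite mulrC -ler_pdivlMr.
rewrite normrM mulrA; apply: ler_wpM2r => //.
rewrite mulrAC ler_pdivrMr //; apply: ler_wpM2l; first exact: ltW.
lra.
Qed.

Lemma is_derive_uniq (V : normedModType R) (u : V -> R) (x v : V) (c c' : R) :
  is_derive x v u c -> is_derive x v u c' -> c = c'.
Proof. by move=> h h'; rewrite -(@derive_val _ _ _ _ _ _ _ h) -(@derive_val _ _ _ _ _ _ _ h'). Qed.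

Lemma mvt1 (A A1 : R -> R) (a b : R) : a <= b ->
  (forall t, a <= t <= b -> is_derive t 1 A (A1 t)) ->
  exists2 c, a <= c <= b & A b - A a = A1 c * (b - a).
Proof.
move=> ab h.
have [] := @MVT_segment R A A1 a b ab.
- by move=> t; rewrite in_itv /= => /andP[t1 t2]; apply: h; rewrite !ltW.
- apply: derivable_within_continuous => t; rewrite in_itv /= => /h; exact: @ex_derive.
- by move=> c; rewrite in_itv /= => cab e; exists c.
Qed.

Lemma derive_le (A A1 B B1 : R -> R) (T : R) : 0 <= T ->
  (forall t, 0 <= t <= T -> is_derive t 1 A (A1 t)) ->
  (forall t, 0 <= t <= T -> is_derive t 1 B (B1 t)) ->
  (forall t, 0 <= t <= T -> A1 t <= B1 t) -> A 0 <= B 0 -> A T <= B T.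
Proof.
move=> T0 hA hB le1 le0.
have [|c cT] := @mvt1 (B - A) (B1 - A1) 0 T T0.
  by move=> t tT; apply: is_deriveB; [exact: hB|exact: hA].
rewrite !fctE subr0 => e.
have : 0 <= (B1 c - A1 c) * T by rewrite mulr_ge0 // subr_ge0 le1.
rewrite -e; lra.
Qed.

(** Stands in for integration over [0, T]; the second order Taylor estimates iterate it instead of
    using integral remainders. *)
Lemma derive_dist_le (A A1 B B1 : R -> R) (e T : R) : 0 <= T ->
  (forall t, 0 <= t <= T -> is_derive t 1 A (A1 t)) ->
  (forall t, 0 <= t <= T -> is_derive t 1 B (B1 t)) ->
  (forall t, 0 <= t <= T -> `|A1 t - B1 t| <= e) -> A 0 = B 0 -> `|A T - B T| <= e * T.
Proof.
move=> T0 hA hB le1 le0.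
have [|c cT] := @mvt1 (A - B) (A1 - B1) 0 T T0.
  by move=> t tT; apply: is_deriveB; [exact: hA|exact: hB].
rewrite !fctE subr0 le0 subrr subr0 => ->.
by rewrite normrM (ger0_norm T0); apply: ler_wpM2r => //; exact: le1.
Qed.

Lemma is_derive_linear (c s : R) : is_derive s 1 (fun s : R => c * s) c.
Proof.
have := @is_deriveZ _ _ _ id c s (1 : R) 1 (is_derive_id _ _).
by rewrite /GRing.scale /= mulr1.
Qed.

Lemma is_derive_square (c s : R) : is_derive s 1 (fun s : R => c * s ^+ 2) (2 * c * s).
Proof.
have := @is_deriveZ _ _ _ _ c s (1 : R) _ (is_deriveX 2 (is_derive_id s (1 : R))).
rewrite /GRing.scale /= expr1 mulr1 (_ : c * _ = 2 * c * s) //; ring.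
Qed.

Section Vector.
Variable n : nat.
Local Notation V := 'rV[R]_n.

(** The box spanned by [x] and [y] in place of the segment: a path that changes one coordinate at a
    time stays in it, and only derivatives along the axes are available. *)
Definition between (x y z : V) := forall l, exists2 t : R, 0 <= t <= 1 &
  z 0 l = x 0 l + t * (y 0 l - x 0 l).

Lemma between_norm x y z r : `|x| <= r -> `|y| <= r -> between x y z -> `|z| <= r.
Proof.
move=> xr yr h; apply: norm_le_coord; first exact: le_trans xr.
move=> l; have [t /andP[t0 t1] ->] := h l.
have := le_trans (coord_le_norm x l) xr; have := le_trans (coord_le_norm y l) yr.
rewrite !ler_norml => /andP[? ?] /andP[? ?]; apply/andP; split; nra.
Qed.

Lemma between_dist x y z : between x y z -> `|z - x| <= `|y - x|.
Proof.
move=> h; apply: norm_le_coord => // l; have [t /andP[t0 t1] e] := h l.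
rewrite !mxE e addrAC subrr add0r normrM (ger0_norm t0).
have := coord_le_norm (y - x) l; rewrite !mxE => hl.
by apply: le_trans hl; rewrite ler_piMl.
Qed.

Lemma path_mvt (u : V -> R) (p : 'I_n -> V -> R) (a : 'I_n -> R) (B : R) x y : 0 <= B ->
  (forall l z, between x y z -> is_derive z 'e_l u (p l z)) ->
  (forall l z, between x y z -> `|p l z - a l| <= B) ->
  `|u y - u x - lin a (y - x)| <= n%:R * B * `|y - x|.
Proof.
move=> B0 du dB.
(* Consecutive [z m] differ in one coordinate, so the mean value theorem in one variable applies to
   each step. *)
pose z m : V := \row_l if (l < m)%N then y 0 l else x 0 l.
have z0 : z 0%N = x by apply/rowP => l; rewrite mxE ltn0.
have zn : z n = y by apply/rowP => l; rewrite mxE ltn_ord.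
have tel : u y - u x = \sum_(m < n) (u (z m.+1) - u (z m)).
  by rewrite -(big_mkord xpredT (fun m => u (z m.+1) - u (z m))) telescope_sumr // z0 zn.
rewrite tel /lin -sumrB; apply: le_trans (ler_norm_sum _ _ _) _.
apply: (le_trans (_ : _ <= \sum_(m < n) B * `|y - x|)); last first.
  by rewrite sumr_const card_ord -mulrA mulr_natl.
apply: ler_sum => m _.
have zs t : z m + (0 + (y - x) 0 m * t) *: 'e_m =
    \row_l (if (l < m)%N then y 0 l else if l == m then x 0 l + t * (y 0 l - x 0 l) else x 0 l).
  apply/rowP => l; rewrite !mxE eqxx /= add0r; case: ltngtP => lm.
  - by rewrite (_ : l == m = false) ?mulr0 ?addr0 //; apply/eqP => e; rewrite e ltnn in lm.
  - by rewrite (_ : l == m = false) ?mulr0 ?addr0 //; apply/eqP => e; rewrite e ltnn in lm.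
  - by rewrite (val_inj lm) eqxx mulr1 mulrC.
have bt t : 0 <= t <= 1 -> between x y (z m + (0 + (y - x) 0 m * t) *: 'e_m).
  move=> t01 l; rewrite zs mxE; case: ifP => _.
    by exists 1; rewrite ?ler01 ?lexx // mul1r addrC subrK.
  case: eqP => [->|_]; first by exists t.
  by exists 0; rewrite ?lexx ?ler01 // mul0r addr0.
have [|c c01 e] := @mvt1 (fun t => u (z m + (0 + (y - x) 0 m * t) *: 'e_m))
    (fun t => (y - x) 0 m * p m (z m + (0 + (y - x) 0 m * t) *: 'e_m)) 0 1 ler01.
  by move=> t t01; apply: is_derive_line; apply: du; exact: bt.
have e1 : z m + (0 + (y - x) 0 m * 1) *: 'e_m = z m.+1.
  rewrite zs; apply/rowP => l; rewrite !mxE ltnS; case: ltngtP => lm //.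
  - by rewrite (_ : l == m = false) //; apply/eqP => el; rewrite el ltnn in lm.
  - by rewrite (val_inj lm) eqxx mul1r addrC subrK.
rewrite e1 mulr0 addr0 scale0r addr0 subr0 mulr1 in e.
rewrite e mulrC -mulrBl normrM; apply: ler_pM => //; last exact: coord_le_norm.
by apply: dB; exact: bt.
Qed.

Lemma is_derive_coord (u : V -> R) x l (t s c : R) :
  is_derive (x + (t + s) *: 'e_l) 'e_l u c ->
  is_derive s 1 (fun s : R => u (x + (t + s) *: 'e_l)) c.
Proof.
move=> h; have := @is_derive_line _ u x 'e_l t 1 s c.
rewrite !mul1r => /(_ h).
by rewrite (_ : (fun s0 => _) = (fun s0 => u (x + (t + s0) *: 'e_l))) //;
  apply: funext => s0; rewrite mul1r.
Qed.

Lemma mixed_mvt (u pi q : V -> R) (x : V) (i j : 'I_n) (s : R) : 0 <= s ->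
  (forall z, is_derive z 'e_i u (pi z)) ->
  (forall z, is_derive z 'e_j pi (q z)) ->
  exists t1 t2, [/\ 0 <= t1 <= s, 0 <= t2 <= s &
    u (x + s *: 'e_i + s *: 'e_j) - u (x + s *: 'e_i)
      - u (x + s *: 'e_j) + u x = q (x + t1 *: 'e_i + t2 *: 'e_j) * s * s].
Proof.
move=> s0 du dpi.
pose A t := u ((x + s *: 'e_j) + (0 + t) *: 'e_i) - u (x + (0 + t) *: 'e_i).
have [|t1 t1s e1] := @mvt1 A (fun t => pi ((x + s *: 'e_j) + (0 + t) *: 'e_i) - pi (x + (0 + t) *: 'e_i)) 0 s s0.
  by move=> t ts; apply: is_deriveB; apply: is_derive_coord; exact: du.
have [|t2 t2s e2] := @mvt1 (fun t => pi ((x + t1 *: 'e_i) + (0 + t) *: 'e_j))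
   (fun t => q ((x + t1 *: 'e_i) + (0 + t) *: 'e_j)) 0 s s0.
  by move=> t ts; apply: is_derive_coord; exact: dpi.
exists t1, t2; split=> //.
rewrite /A !add0r !scale0r !addr0 subr0 in e1; rewrite !add0r scale0r addr0 subr0 in e2.
rewrite -e2 [x + t1 *: _ + _]addrAC -e1 [x + s *: _ + s *: _]addrAC; ring.
Qed.

(** The second difference of [u] over a square of side [s] is s^2 times a value of [q] and also s^2
    times a value of [r], both taken near [x]; continuity at [x] does the rest. *)
Lemma schwarz (u pi pj q r : V -> R) (x : V) (i j : 'I_n) :
  (forall z, is_derive z 'e_i u (pi z)) ->
  (forall z, is_derive z 'e_j u (pj z)) ->
  (forall z, is_derive z 'e_j pi (q z)) ->
  (forall z, is_derive z 'e_i pj (r z)) ->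
  (forall e : R, 0 < e -> exists2 d : R, 0 < d & forall z, `|z - x| <= d ->
     `|q z - q x| <= e /\ `|r z - r x| <= e) ->
  q x = r x.
Proof.
move=> dui duj dq dr cont; apply/eqP; rewrite -subr_eq0 -normr_le0.
apply/ler_addgt0Pl => e e0; rewrite addr0.
have [d d0 hd] := cont (e / 2) (divr_gt0 e0 (ltr0Sn _ 1)).
pose s := d / 2; have s0 : 0 < s by rewrite divr_gt0.
have [t1 [t2 [t1s t2s e1]]] := mixed_mvt x (ltW s0) dui dq.
have [t3 [t4 [t3s t4s e2]]] := mixed_mvt x (ltW s0) duj dr.
have near (t t' : R) k m : 0 <= t <= s -> 0 <= t' <= s ->
    `|x + t *: 'e_k + t' *: 'e_m - x| <= d.
  move=> /andP[a0 a1] /andP[b0 b1]; rewrite -(addrA x) addrAC subrr add0r.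
  apply: le_trans (ler_normD _ _) _; rewrite !normrZ !norm_delta_mx !ger0_norm // !mulr1.
  have : d = s + s by rewrite /s; field.
  lra.
have [h1 _] := hd _ (near t1 t2 i j t1s t2s).
have [_ h2] := hd _ (near t3 t4 j i t3s t4s).
have E : q (x + t1 *: 'e_i + t2 *: 'e_j) =
         r (x + t3 *: 'e_j + t4 *: 'e_i).
  apply: (mulIf (x := s)); first by rewrite gt_eqF.
  apply: (mulIf (x := s)); first by rewrite gt_eqF.
  rewrite -e1 -e2 [x + s *: _ + _]addrAC; ring.
rewrite E in h1; rewrite (_ : q x - r x = (r (x + t3 *: 'e_j + t4 *: 'e_i) - r x) -
  (r (x + t3 *: 'e_j + t4 *: 'e_i) - q x)); last by ring.
apply: le_trans (ler_normB _ _) _; lra.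
Qed.

Lemma taylor_is_derive (a M d : R) (u : V -> R) x l (c : R) : 0 < a -> 0 <= M -> 0 < d ->
  (forall s : R, `|s| <= d -> `|u (x + s *: 'e_l) - u x - c * s| <= M * (`|s| * `|s| `^ a)) ->
  is_derive x 'e_l u c.
Proof.
move=> a0 M0 d0 h; apply/is_deriveP => e e0.
have M1 : 0 < M + 1 by lra.
have [d' d'0 hd] := powR_small a0 (divr_gt0 e0 M1).
exists (Num.min d d'); first by rewrite lt_min d0.
move=> s; rewrite le_min => /andP[sd sd']; apply: le_trans (h s sd) _.
rewrite [`|s| * _]mulrC mulrA; apply: ler_wpM2r => //.
apply: (le_trans (_ : _ <= (M + 1) * (e / (M + 1)))); last by rewrite mulrC divfK // gt_eqF.
apply: ler_pM => //; rewrite ?hd ?normr_ge0 //; lra.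
Qed.

Lemma taylor_on_is_derive I (a M : R) (f : I -> V -> R) p i x l : 0 < a -> 0 <= M ->
  taylor_on a setT f p M -> is_derive x 'e_l (f i) (p l i x).
Proof.
move=> a0 M0 t; apply: (@taylor_is_derive a M 1) => // s _.
have := t i x (x + s *: 'e_l) Logic.I Logic.I.
by rewrite [x + _ - x]addrAC subrr add0r lin_delta normrZ norm_delta_mx mulr1.
Qed.

(* [D w] plays the part of the derivative of [D [::]] along the word [w], the head
   of the word being the last direction differentiated. *)
Definition jets I k (D : seq 'I_n -> I -> V -> R) := forall w l i x, (size w < k)%N ->
  is_derive x 'e_l (D w i) (D (l :: w) i x).

Lemma Cka_jets I (a : R) k (f : I -> V -> R) : 0 < a -> Cka a setT k f ->
  exists D : seq 'I_n -> I -> V -> R, [/\ D [::] = f, jets k D &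
    forall w, (size w <= k)%N -> Cka a setT (k - size w) (D w)].
Proof.
move=> a0; elim: k f => [|k ih] f.
  by move=> hf; exists (fun _ => f); split=> // -[].
move=> hf; have [p [M [hp M0 b t]]] := hf.
have [D hD] := choice (fun l => ih _ (hp l)).
(* The last letter of a word is differentiated first, so the recursion strips it with [last] and
   passes the remaining prefix to the jet of that partial derivative. *)
exists (fun w => if w is v :: w' then D (last v w') (belast v w') else f); split=> //.
  move=> [|v w] l i x /=; first by move=> _; have [-> _ _] := hD l; exact: taylor_on_is_derive t.
  rewrite ltnS => wk; have [_ hj _] := hD (last v w).
  by apply: hj; rewrite size_belast.
move=> [|v w] //= wk; have [_ _ h] := hD (last v w).
by rewrite subSS -{1}(size_belast v w); apply: h; rewrite size_belast.
Qed.

Definition cball (r : R) : set V := [set x | `|x| <= r].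

(** On the box between [x] and [y] each partial derivative stays within N |y - x|^a of its value at
    [x], so [path_mvt] gives a remainder of order 1 + a. Pointwise derivatives thereby yield an
    expansion with one constant. *)
Lemma mvt_taylor I (a : R) (U : set V) (f : I -> V -> R) p : 0 < a ->
  (forall x y z, U x -> U y -> between x y z -> U z) ->
  (forall i z l, U z -> is_derive z 'e_l (f i) (p l i z)) ->
  (forall l, exists2 N : R, 0 <= N & holder_on a U (p l) N) ->
  exists2 M : R, 0 <= M & taylor_on a U f p M.
Proof.
move=> a0 Ub df hp.
have [N N0 hN] : exists2 N : R, 0 <= N & forall l, holder_on a U (p l) N.
  apply: fin_unif hp => l N N' NN h i x y Ux Uy.
  by apply: le_trans (h i x y Ux Uy) _; apply: ler_wpM2r; rewrite ?powR_ge0.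
exists (n%:R * N); first by rewrite mulr_ge0.
move=> i x y Ux Uy.
have P0 : 0 <= N * `|y - x| `^ a by rewrite mulr_ge0 ?powR_ge0.
apply: le_trans (path_mvt (p := fun l => p l i) P0 _ _) _.
- by move=> l z bz; apply: df; exact: Ub bz.
- move=> l z bz; apply: le_trans (hN l i x z Ux (Ub _ _ _ Ux Uy bz)) _.
  by apply: ler_wpM2l => //; apply: powR_mono => //; exact: between_dist.
by rewrite (_ : n%:R * _ * _ = (n%:R * N) * (`|y - x| * `|y - x| `^ a)) //; ring.
Qed.

Lemma jets_Cka I (a r : R) k (D : seq 'I_n -> I -> V -> R) : 0 < a -> a <= 1 -> jets k D ->
  (forall w, (size w <= k)%N -> exists2 M : R, 0 <= M & bounded_on (cball r) (D w) M) ->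
  (forall w, (size w = k)%N -> exists2 M : R, 0 <= M & holder_on a (cball r) (D w) M) ->
  forall j w, (size w + j = k)%N -> Cka a (cball r) j (D w).
Proof.
move=> a0 a1 jD bD hD; elim=> [|j ih] w wj.
  have [M M0 b] : exists2 M : R, 0 <= M & bounded_on (cball r) (D w) M.
    by apply: bD; rewrite -wj addn0.
  have [N N0 h] : exists2 M : R, 0 <= M & holder_on a (cball r) (D w) M.
    by apply: hD; rewrite -wj addn0.
  exists (M + N); split; first exact: addr_ge0.
    by move=> i x Ux; apply: le_trans (b i x Ux) _; lra.
  move=> i x y Ux Uy; apply: le_trans (h i x y Ux Uy) _; apply: ler_wpM2r; rewrite ?powR_ge0 //; lra.
have [M M0 b] : exists2 M : R, 0 <= M & bounded_on (cball r) (D w) M.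
  by apply: bD; rewrite -wj leq_addr.
have hp l : Cka a (cball r) j (D (l :: w)) by apply: ih; rewrite /= addSnnS.
have [N N0 hN] : exists2 N : R, 0 <= N & taylor_on a (cball r) (D w) (fun l => D (l :: w)) N.
  apply: mvt_taylor => // [x y z|i z l _|l]; first exact: between_norm.
    by apply: jD; rewrite -wj addnS ltnS leq_addr.
  by have [N [N0 _ h]] := Cka_le a0 a1 (leq0n j) (hp l); exists N.
exists (fun l => D (l :: w)), (M + N); split=> //.
- exact: addr_ge0.
- by move=> i x Ux; apply: le_trans (b i x Ux) _; rewrite lerDl.
move=> i x y Ux Uy; apply: le_trans (hN i x y Ux Uy) _.
by apply: ler_wpM2r; [rewrite mulr_ge0 ?powR_ge0|rewrite lerDr].
Qed.

End Vector.
End Derivatives.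

(** * Bounds for normalised nonnegative functions *)

Section Bounds.
Variables (R : realType) (n : nat) (I : Type) (a : R) (k : nat).
Hypotheses (a0 : 0 < a) (a1 : a <= 1).
Local Notation V := 'rV[R]_n.
Implicit Types (D : seq 'I_n -> I -> V -> R).

Definition top_holder D := forall w, size w = k ->
  exists2 M : R, 0 <= M & holder_on a setT (D w) M.

Definition locally_bounded (f : I -> V -> R) := forall r : R,
  exists2 M : R, 0 <= M & bounded_on (cball r) f M.

Lemma top_holder_unif D : top_holder D ->
  exists2 M : R, 0 <= M & forall w : k.-tuple 'I_n, holder_on a setT (D w) M.
Proof.
move=> h; apply: fin_unif => [w M N MN hM i x y Ux Uy|w]; last by apply: h; rewrite size_tuple.
by apply: le_trans (hM i x y Ux Uy) _; apply: ler_wpM2r; rewrite ?powR_ge0.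
Qed.

(** An iterated unit difference of [D [::]] along [w] is at most 2^|w| C, and by the mean value
    theorem it is a value of [D w] at some point. Where that point lies inside the larger ball is
    irrelevant afterwards. *)
Lemma unit_difference_mvt D w : jets k D -> (size w <= k)%N -> forall i (r C : R),
  (forall x : V, `|x| <= r + (size w)%:R -> `|D [::] i x| <= C) ->
  forall x : V, `|x| <= r -> exists2 z, `|z| <= r + (size w)%:R & `|D w i z| <= 2 ^+ size w * C.
Proof.
elim: w D => [|l w ih] D jD wk i r C bD x xr.
  by exists x; rewrite ?addr0 // expr0 mul1r bD // addr0.
pose D' v i x := D v i (x + (1 : R) *: 'e_l) - D v i x.
have jD' : jets k D'.
  move=> v m i' y vk; rewrite /D'; apply: is_deriveB; last exact: jD.
  have /is_deriveP h := jD v m i' (y + (1 : R) *: 'e_l) vk.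
  by apply/is_deriveP => e /h [d d0 hd]; exists d => // s /hd; rewrite (addrAC y).
have n1 (y : V) : `|y| <= r + (size w)%:R -> `|y + (1 : R) *: 'e_l| <= r + (size w).+1%:R.
  move=> yr; apply: le_trans (ler_normD _ _) _.
  by rewrite scale1r norm_delta_mx -natr1; lra.
have [|z zr hz] := ih D' jD' (ltnW wk) i r (2 * C) _ x xr.
  move=> y yr; apply: le_trans (ler_normB _ _) _.
  have := bD _ (n1 y yr); have : `|D [::] i y| <= C by apply: bD; rewrite /= -natr1; lra.
  by move=> /=; lra.
have [|c /andP[c0 c1] e] := @mvt1 _ (fun t => D w i (z + (0 + t) *: 'e_l))
   (fun t => D (l :: w) i (z + (0 + t) *: 'e_l)) 0 1 ler01.
  by move=> t _; apply: is_derive_coord; exact: jD.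
rewrite !add0r scale0r addr0 subr0 mulr1 in e.
exists (z + c *: 'e_l).
  apply: le_trans (ler_normD _ _) _; rewrite normrZ norm_delta_mx mulr1 ger0_norm //=.
  by rewrite -natr1; lra.
by rewrite -e /= exprSr -mulrA; exact: hz.
Qed.

(** Downward induction on the length of [w]. At the top the Hölder seminorm carries the bound from
    the point given by [unit_difference_mvt] to [x]; below, the bound already found on the next
    order does. *)
Lemma interpolation D : jets k D -> top_holder D -> locally_bounded (D [::]) ->
  forall w, (size w <= k)%N -> locally_bounded (D w).
Proof.
move=> jD tD bD w wk; move: (subnK wk).
move: (k - size w)%N => j; elim: j w {wk} => [|j ih] w wk r.
  rewrite add0n in wk; have [M M0 hM] := tD w wk.
  pose s := `|r| + (size w)%:R.
  have [C C0 bC] := bD s; exists (2 ^+ size w * C + M * (r + s) `^ a).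
    by rewrite addr_ge0 // mulr_ge0 ?powR_ge0 // exprn_ge0.
  move=> i x xr.
  have xr' : `|x| <= `|r| by apply: le_trans xr _; exact: ler_norm.
  have [||z zr hz] := unit_difference_mvt (w := w) jD _ (i := i) (r := `|r|) (C := C) _ xr'.
  - by rewrite wk.
  - by move=> y yr; apply: bC.
  have h := hM i z x Logic.I Logic.I.
  have : `|x - z| `^ a <= (r + s) `^ a.
    apply: powR_mono => //; apply: le_trans (ler_normB _ _) _; apply: lerD => //.
  move=> hp; have {}hp := ler_wpM2l M0 hp.
  have := ler_normD (D w i z) (D w i x - D w i z); rewrite addrCA subrr addr0.
  lra.
pose s := `|r| + (size w)%:R.
have [N N0 bN] : exists2 N : R, 0 <= N & forall l, bounded_on (cball s) (D (l :: w)) N.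
  apply: fin_unif => [l M M' MM h i x Ux|l]; first exact: le_trans (h i x Ux) MM.
  by apply: ih; rewrite /= addnS -addSn.
have wk' : (size w < k)%N by rewrite -wk addSn ltnS leq_addl.
have [C C0 bC] := bD s; exists (2 ^+ size w * C + n%:R * N * (`|r| + s)).
  by rewrite addr_ge0 // mulr_ge0 ?exprn_ge0 // ?mulr_ge0 // /s ?addr_ge0.
move=> i x xr.
have xr' : `|x| <= `|r| by apply: le_trans xr _; exact: ler_norm.
have [||z zr hz] := unit_difference_mvt (w := w) jD _ (i := i) (r := `|r|) (C := C) _ xr'.
- exact: ltnW.
- by move=> y yr; apply: bC.
have xs : `|x| <= s by apply: le_trans xr' _; rewrite /s lerDl.
have := path_mvt (u := D w i) (p := fun l => D (l :: w) i) (a := fun=> 0) (x := z) (y := x) N0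
  (fun l y _ => jD w l i y wk').
rewrite lin0l subr0 => /(_ _) h.
have {}h : `|D w i x - D w i z| <= n%:R * N * `|x - z|.
  by apply: h => l y bt; rewrite subr0; apply: bN; exact: between_norm bt.
have d : `|x - z| <= `|r| + s by apply: le_trans (ler_normB _ _) _; exact: lerD.
have := ler_wpM2l (mulr_ge0 (ler0n R n) N0) d.
have := ler_normD (D w i z) (D w i x - D w i z); rewrite addrCA subrr addr0.
lra.
Qed.

Hypothesis hk : (k == 2)%N || (k == 3)%N.

(** For k = 2 the seminorm bounds each of the two increments. For k = 3 it does not, as third
    derivatives are not yet known to be bounded; in the symmetric sum only a difference of third
    derivatives remains, which the seminorm controls. *)
Lemma second_symmetric D : jets k D -> top_holder D -> forall r : R,
  exists2 C : R, 0 <= C & forall (l m : 'I_n) i x (t : R), `|t| <= r ->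
    `|D [:: m; m] i (x + t *: 'e_l) + D [:: m; m] i (x - t *: 'e_l)
       - 2 * D [:: m; m] i x| <= C.
Proof.
move=> jD tD r; have [M M0 hM] := top_holder_unif tD.
have rr : r <= `|r| by exact: ler_norm.
case/orP: hk => /eqP ek.
  exists (2 * (M * `|r| `^ a)); first by rewrite !mulr_ge0 // powR_ge0.
  move=> l m i x t tr.
  have sz : size [:: m; m] == k by rewrite ek.
  have h := hM (Tuple sz); rewrite /= in h.
  have := h i x (x + t *: 'e_l) Logic.I Logic.I.
  have := h i x (x - t *: 'e_l) Logic.I Logic.I.
  rewrite ![x + _ - x]addrAC subrr !add0r normrN !normrZ norm_delta_mx mulr1.
  have : `|t| `^ a <= `|r| `^ a by apply: powR_mono => //; exact: le_trans rr.
  move=> /(ler_wpM2l M0) hp h1 h2.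
  rewrite (_ : _ - 2 * _ = (D [:: m; m] i (x + t *: 'e_l) - D [:: m; m] i x) +
     (D [:: m; m] i (x - t *: 'e_l) - D [:: m; m] i x)); last by ring.
  by apply: le_trans (ler_normD _ _) _; lra.
exists (`|r| * (M * (2 * `|r|) `^ a)); first by rewrite !mulr_ge0 // powR_ge0.
move=> l m i x t tr.
have sz : size [:: l; m; m] == k by rewrite ek.
have h := hM (Tuple sz); rewrite /= in h.
have dl (q s : R) : is_derive s 1 (fun s : R => D [:: m; m] i (x + (0 + q * s) *: 'e_l))
    (q * D [:: l; m; m] i (x + (0 + q * s) *: 'e_l)).
  by apply: is_derive_line; apply: jD; rewrite ek.
have := @derive_dist_le R _ _ (cst (2 * D [:: m; m] i x)) (cst 0) (`|r| * (M * (2 * `|r|) `^ a)) 1 ler01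
  (fun s _ => is_deriveD (dl t s) (dl (- t) s)) (fun s _ => is_derive_cst _ _ _).
rewrite !fctE !mulr1 !add0r scaleNr; apply.
  move=> s /andP[s0 s1]; rewrite subr0 !add0r !mulNr -mulrBr normrM.
  apply: ler_pM => //; first exact: le_trans rr.
  apply: le_trans (h i _ _ Logic.I Logic.I) _; apply: ler_wpM2l => //; apply: powR_mono => //.
  rewrite opprD addrACA subrr add0r scaleNr opprK -scalerDl normrZ norm_delta_mx mulr1.
  have -> : t * s + t * s = 2 * (t * s) by ring.
  rewrite !normrM normr_nat; apply: ler_wpM2l => //.
  rewrite (ger0_norm s0); apply: (le_trans (_ : _ <= `|t|)); first by rewrite ler_piMr.
  exact: le_trans rr.
by rewrite !mulr0 scale0r !addr0; ring.
Qed.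

(** [second_symmetric] is integrated twice along the segment. The first order terms at t and - t
    cancel, so the gradient at [x], not bounded a priori, does not enter. *)
Lemma even_taylor D : jets k D -> top_holder D -> forall r : R,
  exists2 C : R, 0 <= C & forall (l : 'I_n) i x (t : R), `|t| <= r ->
    `|D [::] i (x + t *: 'e_l) + D [::] i (x - t *: 'e_l)
       - (2 * D [::] i x + t ^+ 2 * D [:: l; l] i x)| <= C.
Proof.
move=> jD tD r; have [C C0 hC] := second_symmetric jD tD r.
have k1 : (1 < k)%N by case/orP: hk => /eqP ->.
exists (r ^+ 2 * C); first by rewrite mulr_ge0 // sqr_ge0.
move=> l i x t tr.
have d1 (q s : R) : is_derive s 1 (fun s : R => D [::] i (x + (0 + q * s) *: 'e_l))
    (q * D [:: l] i (x + (0 + q * s) *: 'e_l)).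
  by apply: is_derive_line; apply: jD; exact: ltnW.
have d2 (q s : R) : is_derive s 1 (fun s : R => D [:: l] i (x + (0 + q * s) *: 'e_l))
    (q * D [:: l; l] i (x + (0 + q * s) *: 'e_l)).
  by apply: is_derive_line; exact: jD.
have d2' (q s : R) : is_derive s 1 (fun s : R => q * D [:: l] i (x + (0 + q * s) *: 'e_l))
    (q * (q * D [:: l; l] i (x + (0 + q * s) *: 'e_l))).
  by have := @is_deriveZ _ _ _ _ q _ _ _ (d2 q s).
have q2 : r ^+ 2 * C >= 0 by rewrite mulr_ge0 // sqr_ge0.
have step (s : R) : 0 <= s <= 1 ->
   `|(t * D [:: l] i (x + (0 + t * s) *: 'e_l) +
      - t * D [:: l] i (x + (0 + - t * s) *: 'e_l)) -
      (2 * (t ^+ 2 * D [:: l; l] i x) * s)| <= r ^+ 2 * C.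
  move=> /andP[s0 s1].
  have := @derive_dist_le R _ _ _ _ (r ^+ 2 * C) s s0
    (fun s _ => is_deriveD (d2' t s) (d2' (- t) s)) (fun s _ => is_derive_linear (2 * (t ^+ 2 * D [:: l; l] i x)) s).
  rewrite !fctE => h; apply: le_trans (h _ _) _.
  - move=> v /andP[v0 v1]; rewrite !add0r !mulNr !scaleNr.
    rewrite (_ : _ - _ = t ^+ 2 * (D [:: l; l] i (x + (t * v) *: 'e_l) +
      D [:: l; l] i (x - (t * v) *: 'e_l) - 2 * D [:: l; l] i x)); last by ring.
    have t2 : t ^+ 2 <= r ^+ 2 by rewrite -[t ^+ 2]ger0_norm ?sqr_ge0 // normrX lerXn2r // nnegrE //; exact: le_trans tr.
    rewrite normrM (ger0_norm (sqr_ge0 _)); apply: ler_pM => //; first exact: sqr_ge0.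
    apply: hC; rewrite normrM (ger0_norm v0); apply: le_trans tr; rewrite ler_piMr //; lra.
  - by rewrite !mulr0 !addr0 scale0r !addr0; ring.
  - by rewrite ler_piMr.
have := @derive_dist_le R _ _ _ _ (r ^+ 2 * C) 1 ler01
  (fun s _ => is_deriveD (d1 t s) (d1 (- t) s))
  (fun s _ => is_deriveD (is_derive_cst (2 * D [::] i x) s 1) (is_derive_square (t ^+ 2 * D [:: l; l] i x) s)).
rewrite !fctE !mulr1 !add0r scaleNr expr1n !mulr1; apply.
  by move=> s s01; have := step s s01; rewrite !add0r; exact.
by rewrite !mulr0 scale0r !addr0 expr0n /= mulr0; ring.
Qed.

Fixpoint sign_sum (u : V -> R) (x : V) (w : seq 'I_n) (z : V) : R :=
  if w is l :: w' then sign_sum u x w' (z + x 0 l *: 'e_l) +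
    sign_sum u x w' (z - x 0 l *: 'e_l)
  else u z.

Lemma sign_sum_ge0 (u : V -> R) (x : V) w z : (forall y, 0 <= u y) -> 0 <= sign_sum u x w z.
Proof. by move=> u0; elim: w z => //= l w ih z; rewrite addr_ge0. Qed.

Lemma sign_sum_ge (u : V -> R) (x : V) w z : (forall y, 0 <= u y) ->
  u (z + \sum_(l <- w) x 0 l *: 'e_l) <= sign_sum u x w z.
Proof.
move=> u0; elim: w z => [|l w ih] z /=; first by rewrite big_nil addr0.
rewrite big_cons addrA; apply: le_trans (ih _) _.
by rewrite lerDl sign_sum_ge0.
Qed.

(** Each further coordinate doubles the sum: [even_taylor] expands the value, and [second_symmetric]
    moves the pure second derivatives back to the common centre. Mixed derivatives never arise. *)
Lemma sign_sum_taylor D (r : R) w : jets k D -> top_holder D -> exists2 E : R, 0 <= E &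
  forall i x z, `|x| <= r -> `|sign_sum (D [::] i) x w z - 2 ^+ size w *
    (D [::] i z + 2^-1 * \sum_(m <- w) x 0 m ^+ 2 * D [:: m; m] i z)| <= E.
Proof.
move=> jD tD; have [C C0 hC] := even_taylor jD tD r.
have [C' C'0 hC'] := second_symmetric jD tD r.
elim: w => [|l w [E E0 hE]].
  by exists 0 => // i x z xr /=; rewrite big_nil mulr0 addr0 expr0 mul1r subrr normr0.
have S0 : 0 <= \sum_(m <- w) r ^+ 2 * C' by apply: sumr_ge0 => m _; rewrite mulr_ge0 // sqr_ge0.
exists (2 * E + 2 ^+ size w * (C + 2^-1 * \sum_(m <- w) r ^+ 2 * C')).
  by rewrite addr_ge0 ?mulr_ge0 ?exprn_ge0 // addr_ge0 // mulr_ge0 // invr_ge0.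
move=> i x z xr; rewrite big_cons /=.
have := hE i x (z + x 0 l *: 'e_l) xr; have := hE i x (z - x 0 l *: 'e_l) xr.
have xl : `|x 0 l| <= r by apply: le_trans (coord_le_norm _ _) xr.
have := hC l i z _ xl.
have : `|\sum_(m <- w) x 0 m ^+ 2 * D [:: m; m] i (z + x 0 l *: 'e_l) +
   \sum_(m <- w) x 0 m ^+ 2 * D [:: m; m] i (z - x 0 l *: 'e_l) -
   2 * \sum_(m <- w) x 0 m ^+ 2 * D [:: m; m] i z| <= \sum_(m <- w) r ^+ 2 * C'.
  rewrite big_distrr /= -big_split /= -sumrB; apply: le_trans (ler_norm_sum _ _ _) _.
  apply: ler_sum => m _.
  rewrite (_ : _ - _ = x 0 m ^+ 2 * (D [:: m; m] i (z + x 0 l *: 'e_l) +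
    D [:: m; m] i (z - x 0 l *: 'e_l) - 2 * D [:: m; m] i z)); last by ring.
  rewrite normrM; apply: ler_pM => //; last exact: hC'.
  rewrite normrX lerXn2r ?nnegrE //; first exact: le_trans xl.
  by apply: le_trans (coord_le_norm _ _) xr.
set zp := z + _; set zm := z - _.
set s1 := sign_sum _ _ _ zp; set s2 := sign_sum _ _ _ zm.
set A := \sum_(m <- w) _ * D _ i zp; set B := \sum_(m <- w) _ * D _ i zm.
set Z := \sum_(m <- w) _ * D _ i z; set S := \sum_(m <- w) _ * C'.
set h1 := D _ i zp; set h2 := D _ i zm; set h3 := D _ _ z; set h4 := D _ _ z.
move=> e1 e2 e3 e4.
have P0 : 0 <= 2 ^+ size w :> R by rewrite exprn_ge0.
rewrite exprS; move: (2 ^+ size w) P0 e3 e4 => P P0 e3 e4.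
rewrite (_ : _ - _ = (s1 - P * (h1 + 2^-1 * A)) + (s2 - P * (h2 + 2^-1 * B)) +
   P * ((h1 + h2 - (2 * h3 + x 0 l ^+ 2 * h4)) + 2^-1 * (A + B - 2 * Z))); last by field.
apply: le_trans (ler_normD _ _) _; apply: lerD.
  by apply: le_trans (ler_normD _ _) _; lra.
rewrite normrM (ger0_norm P0); apply: ler_wpM2l => //.
apply: le_trans (ler_normD _ _) _; apply: lerD => //.
by rewrite normrM (@ger0_norm _ (2^-1)) ?invr_ge0 //; apply: ler_wpM2l => //; rewrite invr_ge0.
Qed.

(* A nonnegative function is at most the sum of its values over all sign
   changes of the coordinates; odd Taylor terms cancel in that sum, which is
   therefore controlled by the value and the pure second derivatives at 0. *)
Lemma nonneg_locally_bounded D : jets k D -> top_holder D ->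
  (forall i x, 0 <= D [::] i x) -> (forall i, D [::] i 0 <= 1) ->
  (forall i l, D [:: l; l] i 0 <= 1) -> locally_bounded (D [::]).
Proof.
move=> jD tD D0 h0 h2 r; have [E E0 hE] := sign_sum_taylor r (index_enum 'I_n) jD tD.
have S0 : 0 <= \sum_(m < n) r ^+ 2 by apply: sumr_ge0 => m _; exact: sqr_ge0.
exists (E + 2 ^+ size (index_enum 'I_n) * (1 + 2^-1 * \sum_(m < n) r ^+ 2)).
  by rewrite addr_ge0 // mulr_ge0 ?exprn_ge0 // addr_ge0 // mulr_ge0 // invr_ge0.
move=> i x xr; rewrite ger0_norm //.
have := sign_sum_ge x (index_enum 'I_n) 0 (D0 i).
rewrite add0r -row_sum_delta => h; apply: le_trans h _.
have := hE i x 0 xr; rewrite ler_norml => /andP[_]; rewrite lerBlDr => h; apply: le_trans h _.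
apply: lerD => //; apply: ler_wpM2l; first exact: exprn_ge0.
apply: lerD => //; apply: ler_wpM2l; first by rewrite invr_ge0.
apply: ler_sum => m _; apply: (le_trans (_ : _ <= x 0 m ^+ 2 * 1)).
  by apply: ler_wpM2l; rewrite ?sqr_ge0.
rewrite mulr1 -[x 0 m ^+ 2]ger0_norm ?sqr_ge0 // normrX lerXn2r ?nnegrE //.
  exact: le_trans xr.
by apply: le_trans (coord_le_norm _ _) xr.
Qed.

End Bounds.

Lemma Cka0_holder (R : realType) n I (a : R) (U : set 'rV[R]_n) k (f : I -> 'rV[R]_n -> R) :
  0 < a -> a <= 1 -> Cka a U k f -> exists2 M : R, 0 <= M & holder_on a U f M.
Proof. by move=> a0 a1 /(Cka_le a0 a1 (leq0n k)) [M [M0 _ h]]; exists M. Qed.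

(** * Critical points and the root of the gap *)

Section CriticalPoint.
Variables (R : realType) (n : nat) (I : Type) (K : nat).
Local Notation V := 'rV[R]_n.
Variables (D : seq 'I_n -> I -> V -> R) (l : I -> 'I_n) (X : I -> V -> R) (c rho eps : R).
Hypotheses (jD : jets K D) (K2 : (1 < K)%N) (c0 : 0 < c) (er : eps <= rho).
Hypothesis conv : forall i x, cball rho x -> c <= D [:: l i; l i] i x.
Hypothesis Xb : forall i x, cball eps x -> `|X i x| <= rho.
Let Phi i x : V := subst_coord (l i) (X i x) x.
Hypothesis Xz : forall i x, cball eps x -> D [:: l i] i (Phi i x) = 0.

Lemma subst_coord_ball i (t : R) (x : V) : cball eps x -> `|t| <= rho -> cball rho (subst_coord (l i) t x).
Proof.
rewrite /cball /= => xe tr; apply: norm_le_coord.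
  by apply: le_trans er; exact: le_trans xe.
move=> m; rewrite mxE; case: eqP => // _.
by apply: le_trans er; apply: le_trans (coord_le_norm _ _) xe.
Qed.

Lemma Phi_ball i x : cball eps x -> cball rho (Phi i x).
Proof. by move=> xe; apply: subst_coord_ball => //; exact: Xb. Qed.

Lemma lin_Phi u i x y : lin u (Phi i y - Phi i x) =
  lin (fun m => (m != l i)%:R * u m) (y - x) + u (l i) * (X i y - X i x).
Proof. exact: lin_subst_coord. Qed.

Section Exponent.
Variable b : R.
Hypotheses (b0 : 0 < b) (b1 : b <= 1).
Hypothesis HB : forall w j, (size w + j = K)%N -> Cka b (cball rho) j (D w).

Lemma Cka_word w j : (size w + j <= K)%N -> Cka b (cball rho) j (D w).
Proof.
move=> h; apply: (@Cka_le _ _ _ _ _ b0 b1 _ (K - size w)).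
  by rewrite leq_subRL // (leq_trans _ h) // leq_addr.
by apply: HB; rewrite subnKC // (leq_trans _ h) // leq_addr.
Qed.

Lemma jets_taylor w : (size w < K)%N ->
  exists2 M : R, 0 <= M & taylor_on b (cball rho) (D w) (fun m => D (m :: w)) M.
Proof.
move=> wK; apply: mvt_taylor => // [x y z|i z m _|m]; first exact: between_norm.
  exact: jD.
by apply: (@Cka0_holder _ _ _ b _ 0) => //; apply: Cka_word; rewrite addn0.
Qed.

(** Let z be x with its coordinate [l i] replaced by [X i y]. It is as close to [Phi i y] as x is to
    y, so |h_l| is at most L |y - x| at z. As h_l vanishes at [Phi i x] and has slope at least [c]
    along the line, [X i y] cannot be far from [X i x]. *)
Lemma critical_lip : exists2 L : R, 0 <= L &
  forall i x y, cball eps x -> cball eps y -> `|X i y - X i x| <= L * `|y - x|.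
Proof.
have h1 : Cka b (cball rho) 1 (fun i => D [:: l i] i).
  by apply: (@Cka_select _ _ _ _ l _ _ _ (fun t => D [:: t])) => t; apply: Cka_word.
have [L L0 hL] := Cka_lip b0 b1 h1.
exists (L / c); first by rewrite divr_ge0 // ltW.
move=> i x y xe ye; pose z := subst_coord (l i) (X i y) x.
have zr : cball rho z by apply: subst_coord_ball => //; exact: Xb.
have zy : `|z - Phi i y| <= `|y - x|.
  apply: norm_le_coord => // m; rewrite !mxE; case: eqP => _; first by rewrite subrr normr0.
  by have := coord_le_norm (y - x) m; rewrite !mxE distrC.
have [+ _] := hL i _ _ (Phi_ball i ye) zr; rewrite (Xz i ye) subr0 => h2.
have seg t : Phi i x + (0 + (X i y - X i x) * t) *: 'e_(l i) =
    subst_coord (l i) (X i x + t * (X i y - X i x)) x.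
  apply/rowP => m; rewrite !mxE eqxx /= add0r; case: eqP => _; last by rewrite mulr0 addr0.
  by rewrite mulr1 mulrC.
have [s /andP[s0 s1]] := @mvt1 R (fun t => D [:: l i] i (Phi i x + (0 + (X i y - X i x) * t) *: 'e_(l i)))
   (fun t => (X i y - X i x) * D [:: l i; l i] i (Phi i x + (0 + (X i y - X i x) * t) *: 'e_(l i)))
   0 1 ler01 (fun t _ => is_derive_line (jD (w := [:: l i]) (l i) i _ K2)).
rewrite !seg mul0r addr0 mul1r [X i x + (X i y - _)]addrC subrK -/(Phi i x) Xz // !subr0 mulr1 -/z => e.
have cs : c <= D [:: l i; l i] i (subst_coord (l i) (X i x + s * (X i y - X i x)) x).
  apply: conv; apply: subst_coord_ball => //.
  have := Xb i xe; have := Xb i ye; rewrite !ler_norml => /andP[? ?] /andP[? ?].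
  by apply/andP; split; nra.
rewrite mulrAC ler_pdivlMr //.
apply: le_trans (le_trans h2 (ler_wpM2l L0 zy)).
rewrite e normrM; apply: ler_wpM2l => //; apply: le_trans cs _; exact: ler_norm.
Qed.

Lemma Phi_dist : exists2 L : R, 1 <= L & forall i x y, cball eps x -> cball eps y ->
  `|Phi i y - Phi i x| <= L * `|y - x| /\ `|Phi i y - Phi i x| `^ b <= L * `|y - x| `^ b.
Proof.
have [L L0 hL] := critical_lip; exists (1 + L); first by rewrite lerDl.
move=> i x y xe ye.
have h : `|Phi i y - Phi i x| <= (1 + L) * `|y - x| by apply: subst_coord_lip => //; exact: hL.
split=> //; apply: le_trans (powR_mono b0 _ h) _ => //.
by apply: powR_scale => //; rewrite lerDl.
Qed.

(** The implicit function formula - h_lm / h_ll, with entry zero in direction [l i]: the critical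
    point of a line is the same seen from all its points. *)
Definition critical_grad (m : 'I_n) i x :=
  - ((m != l i)%:R * D [:: m; l i] i (Phi i x) / D [:: l i; l i] i (Phi i x)).

(** Both [Phi i x] and [Phi i y] are zeros of h_l; the Taylor expansion of h_l between them, divided
    by h_ll >= c, is the expansion of [X]. *)
Lemma critical_taylor : exists2 M : R, 0 <= M & taylor_on b (cball eps) X critical_grad M.
Proof.
have [L L1 hL] := Phi_dist.
have [M M0 hM] : exists2 M : R, 0 <= M & forall t, taylor_on b (cball rho) (D [:: t]) (fun m => D [:: m; t]) M.
  apply: fin_unif => [t M M' MM h i x y Ux Uy|t]; last exact: jets_taylor.
  apply: le_trans (h i x y Ux Uy) _; by apply: ler_wpM2r.
have L0 : 0 <= L by exact: le_trans L1.
exists (M * L * L / c); first by rewrite divr_ge0 ?mulr_ge0 // ltW.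
move=> i x y xe ye; have := hM (l i) i _ _ (Phi_ball i xe) (Phi_ball i ye).
rewrite (Xz i ye) (Xz i xe) subrr sub0r normrN lin_Phi.
have cx := conv i (Phi_ball i xe).
have d0 : 0 < D [:: l i; l i] i (Phi i x) by exact: lt_le_trans cx.
have -> : lin (fun m => critical_grad m i x) (y - x) = - (lin (fun m => (m != l i)%:R * D [:: m; l i] i (Phi i x)) (y - x) / D [:: l i; l i] i (Phi i x)).
  rewrite mulrC -mulNr -linZl /lin; apply: eq_bigr => m _.
  by rewrite /critical_grad; congr (_ * _); rewrite mulNr mulrC.
move: (lin _ _) => u h.
have -> : X i y - X i x - - (u / D [:: l i; l i] i (Phi i x)) =
   (u + D [:: l i; l i] i (Phi i x) * (X i y - X i x)) / D [:: l i; l i] i (Phi i x).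
  by field; rewrite gt_eqF.
rewrite normrM normfV (gtr0_norm d0) [leRHS]mulrAC.
apply: ler_pM; [exact: normr_ge0|by rewrite invr_ge0 (ltW d0)| |by rewrite lef_pV2 ?posrE].
apply: le_trans h _; have [h1 h2] := hL i x y xe ye.
rewrite -!mulrA; apply: ler_wpM2l => //.
rewrite (_ : L * (L * _) = (L * `|y - x|) * (L * `|y - x| `^ b)); last by ring.
by apply: ler_pM => //; exact: powR_ge0.
Qed.

Lemma Cka_Phi_word (w : I -> seq 'I_n) (T : finType) (t : I -> T) (v : T -> seq 'I_n) j :
  (forall i, w i = v (t i)) -> (forall s, (size (v s) + j <= K)%N) -> Cka b (cball eps) j X ->
  Cka b (cball eps) j (fun i x => D (w i) i (Phi i x)).
Proof.
move=> wv vK hX; have [L L0 hL] := critical_lip.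
apply: (@Cka_eq _ _ _ _ _ _ (fun i x => D (v (t i)) i (Phi i x))); first by move=> i x _; rewrite wv.
apply: (Cka_subst b0 b1 L0 hL Phi_ball hX (f := fun i => D (v (t i)) i)).
by apply: (@Cka_select _ _ _ _ t _ _ _ (fun s => D (v s))) => s; apply: Cka_word.
Qed.

(** Bootstrap: once [X] is of class j, so is [critical_grad], which puts [X] in class j + 1. This
    stops at K - 1 because the formula contains second derivatives. *)
Lemma critical_Cka j : (j < K)%N -> Cka b (cball eps) j X.
Proof.
elim: j => [|j ih] jK.
  have [L L0 hL] := critical_lip; pose r := `|rho|.
  have r0 : 0 <= r by exact: normr_ge0.
  have r2 : 0 <= 2 * r by rewrite mulr_ge0.
  exists (r + (2 * r + L)); split; first lra.
    move=> i x xe; apply: le_trans (Xb i xe) _; apply: le_trans (ler_norm _) _.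
    by rewrite -/r lerDl addr_ge0.
  move=> i x y xe ye; have w0 := powR_ge0 `|y - x| b.
  have := @split_le _ `|y - x| (`|y - x| `^ b) 1 `|X i y - X i x| (2 * r) L r2 L0 ler01 w0
     (powR_ge1 b0 (d := _)).
  rewrite mul1r mulr1 => h.
  apply: le_trans (h _ _) _.
  - apply: le_trans (ler_normB _ _) _; have := Xb i xe; have := Xb i ye; have := ler_norm rho.
    rewrite -/r; lra.
  - move=> d1; apply: le_trans (hL i x y xe ye) _; apply: ler_wpM2l => //.
    exact: powR_ge_id.
  - by apply: ler_wpM2r => //; rewrite lerDr.
have {}ih := ih (ltnW jK).
have [M M0 hM] := critical_taylor.
have [N [N0 bN _]] : Cka b (cball eps) 0 X by exact: Cka_le ih.
exists critical_grad, (N + M); split=> [m|||i x y xe ye].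
- apply: (@Cka_eq _ _ _ _ _ _ (fun i x => (- (m != l i)%:R) * (D [:: m; l i] i (Phi i x) * (D [:: l i; l i] i (Phi i x))^-1))).
    by move=> i x _; rewrite /critical_grad mulNr mulrA.
  apply: (Cka_scale b0 b1 (B := 1)) => [i|].
    by rewrite normrN normr_nat; case: (_ != _).
  apply: Cka_mul => //.
    by apply: (Cka_Phi_word (t := l) (v := fun s => [:: m; s])) => // s; rewrite /= !addSn add0n.
  apply: (Cka_inv b0 b1 c0) => [i x xe|].
    by apply: le_trans (conv i (Phi_ball i xe)) (ler_norm _).
  by apply: (Cka_Phi_word (t := l) (v := fun s => [:: s; s])) => // s; rewrite /= !addSn add0n.
- exact: addr_ge0.
- by move=> i x xe; apply: le_trans (bN i x xe) _; rewrite lerDl.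
apply: le_trans (hM i x y xe ye) _; apply: ler_wpM2r; first by rewrite mulr_ge0 ?powR_ge0.
by rewrite lerDr.
Qed.

Definition critical_value i x := D [::] i (Phi i x).

(** The increment of [X] enters multiplied by h_l at the critical point, which is zero. The gradient
    of the critical value thus contains no derivative of [X], and class K survives although [X] has
    only class K - 1. *)
Lemma critical_value_taylor : exists2 M : R, 0 <= M &
  taylor_on b (cball eps) critical_value (fun m i x => (m != l i)%:R * D [:: m] i (Phi i x)) M.
Proof.
have [L L1 hL] := Phi_dist; have L0 : 0 <= L by exact: le_trans L1.
have [M M0 hM] := jets_taylor (ltnW K2 : (size [::] < K)%N).
exists (M * L * L); first by rewrite !mulr_ge0.
move=> i x y xe ye; have := hM i _ _ (Phi_ball i xe) (Phi_ball i ye).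
rewrite lin_Phi (Xz i xe) mul0r addr0 => h.
apply: le_trans h _; have [h1 h2] := hL i x y xe ye.
rewrite -!mulrA; apply: ler_wpM2l => //.
rewrite (_ : L * (L * _) = (L * `|y - x|) * (L * `|y - x| `^ b)); last by ring.
by apply: ler_pM => //; exact: powR_ge0.
Qed.

Lemma critical_value_Cka : Cka b (cball eps) K critical_value.
Proof.
have [M M0 hM] := critical_value_taylor.
have [N N0 bN] := Cka_bnd (Cka_word (w := [::]) (j := 0) (leq0n K)).
have Kp : K = K.-1.+1 by rewrite prednK // ltnW.
rewrite {}[X in Cka _ _ X _]Kp.
exists (fun m i x => (m != l i)%:R * D [:: m] i (Phi i x)), (N + M); split=> [m|||i x y xe ye].
- apply: (Cka_scale b0 b1 (B := 1)) => [i|].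
    by rewrite normr_nat; case: (_ != _).
  apply: (Cka_Phi_word (t := fun=> tt) (v := fun=> [:: m])) => //.
    by move=> _; rewrite /= add1n prednK // ltnW.
  by apply: critical_Cka; rewrite prednK // ltnW.
- exact: addr_ge0.
- by move=> i x xe; apply: le_trans (bN i _ (Phi_ball i xe)) _; rewrite lerDl.
apply: le_trans (hM i x y xe ye) _; apply: ler_wpM2r; first by rewrite mulr_ge0 ?powR_ge0.
by rewrite lerDr.
Qed.

End Exponent.
End CriticalPoint.

(** * The signed root of the gap between a function and its critical value *)

Section GapRoot.
Variables (R : realType) (n : nat) (I : Type).
Local Notation V := 'rV[R]_n.
Variables (D : seq 'I_n -> I -> V -> R) (l : I -> 'I_n) (X : I -> V -> R) (c rho eps : R).
Hypotheses (jD : jets 2 D) (c0 : 0 < c) (er : eps <= rho).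
Hypothesis conv : forall i x, cball rho x -> c <= D [:: l i; l i] i x.
Hypothesis Xb : forall i x, cball eps x -> `|X i x| <= rho.
Let Phi i x : V := subst_coord (l i) (X i x) x.
Hypothesis Xz : forall i x, cball eps x -> D [:: l i] i (Phi i x) = 0.
Variable b : R.
Hypotheses (b0 : 0 < b) (b1 : b <= 1).
Hypothesis HB : forall w j, (size w + j = 2)%N -> Cka b (cball rho) j (D w).
Hypothesis sym : forall m m' i x, D [:: m; m'] i x = D [:: m'; m] i x.

Let two : (1 < 2)%N := isT.
(* On the segment [Phis i x] from the critical point to x, [quot1] and [quot2] are
   the increments of the gradient and of the value divided by tau and tau^2; in s they
   satisfy quot2' = quot1 (l i) and quot1 m' = D [:: l i; m], including where
   tau = 0. Comparing these ODEs for two base points replaces the integral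
   formulas H = int (1 - s) h_ll and Kq = int h_lm along the segment. *)
Let tau i (x : V) := x 0 (l i) - X i x.
Let Phis i (x : V) (s : R) : V := subst_coord (l i) (X i x + s * tau i x) x.

Let Phis_line i (x : V) (s : R) : Phis i x s = Phi i x + (0 + tau i x * s) *: 'e_(l i).
Proof.
apply/rowP => m; rewrite !mxE eqxx /= add0r; case: eqP => _; last by rewrite mulr0 addr0.
by rewrite mulr1 mulrC.
Qed.

Let Phis0 i x : Phis i x 0 = Phi i x. Proof. by rewrite /Phis mul0r addr0. Qed.

Let Phis1 i x : Phis i x 1 = x.
Proof.
apply/rowP => m; rewrite mxE; case: eqP => [->|//]; rewrite /tau; ring.
Qed.

Let Phis_ball i (x : V) (s : R) : cball eps x -> 0 <= s <= 1 -> cball rho (Phis i x s).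
Proof.
move=> xe /andP[s0 s1]; apply: (subst_coord_ball l er i xe).
have := Xb i xe; rewrite ler_norml => /andP[? ?].
have : `|x 0 (l i)| <= rho by apply: le_trans (coord_le_norm _ _) (le_trans xe er).
rewrite ler_norml => /andP[? ?]; rewrite /tau ler_norml; apply/andP; split; nra.
Qed.

Let Phis_derive w i (x : V) (s : R) : (size w < 2)%N ->
  is_derive s 1 (fun s => D w i (Phis i x s)) (tau i x * D (l i :: w) i (Phis i x s)).
Proof.
move=> w2; rewrite (_ : (fun s => _) = (fun s => D w i (Phi i x + (0 + tau i x * s) *: 'e_(l i)))).
  by rewrite Phis_line; apply: is_derive_line; exact: jD.
by apply: funext => s'; rewrite Phis_line.
Qed.

Let Phis_const i (x : V) (s : R) : tau i x = 0 -> Phis i x s = Phi i x.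
Proof. by move=> t0; rewrite /Phis t0 mulr0 addr0. Qed.

Let quot1 m i (x : V) (s : R) := if tau i x == 0 then D [:: l i; m] i (Phi i x) * s
  else (tau i x)^-1 * (D [:: m] i (Phis i x s) - D [:: m] i (Phi i x)).

Let quot2 i (x : V) (s : R) := if tau i x == 0 then 2^-1 * D [:: l i; l i] i (Phi i x) * s ^+ 2
  else (tau i x)^-1 ^+ 2 * (D [::] i (Phis i x s) - D [::] i (Phi i x)).

Let quot1_derive m i x (s : R) : is_derive s 1 (quot1 m i x) (D [:: l i; m] i (Phis i x s)).
Proof.
rewrite /quot1; case: eqP => [t0|/eqP t0].
  by rewrite Phis_const //; exact: is_derive_linear.
have h := @is_deriveB _ _ _ _ _ _ _ _ _ (@Phis_derive [:: m] i x s isT) (is_derive_cst (D [:: m] i (Phi i x)) s 1).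
have := @is_deriveZ _ _ _ _ (tau i x)^-1 _ _ _ h.
by rewrite subr0 /GRing.scale /= mulKf.
Qed.

Let quot2_derive i x (s : R) : cball eps x -> is_derive s 1 (quot2 i x) (quot1 (l i) i x s).
Proof.
move=> xe; rewrite /quot2 /quot1; case: eqP => [t0|/eqP t0].
  have := is_derive_square (2^-1 * D [:: l i; l i] i (Phi i x)) s.
  by rewrite mulrA divff ?mul1r // pnatr_eq0.
rewrite (Xz i xe) subr0.
have h := @is_deriveB _ _ _ _ _ _ _ _ _ (@Phis_derive [::] i x s isT) (is_derive_cst (D [::] i (Phi i x)) s 1).
have := @is_deriveZ _ _ _ _ ((tau i x)^-1 ^+ 2) _ _ _ h.
by rewrite subr0 /GRing.scale /= expr2 -mulrA mulKf.
Qed.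

Let quot1_0 m i x : quot1 m i x 0 = 0.
Proof. by rewrite /quot1 mulr0; case: eqP => // _; rewrite Phis0 subrr mulr0. Qed.

Let quot2_0 i x : quot2 i x 0 = 0.
Proof. by rewrite /quot2 expr0n mulr0; case: eqP => // _; rewrite Phis0 subrr mulr0. Qed.

Let H i x := quot2 i x 1.
Let Kq m i x := quot1 m i x 1.

Let gap i x : D [::] i x - D [::] i (Phi i x) = tau i x ^+ 2 * H i x.
Proof.
rewrite /H /quot2; case: eqP => [t0|/eqP t0].
  by rewrite t0 expr0n /= mul0r -(Phis_const 1 t0) Phis1 subrr.
by rewrite Phis1 mulrA -exprMn divff // expr1n mul1r.
Qed.

Let gap1 m i x : D [:: m] i x - D [:: m] i (Phi i x) = tau i x * Kq m i x.
Proof.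
rewrite /Kq /quot1; case: eqP => [t0|/eqP t0].
  by rewrite t0 mul0r -(Phis_const 1 t0) Phis1 subrr.
by rewrite Phis1 mulVKf.
Qed.

(** Since quot1' = h_ll >= c and quot2' = quot1, comparison from 0 gives first c s and then c s^2 /
    2. *)
Let H_ge i x : cball eps x -> 2^-1 * c <= H i x.
Proof.
move=> xe; have h s : 0 <= s <= 1 -> c * s <= quot1 (l i) i x s.
  move=> /andP[s0 s1].
  apply: (derive_le s0 (fun t _ => is_derive_linear c t) (fun t _ => quot1_derive (l i) i x t)).
    by move=> t /andP[t0 ts]; apply: conv; apply: Phis_ball => //; rewrite t0 (le_trans ts).
  by rewrite mulr0 quot1_0.
have := @derive_le R _ _ _ _ 1 ler01 (fun t _ => is_derive_square (2^-1 * c) t) (fun t _ => quot2_derive i t xe).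
rewrite expr1n mulr1; apply=> [s s01|].
  by rewrite mulrA divff ?mul1r ?h // pnatr_eq0.
by rewrite expr0n mulr0 quot2_0.
Qed.

Let second_bound : exists2 N : R, 0 <= N & forall m i x, cball rho x -> `|D [:: l i; m] i x| <= N.
Proof.
have [N N0 hN] := @Cka_bnd_fin _ _ _ b (cball rho) 0 _ (fun (m : 'I_n) i => D [:: l i; m] i)
  (fun m => @Cka_select _ _ _ _ l _ _ _ (fun t => D [:: t; m]) (fun t => HB (erefl : (size [:: t; m] + 0 = 2)%N))).
by exists N => // m i x; exact: hN.
Qed.

Let second_holder : exists2 N : R, 0 <= N & forall m i x y, cball rho x -> cball rho y ->
  `|D [:: l i; m] i y - D [:: l i; m] i x| <= N * `|y - x| `^ b.
Proof.
have h m : exists2 M : R, 0 <= M & holder_on b (cball rho) (fun i => D [:: l i; m] i) M.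
  apply: (@Cka0_holder _ _ _ b _ 0) => //.
  exact: (@Cka_select _ _ _ _ l _ _ _ (fun t => D [:: t; m]) (fun t => HB (erefl : (size [:: t; m] + 0 = 2)%N))).
have [N N0 hN] : exists2 N : R, 0 <= N & forall m, holder_on b (cball rho) (fun i => D [:: l i; m] i) N.
  apply: fin_unif h => m M M' MM hM i x y Ux Uy.
  by apply: le_trans (hM i x y Ux Uy) _; apply: ler_wpM2r; rewrite ?powR_ge0.
by exists N => // m i x y; exact: hN.
Qed.

Let Phis_dist : exists2 L : R, 1 <= L & forall i x y (s : R), cball eps x -> cball eps y ->
  0 <= s <= 1 -> `|Phis i y s - Phis i x s| `^ b <= L * `|y - x| `^ b.
Proof.
have [L L0 hL] := critical_lip jD two c0 er conv Xb Xz b0 b1 HB.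
exists (1 + (L + 1)); first by rewrite lerDl addr_ge0.
move=> i x y s xe ye /andP[s0 s1].
apply: (@le_trans _ _ (((1 + (L + 1)) * `|y - x|) `^ b)); last first.
  by apply: powR_scale => //; rewrite lerDl addr_ge0.
apply: powR_mono => //; apply: subst_coord_lip; first by rewrite addr_ge0.
rewrite (_ : _ - _ = (1 - s) * (X i y - X i x) + s * (y - x) 0 (l i)); last first.
  by rewrite /tau !mxE; ring.
apply: le_trans (ler_normD _ _) _; rewrite !normrM mulrDl; apply: lerD.
  rewrite ger0_norm ?subr_ge0 //; apply: le_trans (hL i x y xe ye).
  by rewrite ler_piMl // lerBlDr lerDl.
rewrite ger0_norm //; apply: ler_pM => //; exact: coord_le_norm.
Qed.

Let quot1_bound : exists2 N : R, 0 <= N & forall m i x (s : R), cball eps x -> 0 <= s <= 1 ->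
  `|quot1 m i x s| <= N.
Proof.
have [N N0 hN] := second_bound; exists N => // m i x s xe /andP[s0 s1].
have := derive_dist_le (e := N) s0 (fun t _ => quot1_derive m i x t) (fun t _ => is_derive_cst 0 t 1).
rewrite /cst subr0 => h; apply: le_trans (h _ _) _; last by rewrite ler_piMr.
  move=> t /andP[t0 ts]; rewrite subr0; apply: hN; apply: Phis_ball => //.
  by rewrite t0 (le_trans ts).
by rewrite quot1_0.
Qed.

Let quot1_holder : exists2 N : R, 0 <= N & forall m i x y (s : R), cball eps x -> cball eps y ->
  0 <= s <= 1 -> `|quot1 m i y s - quot1 m i x s| <= N * `|y - x| `^ b.
Proof.
have [N N0 hN] := second_holder; have [L L1 hL] := Phis_dist.
have L0 : 0 <= L by exact: le_trans L1.
exists (N * L); first exact: mulr_ge0.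
move=> m i x y s xe ye /andP[s0 s1].
have := derive_dist_le (e := N * L * `|y - x| `^ b) s0 (fun t _ => quot1_derive m i y t) (fun t _ => quot1_derive m i x t).
move=> h; apply: le_trans (h _ _) _.
- move=> t /andP[t0 ts]; have t01 : 0 <= t <= 1 by rewrite t0 (le_trans ts).
  apply: le_trans (hN m i _ _ (Phis_ball i xe t01) (Phis_ball i ye t01)) _.
  by rewrite -mulrA; apply: ler_wpM2l => //; exact: hL.
- by rewrite !quot1_0.
- by rewrite ler_piMr // !mulr_ge0 ?powR_ge0.
Qed.

Let Kq_Cka m : Cka b (cball eps) 0 (Kq m).
Proof.
have [M M0 hM] := quot1_bound; have [N N0 hN] := quot1_holder.
exists (M + N); split; first exact: addr_ge0.
  by move=> i x xe; apply: le_trans (hM m i x 1 xe _) _; rewrite ?ler01 ?lexx // lerDl.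
move=> i x y xe ye; apply: le_trans (hN m i x y 1 xe ye _) _; first by rewrite ler01 lexx.
by apply: ler_wpM2r; rewrite ?powR_ge0 // lerDr.
Qed.

Let H_Cka : Cka b (cball eps) 0 H.
Proof.
have [M M0 hM] := quot1_bound; have [N N0 hN] := quot1_holder.
exists (M + N); split; first exact: addr_ge0.
  move=> i x xe.
  have := derive_dist_le (e := M) ler01 (fun t _ => quot2_derive i t xe) (fun t _ => is_derive_cst 0 t 1).
  rewrite /cst subr0 mulr1 => h; apply: le_trans (h _ _) _; last by rewrite lerDl.
    by move=> t t01; rewrite subr0; exact: hM.
  by rewrite quot2_0.
move=> i x y xe ye.
have := derive_dist_le (e := N * `|y - x| `^ b) ler01 (fun t _ => quot2_derive i t ye) (fun t _ => quot2_derive i t xe).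
rewrite mulr1 => h; apply: le_trans (h _ _) _.
- by move=> t t01; exact: hN.
- by rewrite !quot2_0.
- by apply: ler_wpM2r; rewrite ?powR_ge0 // lerDr.
Qed.

Let S i x := Num.sqrt (H i x).
(** Formally, differentiating G^2 = h - F gives 2 G G_m = tau Kq, by [gap1] and the gradient of the
    critical value. With G = tau S, cancelling tau leaves this candidate for G_m, which makes sense
    also where tau = 0. *)
Let p m i x := Kq m i x * (2 * S i x)^-1.

(** [tau] is signed: the nonnegative root of the gap would have a corner where [tau] vanishes. *)
Definition gap_root i x := tau i x * S i x.

Let hc0 : 0 < 2^-1 * c. Proof. by rewrite mulr_gt0 // invr_gt0. Qed.

Let S_Cka : Cka b (cball eps) 0 S.
Proof. exact: (Cka_sqrt b0 b1 hc0 H_ge H_Cka). Qed.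

Let S_gt0 i x : cball eps x -> 0 < S i x.
Proof. by move=> xe; rewrite sqrtr_gt0; apply: lt_le_trans (H_ge i xe). Qed.

Let S_sq i x : cball eps x -> S i x ^+ 2 = H i x.
Proof. by move=> xe; rewrite sqr_sqrtr //; apply: le_trans (H_ge i xe); exact: ltW. Qed.

Let p_Cka m : Cka b (cball eps) 0 (p m).
Proof.
apply: (Cka_mul b0 b1 (@Kq_Cka m)); apply: (@Cka_inv _ _ _ _ _ b0 b1 0 (2 * Num.sqrt (2^-1 * c))).
- by rewrite mulr_gt0 // sqrtr_gt0.
- move=> i x xe; rewrite normrM normr_nat; apply: ler_wpM2l => //.
  by apply: le_trans (ler_norm _); apply: ler_wsqrtr; exact: H_ge.
- by apply: (Cka_scale b0 b1 (c := fun=> 2) (B := 2)) => // _; rewrite normr_nat.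
Qed.

Let X_Cka0 : Cka b (cball eps) 0 X.
Proof. exact: (critical_Cka jD two c0 er conv Xb Xz b0 b1 HB). Qed.

Let root_Cka0 : Cka b (cball eps) 0 gap_root.
Proof.
apply: Cka_mul => //; apply: Cka_sub2 => //.
apply: (@Cka_select _ _ _ _ l _ _ _ (fun t i x => x 0 t)) => t.
by apply: (Cka_coord I 0 t (B := eps)) => // x.
Qed.

Lemma gap_root_sqr i x : cball eps x ->
  gap_root i x ^+ 2 = D [::] i x - critical_value D l X i x.
Proof. by move=> xe; rewrite /gap_root exprMn S_sq // -gap. Qed.

Let step_in (x : V) m (s : R) : `|s| <= eps - `|x| -> cball eps (x + s *: 'e_m).
Proof.
move=> h; rewrite /cball /=; apply: le_trans (ler_normD _ _) _.
by rewrite normrZ norm_delta_mx mulr1; lra.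
Qed.

Let step_diff (x : V) m (s : R) : x + s *: 'e_m - x = s *: 'e_m.
Proof. by rewrite addrAC subrr add0r. Qed.

(** Where [tau] vanishes, the expansion of [tau] and the Hölder continuity of [S] give the
    derivative directly; elsewhere G^2 = h - F is expanded and divided by the sum of the two values
    of G. The constant of the second case blows up as G tends to 0, so only a pointwise derivative
    is obtained here. *)
Let root_derive i x m : `|x| < eps -> is_derive x 'e_m (gap_root i) (p m i x).
Proof.
move=> xlt; have xe : cball eps x by exact: ltW.
have d0 : 0 < eps - `|x| by rewrite subr_gt0.
have nd s : `|s *: 'e_m : V| = `|s| by rewrite normrZ norm_delta_mx mulr1.
have S0 := S_gt0 i xe.
case: (eqVneq (tau i x) 0) => t0.
  have [M M0 hM] := critical_taylor jD two c0 er conv Xb Xz b0 b1 HB.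
  have [N N0 hN] := Cka0_holder b0 b1 S_Cka.
  have [B B0 hB] := Cka_bnd S_Cka.
  (* [theta] is the derivative of [tau] in direction [m]. *)
  pose theta := (m == l i)%:R - critical_grad D l X m i x.
  have d2 : D [:: l i; l i] i (Phi i x) = 2 * S i x ^+ 2.
    by rewrite S_sq // /H /quot2 t0 eqxx expr1n mulr1 mulrA divff ?mul1r // pnatr_eq0.
  have pth : p m i x = theta * S i x.
    rewrite /p /Kq /quot1 t0 eqxx mulr1 /theta /critical_grad -/(Phi i x) d2.
    case: (eqVneq m (l i)) => [->|ml] /=.
      by rewrite d2; field; rewrite gt_eqF.
    by rewrite (sym (l i) m); field; rewrite gt_eqF.
  apply: (@taylor_is_derive _ _ b (M * B + `|theta| * N) (eps - `|x|)) => //.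
    by rewrite addr_ge0 ?mulr_ge0.
  move=> s sd; have ye := step_in m sd.
  have := hM i x _ xe ye; have := hN i x _ xe ye; have := hB i _ ye.
  rewrite step_diff nd lin_delta pth.
  have -> : gap_root i x = 0 by rewrite /gap_root t0 mul0r.
  rewrite /gap_root subr0.
  have -> : tau i (x + s *: 'e_m) = (m == l i)%:R * s - (X i (x + s *: 'e_m) - X i x).
    have : x 0 (l i) = X i x by apply/eqP; rewrite -subr_eq0; apply/eqP; exact: t0.
    by rewrite /tau !mxE eqxx /= [l i == m]eq_sym => ->; ring.
  move: (S i (x + _)) (X i (x + _)) => S' X' h1 h2 h3.
  have -> : ((m == l i)%:R * s - (X' - X i x)) * S' - theta * S i x * s =
    - (X' - X i x - critical_grad D l X m i x * s) * S' + theta * (s * (S' - S i x)).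
    by rewrite /theta; ring.
  apply: le_trans (ler_normD _ _) _; rewrite [leRHS]mulrDl; apply: lerD.
    by rewrite normrM normrN [leRHS]mulrAC; apply: ler_pM.
  rewrite !normrM -[leRHS]mulrA; apply: ler_wpM2l => //.
  by rewrite [leRHS]mulrCA; apply: ler_wpM2l.
have [M M0 hM] := jets_taylor jD b0 b1 HB (isT : (size [::] < 2)%N).
have [M' M'0 hM'] := critical_value_taylor jD two c0 er conv Xb Xz b0 b1 HB.
have [N N0 hN] := Cka0_holder b0 b1 root_Cka0.
have G0 : gap_root i x != 0 by rewrite mulf_neq0 // gt_eqF.
have Ga : 0 < `|gap_root i x| by rewrite normr_gt0.
have N1 : 0 < N + 1 by rewrite ltr_wpDl.
(* [d'] keeps the increment of the root below |G x|; then the sum of its values at the two points is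
   at least |G x| in absolute value, and division by that sum is harmless. *)
have [d' d'0 hd'] := powR_small b0 (divr_gt0 Ga N1).
apply: (@taylor_is_derive _ _ b ((M + M' + `|p m i x| * N) / `|gap_root i x|) (Num.min (eps - `|x|) d')) => //.
- by rewrite divr_ge0 // ?addr_ge0 ?mulr_ge0.
- by rewrite lt_min d0.
move=> s; rewrite le_min => /andP[sd sd']; have ye := step_in m sd.
have xr : cball rho x by exact: le_trans er.
have yr : cball rho (x + s *: 'e_m) by exact: le_trans er.
have := hM i x _ xr yr; have := hM' i x _ xe ye; have := hN i x _ xe ye.
rewrite step_diff nd !lin_delta.
have := gap_root_sqr i xe; have := gap_root_sqr i ye.
have e : D [:: m] i x - (m != l i)%:R * D [:: m] i (Phi i x) = 2 * gap_root i x * p m i x.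
  have -> : 2 * gap_root i x * p m i x = tau i x * Kq m i x.
    by rewrite /gap_root /p; field; rewrite gt_eqF.
  rewrite -gap1; congr (_ - _); case: (eqVneq m (l i)) => [->|_]; last by rewrite mul1r.
  by rewrite (Xz i xe) mul0r.
have := hd' `|s|; rewrite normr_ge0 sd' => /(_ isT) sN.
have {}sN : N * `|s| `^ b <= `|gap_root i x|.
  apply: (le_trans (_ : _ <= (N + 1) * (`|gap_root i x| / (N + 1)))); last by rewrite mulrC divfK // gt_eqF.
  by apply: ler_pM => //; rewrite ?powR_ge0 // lerDl.
move: (D [::] i (x + _)) (critical_value D l X i (x + _)) (gap_root i (x + _)) => h' F' G' e1 e2 h1 h2 h3.
have GG : `|gap_root i x| <= `|G' + gap_root i x|.
  have := ler_normB (G' + gap_root i x) (G' - gap_root i x).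
  rewrite (_ : G' + _ - _ = 2 * gap_root i x); last by ring.
  rewrite normrM normr_nat; have := le_trans h1 sN; lra.
rewrite -(ler_pM2r Ga) [leRHS]mulrAC divfK ?gt_eqF //.
apply: (le_trans (_ : _ <= `|G' - gap_root i x - p m i x * s| * `|G' + gap_root i x|)).
  by apply: ler_wpM2l.
rewrite -normrM (_ : (G' - gap_root i x - p m i x * s) * (G' + gap_root i x) = (h' - D [::] i x - D [:: m] i x * s) -
  (F' - critical_value D l X i x - (m != l i)%:R * D [:: m] i (Phi i x) * s) - p m i x * (s * (G' - gap_root i x))); last first.
  have -> : (G' - gap_root i x - p m i x * s) * (G' + gap_root i x) = G' ^+ 2 - gap_root i x ^+ 2 -
      2 * gap_root i x * p m i x * s - p m i x * (s * (G' - gap_root i x)) by ring.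
  by rewrite e1 e2 -e; ring.
apply: le_trans (ler_normB _ _) _; rewrite [leRHS]mulrDl; apply: lerD.
  by apply: le_trans (ler_normB _ _) _; rewrite [leRHS]mulrDl; exact: lerD.
rewrite !normrM -[leRHS]mulrA; apply: ler_wpM2l => //.
by rewrite [leRHS]mulrCA; apply: ler_wpM2l.
Qed.

(** [mvt_taylor] turns the pointwise derivatives into an expansion with one constant, because [p] is
    Hölder continuous uniformly, also across the set where the root vanishes. The ball is open to
    leave room for small steps in every direction. *)
Lemma gap_root_Cka : Cka b [set x | `|x| < eps] 1 gap_root.
Proof.
have sub : [set x : V | `|x| < eps] `<=` cball eps by move=> x /= /ltW.
have pC m : Cka b [set x | `|x| < eps] 0 (p m) := Cka_sub sub (p_Cka m).
have [M M0 hM] : exists2 M : R, 0 <= M & taylor_on b [set x : V | `|x| < eps] gap_root p M.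
  apply: mvt_taylor => [|x y z /= xe ye bz|i z m /= ze|m]; first exact: b0.
  - apply: le_lt_trans (_ : Num.max `|x| `|y| < eps); last by rewrite gt_max xe.
    by apply: between_norm bz; rewrite le_max lexx ?orbT.
  - exact: root_derive.
  - exact: (Cka0_holder b0 b1 (pC m)).
have [N N0 hN] := Cka_bnd root_Cka0.
exists p, (N + M); split=> //.
- exact: addr_ge0.
- by move=> i x /sub xe; apply: le_trans (hN i x xe) _; rewrite lerDl.
move=> i x y xe ye; apply: le_trans (hM i x y xe ye) _; apply: ler_wpM2r.
  by rewrite mulr_ge0 ?powR_ge0.
by rewrite lerDr.
Qed.

End GapRoot.

(** * Local decomposition *)

Section Bump.
Variables (R : realType) (n : nat).
Local Notation V := 'rV[R]_n.

Definition oball (r : R) : set V := [set x | `|x| < r].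

(** Moving a coordinate away from zero cannot lower the sup norm. *)
Lemma oball_step (r s e : R) (x : V) l : `|x| < s -> r <= `|x| -> 0 < e ->
  exists t, [/\ t != 0, `|t| <= e, oball s (x + t *: 'e_l) & ~ oball r (x + t *: 'e_l)].
Proof.
move=> xs rx e0; pose d := Num.min e ((s - `|x|) / 2).
have sx : 0 < (s - `|x|) / 2 by rewrite divr_gt0 // subr_gt0.
have d0 : 0 < d by rewrite lt_min e0.
have ds : d <= (s - `|x|) / 2 by rewrite ge_min lexx orbT.
pose t := if 0 <= x 0 l then d else - d.
have td : `|t| = d by rewrite /t; case: ifP; rewrite ?normrN gtr0_norm.
exists t; split.
- by rewrite -normr_gt0 td.
- by rewrite td ge_min lexx.
- rewrite /oball /=; apply: le_lt_trans (ler_normD _ _) _.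
  by rewrite normrZ norm_delta_mx mulr1 td; lra.
rewrite /oball /= => /lt_le_trans /(_ rx); apply/negP; rewrite -leNgt.
apply: norm_le_coord => // m; apply: le_trans (coord_le_norm _ m).
rewrite !mxE eqxx /=; case: eqP => [->|_]; last by rewrite mulr0 addr0.
rewrite mulr1 /t; case: (leP 0 (x 0 l)) => h; first by rewrite !ger0_norm //; lra.
by rewrite !ltr0_norm //; lra.
Qed.

Lemma Cka_extend_ball I (a r s : R) k (f : I -> V -> R) : 0 < a -> r < s ->
  (forall i x, ~ oball r x -> f i x = 0) -> Cka a (oball s) k f -> Cka a setT k f.
Proof.
move=> a0 rs f0; apply: (@Cka_extend _ _ _ _ _ (oball r) (s - r)) => //.
- by rewrite subr_gt0.
- move=> x y; rewrite /oball /= => xr /negP; rewrite -leNgt => sy.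
  have := ler_normB (y - x) (- x); rewrite opprK subrK normrN; lra.
- move=> x l e; rewrite /oball /= => xs /negP; rewrite -leNgt => rx e0.
  exact: oball_step.
Qed.

Lemma bump_exists (r : R) : 0 < r -> exists b : V -> R, [/\
  forall x, 0 <= b x <= 1, forall x, `|x| <= r / 2 -> b x = 1,
  forall x, ~ oball r x -> b x = 0 &
  forall I (a : R) k, 0 < a -> a <= 1 -> (k <= 3)%N -> Cka a setT k (fun _ : I => b)].
Proof.
move=> r0.
(* On each axis [chi] is 1 up to r / 2 and 0 beyond r. Fourth powers make the truncations of class
   C^{3,a}, the most that is needed. *)
pose e1 l (x : V) := Num.max 0 (r ^+ 2 - x 0 l * x 0 l) ^+ 4.
pose e2 l (x : V) := Num.max 0 (x 0 l * x 0 l - r ^+ 2 / 4) ^+ 4.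
pose chi l x := e1 l x / (e1 l x + e2 l x).
have r2 : 0 < r ^+ 2 by rewrite exprn_gt0.
have e10 l x : 0 <= e1 l x by rewrite exprn_ge0 // le_max lexx.
have e20 l x : 0 <= e2 l x by rewrite exprn_ge0 // le_max lexx.
(* The truncations set in at r^2 and r^2 / 4, whose midpoint is 5 r^2 / 8; one of the two bases is
   therefore always at least 3 r^2 / 8. *)
pose c := (r ^+ 2 * (3 / 8)) ^+ 4.
have c38 : 0 < r ^+ 2 * (3 / 8) by rewrite mulr_gt0.
have c0 : 0 < c by rewrite exprn_gt0.
have cle l x : c <= e1 l x + e2 l x.
  case: (leP (x 0 l * x 0 l) (r ^+ 2 * (5 / 8))) => h.
    have : c <= e1 l x.
      apply: lerXn2r; rewrite ?nnegrE ?le_max ?lexx //; first exact: ltW.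
      by apply/orP; right; lra.
    by have := e20 l x; lra.
  have : c <= e2 l x.
    apply: lerXn2r; rewrite ?nnegrE ?le_max ?lexx //; first exact: ltW.
    by apply/orP; right; lra.
  by have := e10 l x; lra.
have den l x : 0 < e1 l x + e2 l x by apply: lt_le_trans (cle l x).
have chi01 l x : 0 <= chi l x <= 1.
  rewrite divr_ge0 ?(ltW (den _ _)) //= ler_pdivrMr // mul1r lerDl //.
pose b x := \prod_(l < n) chi l x.
have b0 x : ~ oball r x -> b x = 0.
  move=> xr; have [l hl] : exists l, r <= `|x 0 l|.
    apply: contrapT => h; apply: xr; rewrite /oball /=.
    have : `|x| <= Num.max 0 (\big[Num.max/0]_l `|x 0 l|).
      apply: norm_le_coord; first by rewrite le_max lexx.
      by move=> l; rewrite le_max; apply/orP; right; apply: (le_bigmax _ (fun l => `|x 0 l|)).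
    move=> hx; apply: le_lt_trans hx _; rewrite gt_max r0 /=.
    by apply/bigmax_ltP; split => // l _; rewrite ltNge; apply/negP => hl; apply: h; exists l.
  rewrite /b (bigD1 l) //= (_ : chi l x = 0) ?mul0r // /chi /e1 max_l ?expr0n ?mul0r //.
  by rewrite subr_le0 -expr2 -[x 0 l ^+ 2]ger0_norm ?sqr_ge0 // normrX lerXn2r // nnegrE ltW.
exists b; split.
- move=> x; rewrite prodr_ge0 => [|l _]; last by case/andP: (chi01 l x).
  by apply: Num.Theory.prodr_ile1 => l _; exact: chi01.
- move=> x xr; rewrite /b big1 // => l _; rewrite /chi.
  have e2z : e2 l x = 0.
    rewrite /e2 max_l ?expr0n // subr_le0.
    have := le_trans (coord_le_norm x l) xr; rewrite ler_norml => /andP[h1 h2]; nra.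
  by have := den l x; rewrite e2z addr0 => h; rewrite divff // gt_eqF.
- exact: b0.
move=> I a k a0 a1 k3; apply: (@Cka_extend_ball _ _ r (2 * r)) => //.
  lra.
have hc l : Cka a (oball (2 * r)) k (fun (_ : I) (x : V) => x 0 l * x 0 l).
  by apply: Cka_mul => //; apply: (Cka_coord I k l a0 a1 (B := 2 * r)) => x /ltW.
have cst (z : R) : Cka a (oball (2 * r)) k (fun (_ : I) (_ : V) => z).
  by apply: (@Cka_cst _ _ _ _ _ _ (fun=> z) `|z|).
have h1 l : Cka a (oball (2 * r)) k (fun (_ : I) (x : V) => e1 l x).
  by apply: Cka_posX => //; apply: Cka_sub2.
have h2 l : Cka a (oball (2 * r)) k (fun (_ : I) (x : V) => e2 l x).
  by apply: Cka_posX => //; apply: Cka_sub2.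
apply: (Cka_prod a0 a1 (index_enum 'I_n) (P := xpredT) (f := fun l _ x => chi l x)) => l _.
apply: Cka_mul => //; apply: (Cka_inv a0 a1 c0); last exact: Cka_add.
by move=> _ x _; apply: le_trans (cle l x) (ler_norm _).
Qed.

End Bump.

(** * Families with controlled seminorms, and constants for the local construction *)

Section LocalSquares.
Variables (R : realType) (n : nat) (a g : R) (k : nat).
Local Notation V := 'rV[R]_n.
Hypotheses (a0 : 0 < a) (a1 : a <= 1) (g0 : 0 < g) (g1 : g <= 1).
Hypothesis hk : (k == 2)%N || (k == 3)%N.
Hypothesis gk : (k == 2)%N -> g <= a.

Let k1 : (1 < k)%N. Proof. by case/orP: hk => /eqP ->. Qed.
Let k3 : (k <= 3)%N. Proof. by case/orP: hk => /eqP ->. Qed.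

(** Unlike in [Cka], only the derivatives of order [k] are controlled, and only by their Hölder
    seminorm: exactly what rescaling preserves. *)
Definition holder_family I (f : I -> V -> R) := exists D : seq 'I_n -> I -> V -> R,
  [/\ D [::] = f, jets k D & top_holder a k D].

(** No bound on values or gradients, as the global roots may be unbounded. Hölder continuity of the
    gradient is recovered by [taylor_grad_holder]. *)
Definition taylor_family I (f : I -> V -> R) := exists p (M : R),
  0 <= M /\ taylor_on g setT f p M.

Definition indep (T : {set 'I_n}) (u : V -> R) :=
  forall x y : V, (forall m, m \notin T -> x 0 m = y 0 m) -> u x = u y.

(* The induction is on the number j of variables on which the functions may
   depend; it stays in dimension n, [T i] being the variables f i ignores. *)
Definition sos (m j : nat) := forall (I : Type) (T : I -> {set 'I_n}) (f : I -> V -> R),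
  (forall i, (#|~: T i| <= j)%N) -> holder_family f -> (forall i x, 0 <= f i x) ->
  (forall i, indep (T i) (f i)) ->
  exists G : 'I_m -> I -> V -> R, (forall s, taylor_family (G s)) /\
    forall i x, f i x = \sum_(s < m) G s i x ^+ 2.

Lemma Cka_holder_family I (f : I -> V -> R) : Cka a setT k f -> holder_family f.
Proof.
move=> hf; have [D [D0 jD hD]] := Cka_jets a0 hf; exists D; split=> // w wk.
by apply: (Cka0_holder a0 a1 (hD w _)); rewrite wk.
Qed.

(** Expanding at [x] and at [y] and evaluating both at z = y + |y - x| e_l isolates the difference
    of the [l]-th entries times |y - x|. The constant 6 is 1 + 1 + 4, the 4 coming from the step
    from x to z, of length at most 2 |y - x|. *)
Lemma taylor_grad_holder I (f : I -> V -> R) p (M : R) : 0 <= M -> taylor_on g setT f p M ->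
  forall l, holder_on g setT (p l) (6 * M).
Proof.
move=> M0 hf l i x y _ _; have [->|xy] := eqVneq x y.
  by rewrite !subrr normr0 mulr_ge0 ?powR_ge0 // mulr_ge0.
pose d := `|y - x|; have d0 : 0 < d by rewrite normr_gt0 subr_eq0 eq_sym.
pose z := y + d *: 'e_l.
have zy : z - y = d *: 'e_l by rewrite /z addrAC subrr add0r.
have nzy : `|z - y| = d by rewrite zy normrZ norm_delta_mx mulr1 gtr0_norm.
have zx : z - x = (y - x) + d *: 'e_l by rewrite /z addrAC.
have nzx : `|z - x| <= 2 * d.
  by rewrite zx; apply: le_trans (ler_normD _ _) _; rewrite normrZ norm_delta_mx mulr1 (gtr0_norm d0) -/d; lra.
have h1 := hf i y z Logic.I Logic.I; have h2 := hf i x y Logic.I Logic.I.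
have h3 := hf i x z Logic.I Logic.I.
rewrite nzy zy lin_delta in h1; rewrite -/d in h2.
have {}h3 : `|f i z - f i x - lin (fun l => p l i x) (z - x)| <= 4 * (M * (d * d `^ g)).
  apply: le_trans h3 _; rewrite [leRHS]mulrCA; apply: ler_wpM2l => //.
  rewrite (_ : 4 * _ = (2 * d) * (2 * d `^ g)); last by ring.
  apply: ler_pM => //; rewrite ?powR_ge0 //.
  apply: le_trans (powR_mono g0 _ nzx) _ => //; apply: powR_scale => //; [lra|exact: ltW].
have e : lin (fun l => p l i x) (z - x) = lin (fun l => p l i x) (y - x) + p l i x * d.
  have := linBr (fun l => p l i x) (z - x) (y - x).
  rewrite {1}zx addrAC subrr add0r lin_delta => ->; ring.
rewrite e in h3; move: (lin _ _) h2 h3 => u h2 h3.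
rewrite -(ler_pM2r d0) -{1}(gtr0_norm d0) -normrM.
rewrite (_ : (p l i y - p l i x) * d = (f i z - f i x - (u + p l i x * d)) -
   (f i z - f i y - p l i y * d) - (f i y - f i x - u)); last by ring.
apply: le_trans (ler_normB _ _) _.
apply: le_trans (lerD (ler_normB _ _) (lexx _)) _.
rewrite (_ : 6 * M * d `^ g * d = 6 * (M * (d * d `^ g))); last by ring.
by move: (M * (d * d `^ g)) h1 h2 h3 => q h1 h2 h3; lra.
Qed.

(** For a bounded function, a unit step along each axis bounds the gradient. *)
Lemma taylor_family_Cka I (f : I -> V -> R) (B : R) : taylor_family f ->
  (forall i x, `|f i x| <= B) -> Cka g setT 1 f.
Proof.
move=> [p [M [M0 hf]]] fB.
have fB' i x : `|f i x| <= `|B| by apply: le_trans (fB i x) (ler_norm _).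
exists p, (`|B| + M); split.
- move=> l; exists (2 * `|B| + M + 6 * M); split.
  + by rewrite !addr_ge0 // mulr_ge0.
  + move=> i x _; have := hf i x (x + 1 *: 'e_l) Logic.I Logic.I.
    rewrite [x + _ - x]addrAC subrr add0r lin_delta normrZ norm_delta_mx normr1 !mul1r powR1 !mulr1.
    move=> h; apply: (@le_trans _ _ (2 * `|B| + M)); last by rewrite lerDl mulr_ge0.
    have := fB' i x; have := fB' i (x + 1 *: 'e_l).
    move: (f i x) (f i (x + _)) h => u v h hu hv.
    rewrite (_ : p l i x = (v - u) - (v - u - p l i x)); last by ring.
    by apply: le_trans (ler_normB _ _) _; have := ler_normB v u; lra.
  + move=> i x y _ _; apply: le_trans (taylor_grad_holder M0 hf l i Logic.I Logic.I) _.
    by apply: ler_wpM2r; rewrite ?powR_ge0 // lerDr addr_ge0 // mulr_ge0.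
- exact: addr_ge0.
- by move=> i x _; apply: le_trans (fB' i x) _; rewrite lerDl.
- move=> i x y _ _; apply: le_trans (hf i x y Logic.I Logic.I) _.
  by apply: ler_wpM2r; rewrite ?mulr_ge0 ?powR_ge0 // lerDr.
Qed.

Section Family.
Variables (I : Type) (D : seq 'I_n -> I -> V -> R).
Hypotheses (jD : jets k D) (tD : top_holder a k D).
Hypothesis bD : forall w, (size w <= k)%N -> locally_bounded (D w).

Lemma normal_Cka r w j : (size w + j = k)%N -> Cka a (cball r) j (D w).
Proof.
apply: jets_Cka => // {}w wk; first exact: bD.
have [M M0 h] := tD wk; exists M => // i x y _ _; exact: h.
Qed.

(** Both values of [k] are brought to two derivatives and the common exponent [g]: for k = 2 by g <=
    a, for k = 3 because bounded third derivatives make the second ones Lipschitz on balls. *)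
Lemma normal_Cka2 r w j : (size w + j = 2)%N -> Cka g (cball r) j (D w).
Proof.
move=> wj; case/orP: hk => /eqP ek.
  apply: (@Cka_expo _ _ _ a) => //; first by apply: gk; rewrite ek.
  by apply: normal_Cka; rewrite ek.
apply: (@Cka_expo _ _ _ 1) => //.
have j2 : jets 2 D by move=> v l i x v2; apply: jD; rewrite ek ltnW.
apply: (jets_Cka (k := 2)) wj => // v v2; first by apply: bD; rewrite ek ltnW.
have hb l : exists2 N : R, 0 <= N & bounded_on (cball r) (D (l :: v)) N.
  by apply: bD; rewrite /= v2 ek.
have [N N0 hN] := fin_unif (P := fun l N => bounded_on (cball r) (D (l :: v)) N)
  (fun l M M' MM h i x Ux => le_trans (h i x Ux) MM) hb.
exists (n%:R * N); first exact: mulr_ge0.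
move=> i x y Ux Uy; rewrite powRr1 //.
have := path_mvt (u := D v i) (p := fun l => D (l :: v) i) (a := fun=> 0) (x := x) (y := y) N0
  (fun l z _ => jD l i z (eq_leq (etrans (congr1 S v2) (esym ek)))).
rewrite lin0l subr0; apply.
by move=> l z bz; rewrite subr0; apply: hN; exact: between_norm bz.
Qed.

Lemma normal_sym m m' i x : D [:: m; m'] i x = D [:: m'; m] i x.
Proof.
apply: (schwarz (u := D [::] i) (pi := D [:: m'] i) (pj := D [:: m] i)
  (q := D [:: m; m'] i) (r := D [:: m'; m] i) (i := m') (j := m)).
- by move=> z; apply: jD; exact: ltnW.
- by move=> z; apply: jD; exact: ltnW.
- by move=> z; apply: jD.
- by move=> z; apply: jD.
move=> e e0; pose r := `|x| + 1.
have [M [M0 _ hM]] := normal_Cka2 r (erefl : (size [:: m; m'] + 0 = 2)%N).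
have [N [N0 _ hN]] := normal_Cka2 r (erefl : (size [:: m'; m] + 0 = 2)%N).
have MN : 0 < M + N + 1 by lra.
have [d d0 hd] := powR_small g0 (divr_gt0 e0 MN).
exists (Num.min 1 d); first by rewrite lt_min ltr01.
move=> z; rewrite le_min => /andP[z1 zd].
have xr : cball r x by rewrite /cball /= /r lerDl.
have zr : cball r z.
  by rewrite /cball /= /r; have := ler_normD x (z - x); rewrite addrCA subrr addr0; lra.
have := hd `|z - x|; rewrite normr_ge0 zd => /(_ isT) h.
have fin (C : R) : 0 <= C -> C <= M + N + 1 -> C * `|z - x| `^ g <= e.
  move=> C0 CM; apply: (le_trans (_ : _ <= (M + N + 1) * (e / (M + N + 1)))).
    by apply: ler_pM => //; exact: powR_ge0.
  by rewrite mulrC divfK // gt_eqF.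
by split; [apply: le_trans (hM i x z xr zr) _|apply: le_trans (hN i x z xr zr) _]; apply: fin => //; lra.
Qed.

Hypothesis nonneg : forall i x, 0 <= D [::] i x.

(** If h is small at 0, its gradient there is small, as h would otherwise become negative nearby.
    With h_ll >= c / 2, the derivative h_l then changes sign between - rho and rho, which brackets a
    critical point. *)
Lemma local_parameters (c : R) : 0 < c -> exists rho d e : R,
  [/\ [/\ 0 < rho, 0 < d, d <= c, 0 < e & e <= rho],
    forall i l x, c <= D [:: l; l] i 0 -> cball rho x -> c / 2 <= D [:: l; l] i x,
    forall i l x, c <= D [:: l; l] i 0 -> D [::] i 0 < d -> cball e x ->
      0 <= D [:: l] i (subst_coord l rho x) /\ D [:: l] i (subst_coord l (- rho) x) <= 0 &
    forall i x, d <= D [::] i 0 -> cball e x -> d / 2 <= D [::] i x].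
Proof.
move=> c0.
have hol w : (size w <= 2)%N -> exists2 M : R, 0 <= M & holder_on g (cball 1) (D w) M.
  move=> w2; apply: (@Cka0_holder _ _ _ g _ (2 - size w)) => //.
  by apply: normal_Cka2; rewrite subnKC.
have uni (v : 'I_n -> seq 'I_n) : (forall l, (size (v l) <= 2)%N) ->
    exists2 M : R, 0 <= M & forall l, holder_on g (cball 1) (D (v l)) M.
  move=> v2; apply: fin_unif => [l M M' MM h i x y Ux Uy|l]; last exact: hol.
  by apply: le_trans (h i x y Ux Uy) _; apply: ler_wpM2r; rewrite ?powR_ge0.
have [N2 N20 hN2] := uni (fun l => [:: l; l]) (fun=> isT).
have [N1 N10 hN1] := uni (fun l => [:: l]) (fun=> isT).
have [N0 N00 hN0] := hol [::] isT.
have [M M0 hM] : exists2 M : R, 0 <= M & taylor_on g (cball 1) (D [::]) (fun m => D [:: m]) M.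
  apply: (jets_taylor (K := 2)) => //; first by move=> w l i x w2; apply: jD; exact: leq_trans k1.
  exact: normal_Cka2.
have small (C e : R) : 0 <= C -> 0 < e -> exists2 d : R, 0 < d <= 1 & forall t, 0 <= t <= d -> C * t `^ g <= e.
  move=> C0 e0; have C1 : 0 < C + 1 by lra.
  have [d d0 hd] := powR_small g0 (divr_gt0 e0 C1).
  exists (Num.min 1 d); first by rewrite lt_min ltr01 d0 /= ge_min lexx.
  move=> t /andP[t0]; rewrite le_min => /andP[_ td].
  apply: (le_trans (_ : _ <= (C + 1) * (e / (C + 1)))); last by rewrite mulrC divfK // gt_eqF.
  by apply: ler_pM; rewrite ?powR_ge0 ?hd ?t0 //; lra.
have [rho /andP[rho0 rho1] hrho] := small N2 (c / 2) N20 (divr_gt0 c0 (ltr0Sn _ 1)).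
have conv i l x : c <= D [:: l; l] i 0 -> cball rho x -> c / 2 <= D [:: l; l] i x.
  rewrite /cball /= => h xr.
  have x1 : cball 1 x by exact: le_trans rho1.
  have := hN2 l i 0 x _ x1; rewrite /cball /= normr0 ler01 subr0 => /(_ isT).
  have := hrho `|x|; rewrite normr_ge0 xr => /(_ isT) => h1 /le_trans /(_ h1).
  rewrite ler_norml => /andP[h2 _]; lra.
(* Over a length rho convexity contributes rho c / 2 = 4 eta; the gradient at 0 takes at most 2 eta
   of it and the move from 0 to x at most eta. *)
pose eta := rho * c / 8.
have eta0 : 0 < eta by rewrite divr_gt0 // mulr_gt0.
have [t /andP[t0 t1] ht] := small M eta M0 eta0.
have [e1 /andP[e10 e11] he1] := small N1 eta N10 eta0.
(* The bound t eta lets h >= 0 at distance t yield |h_l 0| <= 2 eta; the bound [c] ensures that h 0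
   < d excludes the alternative c <= h 0. *)
pose d := Num.min c (t * eta).
have d0 : 0 < d by rewrite lt_min c0 mulr_gt0.
have d2 : 0 < d / 2 by rewrite divr_gt0.
have [e2 /andP[e20 e21] he2] := small N0 (d / 2) N00 d2.
pose e := Num.min rho (Num.min e1 e2).
have e0 : 0 < e by rewrite !lt_min rho0 e10.
have ee1 : e <= e1 by rewrite !ge_min lexx /= orbT.
have ee2 : e <= e2 by rewrite !ge_min lexx !orbT.
have er : e <= rho by rewrite ge_min lexx.
exists rho, d, e; split=> //; first by split=> //; rewrite ge_min lexx.
- move=> i l x hc hd xe.
  have b1 s : `|s| <= 1 -> cball 1 (0 + s *: 'e_l : V).
    by rewrite /cball /= add0r normrZ norm_delta_mx mulr1.
  have c10 : cball 1 (0 : V) by rewrite /cball /= normr0.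
  have grad0 : `|D [:: l] i 0| <= 2 * eta.
    have tt (s : R) : `|s| = t -> - (2 * eta * t) <= D [:: l] i 0 * s.
      move=> st; have s1 : `|s| <= 1 by rewrite st.
      have := hM i 0 (0 + s *: 'e_l) c10 (b1 s s1).
      rewrite [_ + _ - 0]addrAC subrr add0r lin_delta normrZ norm_delta_mx mulr1 st.
      have := ht t; rewrite (ltW t0) lexx => /(_ isT) h1.
      have h2 : M * (t * t `^ g) <= t * eta by rewrite mulrCA; apply: ler_wpM2l => //; exact: ltW.
      move=> /le_trans /(_ h2); rewrite ler_norml => /andP[_ h3].
      have := nonneg i (s *: 'e_l).
      have : d <= t * eta by rewrite ge_min lexx orbT.
      by rewrite ?add0r in h3 *; lra.
    have h1 := tt t (gtr0_norm t0).
    have h2 : - (2 * eta * t) <= D [:: l] i 0 * - t by apply: tt; rewrite normrN gtr0_norm.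
    rewrite mulrN lerN2 in h2; rewrite -mulNr in h1.
    rewrite ler_norml; apply/andP; split; by [rewrite -(ler_pM2r t0)|rewrite -(ler_pM2r t0)].
  have inb (s : R) : `|s| <= rho -> cball rho (subst_coord l s x).
    by move=> sr; apply: (subst_coord_ball (fun _ : I => l) er i xe sr).
  have inb0 (s : R) : `|s| <= rho -> cball rho (subst_coord l s (0 : V)).
    move=> sr; apply: (subst_coord_ball (fun _ : I => l) er i _ sr).
    by rewrite /cball /= normr0 ltW.
  have sub1 : cball rho `<=` (cball 1 : set V) by move=> z zr; exact: le_trans rho1.
  have move0 (s : R) : `|s| <= rho -> `|D [:: l] i (subst_coord l s x) - D [:: l] i (subst_coord l s (0 : V))| <= eta.
    move=> sr; apply: le_trans (hN1 l i _ _ (sub1 _ (inb0 s sr)) (sub1 _ (inb s sr))) _.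
    apply: he1; rewrite normr_ge0 /=.
    apply: norm_le_coord; first exact: ltW.
    move=> m; rewrite !mxE; case: eqP => _; first by rewrite subrr normr0 ltW.
    by rewrite subr0; apply: le_trans (coord_le_norm _ _) (le_trans xe ee1).
  have axis (s : R) : subst_coord l s 0 = 0 + (0 + s) *: 'e_l :> V.
    apply/rowP => m; rewrite !mxE eqxx /= !add0r; case: eqP => _; first by rewrite mulr1.
    by rewrite mulr0.
  have dl (s : R) : is_derive s 1 (fun s => D [:: l] i (0 + (0 + s) *: 'e_l)) (D [:: l; l] i (0 + (0 + s) *: 'e_l)).
    by apply: is_derive_coord; exact: jD.
  have rc : 8 * eta = rho * c by rewrite /eta; field.
  split.
    have [s /andP[s0 s1]] := @mvt1 _ _ _ 0 rho (ltW rho0) (fun s _ => dl s).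
    rewrite -!axis subr0 (_ : subst_coord l 0 0 = 0 :> V); last by rewrite axis addr0 scale0r addr0.
    have : c / 2 <= D [:: l; l] i (subst_coord l s 0).
      by apply: conv => //; apply: inb0; rewrite ger0_norm.
    have := move0 rho; rewrite (gtr0_norm rho0) lexx => /(_ isT).
    move: grad0; rewrite !ler_norml => /andP[? ?] /andP[? ?]; move: (D [:: l; l] i _) => q; nra.
  have nr : - rho <= 0 by rewrite oppr_le0 ltW.
  have [s /andP[s0 s1]] := @mvt1 _ _ _ (- rho) 0 nr (fun s _ => dl s).
  rewrite -!axis sub0r opprK (_ : subst_coord l 0 0 = 0 :> V); last by rewrite axis addr0 scale0r addr0.
  have : c / 2 <= D [:: l; l] i (subst_coord l s 0).
    by apply: conv => //; apply: inb0; rewrite ler0_norm // lerNl.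
  have := move0 (- rho); rewrite normrN (gtr0_norm rho0) lexx => /(_ isT).
  move: grad0; rewrite !ler_norml => /andP[? ?] /andP[? ?]; move: (D [:: l; l] i _) => q; nra.
move=> i x hd xe.
have x1 : cball 1 x by apply: le_trans xe (le_trans ee2 e21).
have := hN0 i 0 x _ x1; rewrite /cball /= normr0 ler01 subr0 => /(_ isT).
have := he2 `|x|; rewrite normr_ge0 (le_trans xe ee2) => /(_ isT) => h1 /le_trans /(_ h1).
rewrite ler_norml => /andP[h2 _]; lra.
Qed.

End Family.
End LocalSquares.

(** * Local sums of squares from fewer variables *)

Section LocalDecomposition.
Variables (R : realType) (n : nat) (a g : R) (k : nat).
Local Notation V := 'rV[R]_n.
Hypotheses (a0 : 0 < a) (a1 : a <= 1) (g0 : 0 < g) (g1 : g <= 1).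
Hypothesis hk : (k == 2)%N || (k == 3)%N.
Hypothesis gk : (k == 2)%N -> g <= a.

Let k1 : (1 < k)%N. Proof. by case/orP: hk => /eqP ->. Qed.
Let k3 : (k <= 3)%N. Proof. by case/orP: hk => /eqP ->. Qed.

Definition kill (T : {set 'I_n}) (x : V) : V :=
  diag_affine (\row_m (m \notin T)%:R) 0 x.

Lemma killE T x m : kill T x 0 m = if m \in T then 0 else x 0 m.
Proof. by rewrite !mxE addr0; case: (m \in T); rewrite /= ?mul0r ?mul1r. Qed.

Lemma kill_norm T x : `|kill T x| <= `|x|.
Proof.
apply: norm_le_coord => // m; rewrite killE; case: ifP => _; first by rewrite normr0.
exact: coord_le_norm.
Qed.

Lemma kill_indep (T : {set 'I_n}) (x y : V) : (forall m, m \notin T -> x 0 m = y 0 m) -> kill T x = kill T y.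
Proof. by move=> xy; apply/rowP => m; rewrite !killE; case: ifP => // /negbT /xy. Qed.

Lemma killK T x : kill T (kill T x) = kill T x.
Proof. by apply: kill_indep => m mT; rewrite killE (negPf mT). Qed.

Lemma indep_derive (T : {set 'I_n}) (u v : V -> R) l : indep T u ->
  (forall x, is_derive x 'e_l u (v x)) -> indep T v.
Proof.
move=> uT du x y xy; have := du y => /is_deriveP h.
apply: (is_derive_uniq (du x)); apply/is_deriveP => e /h [d d0 hd]; exists d => // s /hd.
by rewrite (uT y x) => [|m /xy //]; rewrite (uT (y + _) (x + s *: 'e_l)) // => m /xy; rewrite !mxE => ->.
Qed.

Lemma indep_derive0 (T : {set 'I_n}) (u : V -> R) l x (c : R) : indep T u -> l \in T ->
  is_derive x 'e_l u c -> c = 0.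
Proof.
move=> uT lT h; apply: (is_derive_uniq h); apply/is_deriveP => e e0; exists 1 => // s _.
rewrite (uT (x + s *: 'e_l) x); first by rewrite subrr mul0r subr0 normr0 mulr_ge0 // ltW.
by move=> m mT; rewrite !mxE eqxx /=; case: eqP mT => [->|]; rewrite ?lT // mulr0 addr0.
Qed.

Section Family.
Variables (I : Type) (D : seq 'I_n -> I -> V -> R) (T : I -> {set 'I_n}).
Hypotheses (jD : jets k D) (tD : top_holder a k D).
Hypothesis bD : forall w, (size w <= k)%N -> locally_bounded (D w).
Hypothesis nonneg : forall i x, 0 <= D [::] i x.
Hypothesis indT : forall i, indep (T i) (D [::] i).
Variables (m j : nat).
Hypotheses (IH : sos n a g k m j) (cardT : forall i, (#|~: T i| <= j.+1)%N).

Lemma local_convex (l : I -> 'I_n) (c rho e : R) : 0 < c -> 0 < e -> e <= rho ->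
  (forall i x, cball rho x -> c <= D [:: l i; l i] i x) ->
  (forall i x, cball e x -> 0 <= D [:: l i] i (subst_coord (l i) rho x) /\
     D [:: l i] i (subst_coord (l i) (- rho) x) <= 0) ->
  exists G : 'I_m.+1 -> I -> V -> R, (forall s, Cka g (cball (e / 4)) 1 (G s)) /\
    forall i x, cball (e / 4) x -> D [::] i x = \sum_(s < m.+1) G s i x ^+ 2.
Proof.
move=> c0 e0 er conv sign.
have rho0 : 0 < rho by exact: lt_le_trans er.
have dl i x : is_derive x 'e_(l i) (D [::] i) (D [:: l i] i x) by apply: jD; exact: ltnW.
have dll i x : is_derive x 'e_(l i) (D [:: l i] i) (D [:: l i; l i] i x) by apply: jD.
(* In an ignored variable h_ll would vanish, against the lower bound [c]; so [l i] is a new variable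
   to remove. *)
have lT i : l i \notin T i.
  apply/negP => lT; have z x : D [:: l i] i x = 0 := indep_derive0 (@indT i) lT (dl i x).
  have := conv i 0; rewrite /cball /= normr0 => /(_ (ltW rho0)).
  rewrite (indep_derive0 (T := T i) _ lT (dll i 0)); last by move=> x y _; rewrite !z.
  by rewrite leNgt c0.
have zero i x : exists t : R, cball e x -> `|t| <= rho /\ D [:: l i] i (subst_coord (l i) t x) = 0.
  case: (pselect (cball e x)) => xe; last by exists 0 => /xe.
  have [s1 s2] := sign i x xe.
  have line t : subst_coord (l i) t x = subst_coord (l i) 0 x + (0 + t) *: 'e_(l i).
    apply/rowP => v; rewrite !mxE eqxx /= !add0r; case: eqP => _; first by rewrite mulr1 add0r.
    by rewrite mulr0 addr0.
  have [|||t] := @IVT R (fun t => D [:: l i] i (subst_coord (l i) 0 x + (0 + t) *: 'e_(l i))) (- rho) rho 0.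
  - lra.
  - apply: derivable_within_continuous => t _.
    have h := is_derive_coord (dll i (subst_coord (l i) 0 x + (0 + t) *: 'e_(l i))).
    exact: (@ex_derive _ _ _ _ _ _ _ h).
  - by rewrite -!line ge_min le_max s1 s2 orbT.
  rewrite in_itv /= -line => /andP[t1 t2] ht; exists t => _; split=> //.
  by rewrite ler_norml t1.
have [X0 hX0] := choice (fun ix : I * V => zero ix.1 ix.2).
(* Choosing the zero at the projection of [x] makes [X] independent of the variables in [S i] by
   construction. *)
pose S i := l i |: T i.
pose X i x := X0 (i, kill (S i) x).
pose Phi i x := subst_coord (l i) (X i x) x.
have kille i x : cball e x -> cball e (kill (S i) x) by apply: le_trans; exact: kill_norm.
have agree i (x : V) (t : R) v : v \notin T i -> subst_coord (l i) t x 0 v = subst_coord (l i) t (kill (S i) x) 0 v.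
  by move=> vT; rewrite 2!mxE killE !inE; case: eqP => //= _; rewrite (negPf vT).
have Xb i x : cball e x -> `|X i x| <= rho by move=> /(kille i) /(hX0 (i, _)) [].
have Xz i x : cball e x -> D [:: l i] i (Phi i x) = 0.
  move=> /(kille i) /(hX0 (i, _)) [_ /= <-].
  by apply: (indep_derive (@indT i) (dl i)) => v; exact: agree.
have HA w q : (size w + q = k)%N -> Cka a (cball rho) q (D w) := normal_Cka a0 a1 jD tD bD rho (w := w) (j := q).
have HG w q : (size w + q = 2)%N -> Cka g (cball rho) q (D w) := normal_Cka2 a0 a1 g0 g1 hk gk jD tD bD rho (w := w) (j := q).
have j2 : jets 2 D by move=> w v i x w2; apply: jD; exact: leq_trans k1.
pose F := critical_value D l X.
have FC : Cka a (cball e) k F := critical_value_Cka jD k1 c0 er conv Xb Xz a0 a1 HA.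
have [psi [psi01 psi1 psi0 psiC]] := @bump_exists R n (e / 2) (divr_gt0 e0 (ltr0Sn _ 1)).
pose h0 i x := F i x * (psi x * psi x).
have esub : oball (R := R) (n := n) e `<=` cball e by move=> x /ltW.
have h0C : Cka a setT k h0.
  apply: (@Cka_extend_ball _ _ _ _ (e / 2) e) => //.
  - by rewrite ltr_pdivrMr // ltr_pMr // ltr1n.
  - by move=> i x /psi0 px; rewrite /h0 px mulr0 mulr0.
  apply: Cka_mul => //; first exact: Cka_sub FC.
  by apply: (Cka_sub (U := setT)) => //; apply: Cka_mul => //; exact: psiC.
(* The bump depends on all variables; the projection restores independence of those in [S i], and
   the bump is still 1 on the small ball because the projection does not increase the norm. *)
pose h i x := h0 i (kill (S i) x).
have hC : Cka a setT k h.
  apply: (Cka_diag_affine (U := setT) a0 a1 (D := fun i => \row_v (v \notin S i)%:R) (v := fun=> 0) (K := 1)) => // i.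
  by apply: norm_le_coord => // v; rewrite mxE normr_nat; case: (_ \notin _).
have [||i x|i x y xy|G [GT Gsq]] := IH (T := S) (f := h).
- move=> i; rewrite -ltnS; apply: leq_trans (cardT i).
  rewrite -(leq_add2l #|T i|) addnS -addSn (_ : #|T i|.+1 = #|S i|) ?cardsC //.
  by rewrite /S cardsU1 lT.
- exact: Cka_holder_family.
- rewrite /h /h0; apply: mulr_ge0; first exact: nonneg.
  by have /andP[p0 _] := psi01 (kill (S i) x); rewrite mulr_ge0.
- by rewrite /h (kill_indep xy).
have [B B0 hB] := Cka_bnd hC.
(* Each term of a bounded sum of squares is bounded, so the roots from the induction hypothesis,
   known only through their Taylor remainders, are of class [Cka] 1. *)
have GB s i x : `|G s i x| <= 1 + B.
  have := hB i x Logic.I; rewrite Gsq ger0_norm; last by apply: sumr_ge0 => v _; exact: sqr_ge0.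
  rewrite (bigD1 s) //= => hs.
  have : 0 <= \sum_(v < m | v != s) G v i x ^+ 2 by apply: sumr_ge0 => v _; exact: sqr_ge0.
  move=> hs'; have {}hs : `|G s i x| ^+ 2 <= B by rewrite -normrX ger0_norm ?sqr_ge0 //; lra.
  have : 0 <= `|G s i x| by []. 
  move: `|_| hs => z hz z0; nra.
have sub4 : cball (e / 4) `<=` oball (R := R) (n := n) e.
  move=> x xe; apply: le_lt_trans xe _; rewrite ltr_pdivrMr // ltr_pMr // ltr1n //.
exists (fun s => if unlift ord0 s is Some s' then G s' else gap_root D l X); split.
  move=> s; case: (unliftP ord0 s) => [s' _|_].
    by apply: (Cka_sub (U := setT)) => //; apply: taylor_family_Cka (GT s') _ => // i x; exact: GB.
  apply: (Cka_sub sub4).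
  exact: (gap_root_Cka j2 c0 er conv Xb Xz g0 g1 HG (normal_sym a0 a1 g0 g1 hk gk jD tD bD)).
move=> i x x4; rewrite big_ord_recl unlift_none.
under eq_bigr => s _ do rewrite liftK.
have xe : cball e x by apply: esub; exact: sub4.
rewrite (gap_root_sqr j2 c0 er conv Xb Xz i xe) -Gsq.
have pk : psi (kill (S i) x) = 1.
  apply: psi1; apply: le_trans (kill_norm _ _) _; apply: le_trans x4 _; lra.
rewrite /h /h0 pk !mulr1 (_ : F i (kill (S i) x) = F i x) ?subrK //.
rewrite /F /critical_value /X killK; apply/esym; apply: indT => v; exact: agree.
Qed.

End Family.

Lemma local_decomposition (I : Type) (D : seq 'I_n -> I -> V -> R) (T : I -> {set 'I_n}) (m j : nat) (c : R) :
  jets k D -> top_holder a k D ->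
  (forall w, (size w <= k)%N -> locally_bounded (D w)) ->
  (forall i x, 0 <= D [::] i x) -> (forall i, indep (T i) (D [::] i)) ->
  sos n a g k m j -> (forall i, (#|~: T i| <= j.+1)%N) -> 0 < c ->
  (forall i, c <= D [::] i 0 \/ exists l, c <= D [:: l; l] i 0) ->
  exists2 e : R, 0 < e & exists G : 'I_m.+1 -> I -> V -> R,
    (forall s, Cka g (cball e) 1 (G s)) /\
    forall i x, cball e x -> D [::] i x = \sum_(s < m.+1) G s i x ^+ 2.
Proof.
move=> jD tD bD nonneg indT IH cardT c0 alt.
have [rho [d [e [[rho0 d0 dc e0 er] conv sign low]]]] :=
  local_parameters a0 a1 g0 g1 hk gk jD tD bD nonneg c0.
have e4 : 0 < e / 4 by rewrite divr_gt0.
have e4e : e / 4 <= e by rewrite ler_pdivrMr // ler_peMr ?ler1n // ltW.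
(* If d <= h 0, the root of h itself is regular near 0; otherwise h 0 < d <= c, and the alternative
   provides a direction of convexity. *)
pose P i := d <= D [::] i 0.
have exl (i : {i | ~ P i}) : exists l, c <= D [:: l; l] (sval i) 0.
  by case: (alt (sval i)) => // h; case: (svalP i); exact: le_trans h.
have [l hl] := choice exl.
pose D' w (i : {i | ~ P i}) := D w (sval i).
have c2 : 0 < c / 2 by rewrite divr_gt0.
have [||||||i x|i x|G [GC Gsq]] := @local_convex _ D' (fun i => T (sval i)) _ _ _ _ _ m j IH _ l (c / 2) rho e c2 e0 er.
- by move=> w v i x; exact: jD.
- by move=> w /tD [M M0 h]; exists M => // i; exact: h.
- by move=> w /bD h r; have [M M0 hM] := h r; exists M => // i; exact: hM.
- by move=> i; exact: nonneg.
- by move=> i; exact: indT.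
- by move=> i; exact: cardT.
- by apply: conv; exact: hl.
- by apply: sign; [exact: hl|rewrite ltNge; apply/negP; exact: (svalP i)].
have sC : Cka g (cball (e / 4)) 1 (fun (i : {i | P i}) x => Num.sqrt (D [::] (sval i) x)).
  apply: (Cka_sqrt g0 g1 (c := d / 2)); first by rewrite divr_gt0.
    by move=> i x xe; apply: low; [exact: (svalP i)|exact: le_trans e4e].
  apply: Cka_down => //.
  exact: (Cka_reindex (fun i => sval i) (normal_Cka2 a0 a1 g0 g1 hk gk jD tD bD (e / 4) (w := [::]) (j := 2) (erefl : (size [::] + 2 = 2)%N))).
have exK (s : 'I_m.+1) : exists Ks : I -> V -> R,
    (forall i : {i | P i}, Ks (sval i) = if s == ord0 then (fun x => Num.sqrt (D [::] (sval i) x)) else fun=> 0) /\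
    (forall i : {i | ~ P i}, Ks (sval i) = G s i).
  exists (fun i => match pselect (P i) with
    left h => if s == ord0 then (fun x => Num.sqrt (D [::] i x)) else fun=> 0
    | right h => G s (exist _ i h) end).
  by split=> -[i h] /=; case: pselect => // h'; rewrite (Prop_irrelevance h' h).
have [K hK] := choice exK.
exists (e / 4) => //; exists K; split.
  move=> s; apply: (Cka_merge (P := P)).
    apply: (@Cka_eq _ _ _ _ _ _ (fun i x => (s == ord0)%:R * Num.sqrt (D [::] (sval i) x))).
      by move=> i x _; rewrite (proj1 (hK s)); case: eqP => _; rewrite /= ?mul1r ?mul0r.
    apply: (Cka_scale g0 g1 (c := fun=> (s == ord0)%:R) (B := 1)) => //.
    by move=> _; rewrite normr_nat; case: eqP.
  by apply: Cka_eq (GC s) => i x _; rewrite (proj2 (hK s)).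
move=> i x xe; case: (pselect (P i)) => Pi.
  rewrite (bigD1 ord0) //= big1 => [|s s0].
    by rewrite addr0 (proj1 (hK ord0) (exist _ i Pi)) /= sqr_sqrtr.
  by rewrite (proj1 (hK s) (exist _ i Pi)) /= (negPf s0) expr0n.
transitivity (\sum_(s < m.+1) G s (exist _ i Pi) x ^+ 2); first exact: (Gsq (exist _ i Pi) x xe).
apply: eq_bigr => s _.
by rewrite (proj2 (hK s) (exist _ i Pi)).
Qed.

End LocalDecomposition.

(** * Dyadic cells and gluing *)

Section Glue.
Variables (R : realType) (n : nat) (J K : Type) (b : R) (U : set 'rV[R]_n).
Local Notation V := 'rV[R]_n.
Variables (mem : J -> K -> Prop) (B : J -> K -> set V) (sel : J -> V -> option K).
Hypothesis sel_some : forall j x q, sel j x = Some q -> mem j q /\ B j q x.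
Hypothesis sel_uniq : forall j x q, mem j q -> B j q x -> sel j x = Some q.

Definition glue (u : J -> K -> V -> R) (j : J) (x : V) : R :=
  if sel j x is Some q then u j q x else 0.

(** Bounds are demanded only of pieces that meet [U]: in the application the scales of the others
    are not comparable, and no common constant is available for them. *)
Let meets j q := mem j q /\ exists2 x, U x & B j q x.

Let sel_none (u : J -> K -> V -> R) j q x : mem j q -> sel j x <> Some q ->
  (forall j q x, mem j q -> ~ B j q x -> u j q x = 0) -> u j q x = 0.
Proof. by move=> mq sx; apply=> // /(sel_uniq mq). Qed.

Lemma glue_bounded (u : J -> K -> V -> R) (M : R) : 0 <= M ->
  (forall j q x, meets j q -> U x -> `|u j q x| <= M) -> bounded_on U (glue u) M.
Proof.
move=> M0 h j x Ux; rewrite /glue; case e: (sel j x) => [q|]; last by rewrite normr0.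
have [mq Bx] := sel_some e; apply: h => //; split=> //; by exists x.
Qed.

(** At most one piece is active at [x] and one at [y]; when they differ, each vanishes at the other
    point. Hence the factor 2. *)
Lemma glue_holder (u : J -> K -> V -> R) (M : R) : 0 <= M ->
  (forall j q x, mem j q -> ~ B j q x -> u j q x = 0) ->
  (forall j q x y, meets j q -> U x -> U y -> `|u j q y - u j q x| <= M * `|y - x| `^ b) ->
  holder_on b U (glue u) (2 * M).
Proof.
move=> M0 u0 h j x y Ux Uy; rewrite /glue.
have P0 : 0 <= M * `|y - x| `^ b by rewrite mulr_ge0 // powR_ge0.
rewrite -mulrA mulr2n mulrDl mul1r.
have one q : mem j q -> B j q x \/ B j q y -> `|u j q y - u j q x| <= M * `|y - x| `^ b.
  by move=> mq [] Bq; apply: h => //; split=> //; [exists x|exists y].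
case ex: (sel j x) => [q|]; case ey: (sel j y) => [q'|].
- have [mq Bq] := sel_some ex; have [mq' Bq'] := sel_some ey.
  have [e|qq] := pselect (q = q').
    by rewrite -e; apply: le_trans (one q mq (or_introl Bq)) _; rewrite lerDl.
  have z1 : u j q y = 0 by apply: sel_none => //; rewrite ey => -[] /esym.
  have z2 : u j q' x = 0 by apply: sel_none => //; rewrite ex => -[].
  have := one q mq (or_introl Bq); have := one q' mq' (or_intror Bq').
  rewrite z1 z2 subr0 sub0r normrN => h1 h2.
  by apply: le_trans (ler_normB _ _) _; exact: lerD.
- have [mq Bq] := sel_some ex.
  have z1 : u j q y = 0 by apply: sel_none => //; rewrite ey.
  by have := one q mq (or_introl Bq); rewrite z1 !sub0r !normrN => h1; apply: le_trans h1 _; rewrite lerDl.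
- have [mq Bq] := sel_some ey.
  have z1 : u j q' x = 0 by apply: sel_none => //; rewrite ex.
  by have := one q' mq (or_intror Bq); rewrite z1 !subr0 => h1; apply: le_trans h1 _; rewrite lerDl.
- by rewrite subrr normr0 addr_ge0.
Qed.

Lemma glue_taylor (u : J -> K -> V -> R) (p : 'I_n -> J -> K -> V -> R) (M : R) : 0 <= M ->
  (forall j q x, mem j q -> ~ B j q x -> u j q x = 0) ->
  (forall l j q x, mem j q -> ~ B j q x -> p l j q x = 0) ->
  (forall j q x y, meets j q -> U x -> U y ->
    `|u j q y - u j q x - lin (fun l => p l j q x) (y - x)| <= M * (`|y - x| * `|y - x| `^ b)) ->
  taylor_on b U (glue u) (fun l => glue (p l)) (2 * M).
Proof.
move=> M0 u0 p0 h j x y Ux Uy; rewrite /glue.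
have P0 : 0 <= M * (`|y - x| * `|y - x| `^ b) by rewrite !mulr_ge0 // powR_ge0.
rewrite -mulrA mulr2n mulrDl mul1r.
have one q : mem j q -> B j q x \/ B j q y ->
  `|u j q y - u j q x - lin (fun l => p l j q x) (y - x)| <= M * (`|y - x| * `|y - x| `^ b).
  by move=> mq [] Bq; apply: h => //; split=> //; [exists x|exists y].
have pz q : mem j q -> sel j x <> Some q -> lin (fun l => p l j q x) (y - x) = 0.
  move=> mq sx; rewrite (_ : (fun l => _) = (fun=> 0)) ?lin0l //.
  by apply: funext => l; apply: (sel_none (u := p l)) => // ? ? ?; exact: p0.
case ex: (sel j x) => [q|]; case ey: (sel j y) => [q'|].
- have [mq Bq] := sel_some ex; have [mq' Bq'] := sel_some ey.
  have [e|qq] := pselect (q = q').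
    by rewrite -e; apply: le_trans (one q mq (or_introl Bq)) _; rewrite lerDl.
  have z1 : u j q y = 0 by apply: sel_none => //; rewrite ey => -[] /esym.
  have z2 : u j q' x = 0 by apply: sel_none => //; rewrite ex => -[].
  have z3 : lin (fun l => p l j q' x) (y - x) = 0 by apply: pz => //; rewrite ex => -[].
  have := one q mq (or_introl Bq); have := one q' mq' (or_intror Bq').
  rewrite z1 z2 z3 !subr0 sub0r => h1 h2.
  rewrite (_ : _ - _ - _ = u j q' y + (- u j q x - lin (fun l => p l j q x) (y - x))); last by ring.
  by apply: le_trans (ler_normD _ _) _; exact: lerD.
- have [mq Bq] := sel_some ex.
  have z1 : u j q y = 0 by apply: sel_none => //; rewrite ey.
  by have := one q mq (or_introl Bq); rewrite z1 => h1; apply: le_trans h1 _; rewrite lerDl.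
- have [mq Bq] := sel_some ey.
  have z1 : u j q' x = 0 by apply: sel_none => //; rewrite ex.
  have z3 : lin (fun l => p l j q' x) (y - x) = 0 by apply: pz => //; rewrite ex.
  have := one q' mq (or_intror Bq); rewrite z1 z3 lin0l !subr0 => h1.
  by apply: le_trans h1 _; rewrite lerDl.
- by rewrite lin0l subrr subr0 normr0 addr_ge0.
Qed.

End Glue.

Lemma telescope_squares (R : realType) (s c : nat -> R) N :
  (forall i, s i ^+ 2 + c i ^+ 2 = 1) ->
  \sum_(i < N) (s i * \prod_(j < i) c j) ^+ 2 = 1 - \prod_(i < N) c i ^+ 2.
Proof.
move=> sc; elim: N => [|N ih]; first by rewrite !big_ord0 subrr.
rewrite big_ord_recr big_ord_recr /= ih exprMn -prodrXl.
have -> : s N ^+ 2 = 1 - c N ^+ 2 by rewrite -(sc N) addrK.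
ring.
Qed.

Lemma gap_exponent (R : realType) (a g : R) (k : nat) : 0 < a -> a <= 1 ->
  (k == 2)%N || (k == 3)%N -> k%:R + a = 2 + 2 * g ->
  [/\ 0 < g, g <= 1 & (k == 2)%N -> g <= a].
Proof.
move=> a0 a1 /orP[] /eqP -> h; first by split=> [||_]; lra.
by split=> //; lra.
Qed.

(** * Normalisation at admissible scales *)

Section Normalise.
Variables (R : realType) (n : nat) (a g : R) (k : nat).
Local Notation V := 'rV[R]_n.
Hypotheses (a0 : (0 : R) < a) (a1 : a <= (1 : R)).
Hypothesis hk : (k == 2)%N || (k == 3)%N.
Hypothesis hg : k%:R + a = 2 + 2 * g :> R.

Let g0 : 0 < g. Proof. by case: (gap_exponent a0 a1 hk hg). Qed.
Let g1 : g <= 1. Proof. by case: (gap_exponent a0 a1 hk hg). Qed.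
Let gk : (k == 2)%N -> g <= a. Proof. by case: (gap_exponent a0 a1 hk hg). Qed.
Let k1 : (1 < k)%N. Proof. by case/orP: hk => /eqP ->. Qed.
Let g2 : 0 <= 2 * g. Proof. by rewrite mulr_ge0 // ltW. Qed.
Let g22 : 0 <= 2 + 2 * g. Proof. exact: addr_ge0. Qed.

Lemma is_derive_affine (u : V -> R) (c x v : V) (r d : R) :
  is_derive (c + r *: x) v u d -> is_derive x v (fun x => u (c + r *: x)) (r * d).
Proof.
move=> /is_deriveP h; apply/is_deriveP => e e0.
have r1 : 0 < `|r| + 1 by rewrite ltr_wpDl.
have [t t0 ht] := h _ (divr_gt0 e0 r1).
exists (t / (`|r| + 1)); first exact: divr_gt0.
move=> s st; rewrite scalerDr scalerA addrA (_ : r * d * s = d * (r * s)); last by ring.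
apply: le_trans (ht _ _) _.
  rewrite normrM; apply: (le_trans (_ : _ <= (`|r| + 1) * `|s|)).
    by apply: ler_wpM2r => //; lra.
  by rewrite mulrC -ler_pdivlMr.
rewrite normrM mulrA; apply: ler_wpM2r => //.
rewrite mulrAC ler_pdivrMr //; apply: ler_wpM2l; first exact: ltW.
lra.
Qed.

Section Family.
Variables (I : Type) (D : seq 'I_n -> I -> V -> R) (T : I -> {set 'I_n}).
Hypotheses (jD : jets k D) (tD : top_holder a k D).
Hypothesis nonneg : forall i x, 0 <= D [::] i x.
Hypothesis indT : forall i, indep (T i) (D [::] i).

Definition admissible i (c : V) (r : R) :=
  D [::] i c <= r `^ (2 + 2 * g) /\ forall l, D [:: l; l] i c <= r `^ (2 * g).

Lemma admissible_le i c r s : 0 <= r -> r <= s -> admissible i c r -> admissible i c s.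
Proof.
move=> r0 rs [h1 h2]; have s0 := le_trans r0 rs; split=> [|l].
  by apply: le_trans h1 _; apply: ge0_ler_powR; rewrite ?nnegrE.
by apply: le_trans (h2 l) _; apply: ge0_ler_powR; rewrite ?nnegrE.
Qed.

(** The triple (index, centre, scale) serves as index, so that all centres and scales form one
    family with common constants. The factor r^|w| comes from the chain rule. *)
Definition rescale (w : seq 'I_n) (q : I * V * R) (x : V) : R :=
  q.2 ^+ size w / q.2 `^ (2 + 2 * g) * D w q.1.1 (q.1.2 + q.2 *: x).

Lemma powR_split (r : R) : 0 < r -> r `^ (2 + 2 * g) = r ^+ 2 * r `^ (2 * g).
Proof.
move=> r0; rewrite powRD ?powR_mulrn ?ltW //.
by apply/implyP => _; rewrite gt_eqF.
Qed.

Section Reindex.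
Variables (J : Type) (q : J -> I * V * R).
Hypothesis qpos : forall j, 0 < (q j).2.
Hypothesis qadm : forall j, admissible (q j).1.1 (q j).1.2 (q j).2.

Let E w j := rescale w (q j).

Lemma rescale_jets : jets k E.
Proof.
move=> w l j x wk; rewrite /E /rescale /=.
have h := is_derive_affine (jD l (q j).1.1 ((q j).1.2 + (q j).2 *: x) wk).
have := @is_deriveZ _ _ _ _ ((q j).2 ^+ size w / (q j).2 `^ (2 + 2 * g)) _ _ _ h.
rewrite /GRing.scale /= => h'; apply: is_derive_eq h' _; rewrite exprS; ring.
Qed.

Lemma rescale_top_holder : top_holder a k E.
Proof.
move=> w wk; have [M M0 hM] := tD wk; exists M => // j x y _ _.
have r0 := qpos j; rewrite /E /rescale -mulrBr normrM.
set r := (q j).2 in r0 *.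
have P0 : 0 < r `^ (2 + 2 * g) by exact: powR_gt0.
rewrite ger0_norm; last by rewrite divr_ge0 ?exprn_ge0 // ltW.
apply: le_trans (ler_wpM2l _ (hM _ _ _ Logic.I Logic.I)) _.
  by rewrite divr_ge0 ?exprn_ge0 // ltW.
rewrite opprD addrACA subrr add0r -scalerBr normrZ (gtr0_norm r0) powRM ?(ltW r0) //.
(* The exponent 2 + 2 g = k + a makes the top seminorm invariant under rescaling. *)
have e : r ^+ size w * r `^ a = r `^ (2 + 2 * g).
  rewrite wk -hg powRD ?powR_mulrn ?ltW //.
  by apply/implyP => _; rewrite gt_eqF.
rewrite (_ : _ / _ * _ = M * `|y - x| `^ a * ((r ^+ size w * r `^ a) / r `^ (2 + 2 * g))); last by ring.
by rewrite e divff ?mulr1 // gt_eqF.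
Qed.

Lemma rescale_ge0 j x : 0 <= E [::] j x.
Proof. by rewrite /E /rescale mulr_ge0 // divr_ge0 ?powR_ge0. Qed.

Lemma rescale_val0 j : E [::] j 0 <= 1.
Proof.
have [h _] := qadm j.
rewrite /E /rescale scaler0 addr0 expr0 div1r mulrC ler_pdivrMr ?mul1r //.
exact: powR_gt0.
Qed.

Lemma rescale_second0 j l : E [:: l; l] j 0 <= 1.
Proof.
have r0 := qpos j; have [_ h] := qadm j.
rewrite /E /rescale scaler0 addr0 /= (powR_split r0) mulrAC ler_pdivrMr ?mul1r.
  by apply: ler_wpM2l => //; rewrite sqr_ge0.
by rewrite mulr_gt0 ?exprn_gt0 // powR_gt0.
Qed.

Lemma rescale_bounded w : (size w <= k)%N -> locally_bounded (E w).
Proof.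
apply: (interpolation a0 rescale_jets rescale_top_holder).
apply: (nonneg_locally_bounded a0 hk rescale_jets rescale_top_holder).
- exact: rescale_ge0.
- exact: rescale_val0.
- by move=> j l; exact: rescale_second0.
Qed.

Lemma rescale_indep j : indep (T (q j).1.1) (E [::] j).
Proof.
move=> x y xy; rewrite /E /rescale; congr (_ * _); apply: indT => v vT.
by rewrite !mxE xy.
Qed.

End Reindex.

(** The normalised value and pure second derivatives are at most 1 at 0 and, uniformly over all
    admissible triples, at most 2^(2 g) near 0. Doubling the scale gives the second derivatives
    exactly this room, and the value even 2^(2 + 2 g). *)
Lemma admissible_slow : exists2 e : R, 0 < e & forall i x y (r : R), 0 < r ->
  admissible i x r -> `|y - x| <= e * r -> admissible i y (2 * r).
Proof.
pose J := {q : I * V * R | 0 < q.2 /\ admissible q.1.1 q.1.2 q.2}.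
have qpos (j : J) : 0 < (sval j).2 by case: (svalP j).
have qadm (j : J) : admissible (sval j).1.1 (sval j).1.2 (sval j).2 by case: (svalP j).
pose E w (j : J) := rescale w (sval j).
have jE := rescale_jets (fun j : J => sval j).
have tE := rescale_top_holder qpos.
have bE := rescale_bounded qpos qadm.
have hol w : (size w <= 2)%N -> exists2 M : R, 0 <= M & holder_on g (cball 1) (E w) M.
  move=> w2; apply: (@Cka0_holder _ _ _ g _ (2 - size w)) => //.
  by apply: (normal_Cka2 a0 a1 g0 g1 hk gk jE tE) => //; rewrite subnKC.
have [N N0 hN] : exists2 M : R, 0 <= M & forall l : 'I_n, holder_on g (cball 1) (E [:: l; l]) M.
  apply: fin_unif => [l M M' MM h i x y Ux Uy|l]; last exact: hol.
  by apply: le_trans (h i x y Ux Uy) _; apply: ler_wpM2r; rewrite ?powR_ge0.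
have [M M0 hM] := hol [::] isT.
pose d : R := 2 `^ (2 * g) - 1.
have d0 : 0 < d.
  have g2' : 0 < 2 * g by rewrite mulr_gt0.
  have := @gt0_ltr_powR _ _ g2' 1 2; rewrite !nnegrE powR1 => /(_ ler01 (ler0n _ _)).
  by rewrite ltr1n subr_gt0; apply.
have MN1 : 0 < M + N + 1 by lra.
have [e e0 he] := powR_small g0 (divr_gt0 d0 MN1).
exists (Num.min 1 e); first by rewrite lt_min ltr01.
move=> i x y r r0 adm yx.
have jp : 0 < (i, x, r).2 /\ admissible (i, x, r).1.1 (i, x, r).1.2 (i, x, r).2 by [].
pose j : J := exist _ (i, x, r) jp.
pose z := r^-1 *: (y - x).
have zy : x + r *: z = y by rewrite /z scalerA divff ?gt_eqF // scale1r addrCA subrr addr0.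
have zn : `|z| <= Num.min 1 e.
  by rewrite /z normrZ gtr0_norm ?invr_gt0 // mulrC ler_pdivrMr.
move: (zn); rewrite le_min => /andP[z1 ze].
have c0 : cball 1 (0 : V) by rewrite /cball /= normr0.
have fin (C : R) : 0 <= C -> C <= M + N + 1 -> C * `|z| `^ g <= d.
  move=> C0 CM; apply: (le_trans (_ : _ <= (M + N + 1) * (d / (M + N + 1)))).
    by apply: ler_pM; rewrite ?powR_ge0 ?he ?normr_ge0.
  by rewrite mulrC divfK // gt_eqF.
have P0 : 0 < r `^ (2 + 2 * g) by exact: powR_gt0.
have P2 : 0 < r `^ (2 * g) by exact: powR_gt0.
split=> [|l].
  have := hM j 0 z c0 z1; rewrite subr0 ler_norml => /andP[_ h].
  have v0 := rescale_val0 qpos qadm j.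
  have := fin M M0; have : M <= M + N + 1 by lra.
  move=> h1 /(_ h1) h2.
  have : E [::] j z <= 2 `^ (2 * g) by move: h v0 h2; rewrite /E /d; lra.
  rewrite /E /rescale /= zy expr0 div1r mulrC ler_pdivrMr // => h3.
  apply: le_trans h3 _; rewrite powRM ?(ltW r0) // ler_pM2r //.
  by apply: ler_powR; rewrite ?ler1n // lerDr.
have := hN l j 0 z c0 z1; rewrite subr0 ler_norml => /andP[_ h].
have v0 := rescale_second0 qpos qadm j l.
have := fin N N0; have : N <= M + N + 1 by lra.
move=> h1 /(_ h1) h2.
have : E [:: l; l] j z <= 2 `^ (2 * g) by move: h v0 h2; rewrite /E /d; lra.
rewrite /E /rescale /= zy (powR_split r0) invfM mulrA divff ?mul1r ?expf_neq0 ?gt_eqF //.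
rewrite mulrC ler_pdivrMr // => h3.
by apply: le_trans h3 _; rewrite powRM ?(ltW r0).
Qed.

End Family.
End Normalise.

(** * Selected dyadic cubes and their colours *)

Lemma eq_of_mod5 (s t : int) : (s %% 5)%Z = (t %% 5)%Z -> s < t + 5 -> t < s + 5 -> s = t.
Proof. lia. Qed.

Lemma eq_of_parity (s t : int) : (2 %| s)%Z = (2 %| t)%Z -> s < t + 2 -> t < s + 2 -> s = t.
Proof. lia. Qed.

Lemma dyadic_between (R : realType) (P : R -> Prop) (A x y : R) : 0 < A -> 0 < x -> 0 < y ->
  (forall r s : R, 0 < r -> r <= s -> P r -> P s) -> ~ P x -> P y -> exists s : int,
  ~ P (A * 2 ^ s) /\ P (A * 2 ^ (s + 1)).
Proof.
move=> A0 x0 y0 mono Px Py.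
have pos (s : int) : 0 < A * 2 ^ s :> R by rewrite mulr_gt0 // exprz_gt0.
pose K := Num.bound (A / x).
have hK : A * 2 ^ (- K%:Z) <= x.
  rewrite -exprnN ler_pdivrMr ?exprn_gt0 // mulrC -ler_pdivrMr //.
  exact/ltW/upper_nthrootP.
pose L := Num.bound (y / A).
have hL : y <= A * 2 ^ (L%:Z).
  by rewrite mulrC -ler_pdivrMr // -exprnP; exact/ltW/upper_nthrootP.
pose Q t := `[< P (A * 2 ^ (- K%:Z + t%:Z)) >].
have exQ : exists t, Q t.
  exists (K + L)%N; apply/asboolP; rewrite PoszD addrA addNr add0r.
  exact: mono Py.
case: (ex_minnP exQ) => -[|t] /asboolP Qt tmin.
  by case: Px; apply: mono Qt; rewrite ?addr0.
exists (- K%:Z + t%:Z); split; last by move: Qt; rewrite intS [1 + _]addrC addrA.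
by move=> Qt'; have := tmin t; rewrite ltnn => /(_ (introT (asboolP _) Qt')).
Qed.

Section Cubes.
Variables (R : realType) (n : nat) (a g : R) (k : nat).
Local Notation V := 'rV[R]_n.
Hypotheses (a0 : 0 < a) (a1 : a <= 1).
Hypothesis hk : (k == 2)%N || (k == 3)%N.
Hypothesis hg : k%:R + a = 2 + 2 * g.

Let g0 : 0 < g. Proof. by case: (gap_exponent a0 a1 hk hg). Qed.
Let g1 : g <= 1. Proof. by case: (gap_exponent a0 a1 hk hg). Qed.

Variables (I : Type) (D : seq 'I_n -> I -> V -> R).
Variables (A e : R).
Hypotheses (A0 : 0 < A) (e0 : 0 < e) (eA : e * A = 4).
Hypothesis slow : forall i x y (r : R), 0 < r -> admissible g D i x r -> `|y - x| <= e * r ->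
  admissible g D i y (2 * r).

Definition cube := (I * int * {ffun 'I_n -> int})%type.
Implicit Types q : cube.

Definition side q : R := 2 ^ q.1.2.
Definition center q : V := \row_l (side q * (q.2 l)%:~R).
(** The lattice of centres has step [side], half the width of a cell: cells overlap, and the
    half-size cells, where the bumps equal 1, still cover. *)
Definition cell q : set V := [set x | `|x - center q| < side q].
(** At a point x the dyadic scale is fixed by 4 A side being admissible and 2 A side not. Passing
    between x and the nearby centre costs a factor 2 each way, hence 8 A and A. *)
Definition selected q := admissible g D q.1.1 (center q) (8 * A * side q) /\
  ~ admissible g D q.1.1 (center q) (A * side q).

(* Sizes of cells meeting at a point differ by a factor less than 2^5, which is why
   the exponent is recorded modulo 5. *)
Definition color_type : finType := ('I_5 * {ffun 'I_n -> bool})%type.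
Definition color q : nat := @enum_rank color_type
  (inord `|(q.1.2 %% 5)%Z|, [ffun l => (2 %| q.2 l)%Z]).

Lemma color_lt q : (color q < #|color_type|)%N. Proof. exact: ltn_ord. Qed.

Lemma color_inj q q' : color q = color q' -> (q.1.2 %% 5)%Z = (q'.1.2 %% 5)%Z /\
  forall l, (2 %| q.2 l)%Z = (2 %| q'.2 l)%Z.
Proof.
move=> /ord_inj /enum_rank_inj [h1 h2]; split.
  have b (s : int) : (`|(s %% 5)%Z| < 5)%N by lia.
  by have := congr1 val h1; rewrite /= !inordK // => h; lia.
by move=> l; have := congr1 (fun u : {ffun 'I_n -> bool} => u l) h2; rewrite !ffunE.
Qed.

Lemma side_gt0 q : 0 < side q. Proof. exact: exprz_gt0. Qed.

Let adm_le i c (r s : R) : 0 < r -> r <= s -> admissible g D i c r -> admissible g D i c s.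
Proof. by move=> r0; apply: (admissible_le a0 a1 hk hg); exact: ltW. Qed.

Lemma side_le q q' (t : nat) : q.1.2 + t%:Z <= q'.1.2 -> 2 ^+ t * side q <= side q'.
Proof.
move=> h; rewrite /side exprnP -expfzDr ?pnatr_eq0 // addrC.
by apply: ler_weXz2l => //; rewrite ler1n.
Qed.

(** As e A = 4, [slow] reaches distance 4 s at scale A s. Were [q'] at least 32 times larger than
    [q], passing from the centre of [q] to [x] and on to the centre of [q'] would make A side q'
    admissible there. *)
Lemma selected_comparable q q' x : selected q -> selected q' -> q.1.1 = q'.1.1 ->
  `|x - center q| <= 2 * side q -> `|x - center q'| <= 2 * side q' -> q'.1.2 < q.1.2 + 5.
Proof.
move=> [s1 _] [_ s2] qq xq xq'; rewrite ltNge; apply/negP => h.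
have s0 := side_gt0 q; have s0' := side_gt0 q'.
have h32 : 32 * side q <= side q'.
  by have := side_le (t := 5) h; rewrite (_ : 2 ^+ 5 = 32) //; rewrite -natrX.
apply: s2; rewrite -qq.
have x1 : admissible g D q.1.1 x (2 * (8 * A * side q)).
  apply: slow s1 _; first by rewrite !mulr_gt0.
  apply: le_trans xq _; rewrite (_ : e * _ = 8 * (e * A) * side q); last by ring.
  by rewrite eA; apply: ler_wpM2r; [exact: ltW|rewrite -natrM ler_nat].
have x2 : admissible g D q.1.1 x (A * side q' / 2).
  apply: adm_le x1; first by rewrite !mulr_gt0.
  rewrite ler_pdivlMr // (_ : _ * 2 = A * (32 * side q)); last by ring.
  by apply: ler_wpM2l => //; exact: ltW.
rewrite (_ : A * side q' = 2 * (A * side q' / 2)); last by field.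
apply: slow x2 _; first by rewrite divr_gt0 // mulr_gt0.
rewrite distrC; apply: le_trans xq' _; rewrite (_ : e * _ = e * A * side q' / 2); last by ring.
by rewrite eA ler_pdivlMr // mulrAC -natrM.
Qed.

(** Meeting cells have exponents differing by less than 5, so equality modulo 5 gives equal sizes;
    the lattice indices then differ by less than 2, so equal parity gives equality. *)
Lemma cell_disjoint q q' x : selected q -> selected q' -> q.1.1 = q'.1.1 ->
  color q = color q' -> cell q x -> cell q' x -> q = q'.
Proof.
move=> sq sq' qq cc xq xq'.
have le2 q0 : `|x - center q0| < side q0 -> `|x - center q0| <= 2 * side q0.
  by move=> /ltW h; apply: le_trans h _; rewrite ler_peMl ?ler1n // ltW // side_gt0.
have [m5 m2] := color_inj cc.
have ss : q.1.2 = q'.1.2.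
  apply: (eq_of_mod5 m5).
    by apply: (selected_comparable sq' sq (esym qq)); exact: le2.
  by apply: (selected_comparable sq sq' qq); exact: le2.
have sd : side q' = side q by rewrite /side ss.
have s0 := side_gt0 q.
have cl l : q.2 l = q'.2 l.
  have h : `|center q 0 l - center q' 0 l| < 2 * side q.
    have h1 := le_lt_trans (coord_le_norm _ l) xq; have h2 := le_lt_trans (coord_le_norm _ l) xq'.
    rewrite !mxE sd in h2; rewrite !mxE in h1; rewrite !mxE sd.
    rewrite (_ : _ - _ = (x 0 l - side q * (q'.2 l)%:~R) - (x 0 l - side q * (q.2 l)%:~R)); last by ring.
    apply: le_lt_trans (ler_normB _ _) _; rewrite (_ : 2 * side q = side q + side q); [exact: ltrD|ring].
  rewrite !mxE sd -mulrBr normrM (gtr0_norm s0) mulrC ltr_pM2r // in h.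
  rewrite -intrB -intr_norm -[2]/(2%:~R) ltr_int in h.
  by apply: (eq_of_parity (m2 l)); move: h; rewrite ltr_norml => /andP[]; move: (q.2 l) (q'.2 l); clear => u v; lia.
case: q q' qq ss cl {sq sq' cc xq xq' m5 m2 sd s0} => [[i s] v] [[i' s'] v'] /= -> -> cl.
by congr (_, _); apply/ffunP.
Qed.

(** Positivity of the value makes very small scales inadmissible, so there is a last inadmissible
    dyadic scale. *)
Lemma selected_cover i x : 0 < D [::] i x ->
  exists q, [/\ q.1.1 = i, selected q & `|x - center q| <= side q / 2].
Proof.
move=> fx.
have b0 : 0 < 2 + 2 * g by rewrite ltr_wpDr // mulr_ge0 // ltW.
have [d d0 hd] := powR_small b0 (divr_gt0 fx (ltr0Sn _ 1)).
have nd : ~ admissible g D i x d.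
  move=> [h _]; have := hd d; rewrite (ltW d0) lexx => /(_ isT) h'.
  by have := le_trans h h'; rewrite leNgt ltr_pdivrMr // ltr_pMr ?ltr1n.
(* An admissible scale: [y] dominates the value, and as y >= 1 so does its power 2 + 2 g; the sum
   takes care of the second derivatives. *)
pose y := 1 + D [::] i x + \sum_l `|D [:: l; l] i x| `^ (2 * g)^-1.
have S0 : 0 <= \sum_l `|D [:: l; l] i x| `^ (2 * g)^-1 by apply: sumr_ge0 => l _; exact: powR_ge0.
have y1 : 1 <= y by rewrite /y -addrA lerDl addr_ge0 // ltW.
have y0 : 0 < y by exact: lt_le_trans y1.
have hy : admissible g D i x y.
  split=> [|l].
    apply: (@le_trans _ _ y); first by rewrite /y -addrA addrCA lerDl addr_ge0.
    by apply: le1r_powR => //; rewrite -addrA ler_wpDr // addr_ge0 // mulr_ge0 // ltW.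
  apply: le_trans (ler_norm _) _.
  have -> : `|D [:: l; l] i x| = (`|D [:: l; l] i x| `^ (2 * g)^-1) `^ (2 * g).
    by rewrite -powRrM mulVf ?powRr1 // mulf_neq0 ?pnatr_eq0 // gt_eqF.
  apply: ge0_ler_powR; rewrite ?nnegrE ?powR_ge0 ?(ltW y0) ?mulr_ge0 ?(ltW g0) //.
  rewrite /y (bigD1 l) //= addrCA lerDl addr_ge0 //; first by rewrite addr_ge0 // ltW.
  by apply: sumr_ge0 => l' _; exact: powR_ge0.
have A2 : 0 < 2 * A by rewrite mulr_gt0.
have [s [ns ys]] := dyadic_between (P := admissible g D i x) A2 d0 y0 (@adm_le i x) nd hy.
(* Adding 2^-1 before [Num.floor] rounds to the nearest lattice point, at distance at most side /
   2. *)
pose q : cube := (i, s, [ffun l => Num.floor (x 0 l / 2 ^ s + 2^-1)]).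
have sq : side q = 2 ^ s by [].
have s0 : 0 < (2 : R) ^ s by exact: exprz_gt0.
have xq : `|x - center q| <= 2 ^ s / 2.
  apply: norm_le_coord; first by rewrite divr_ge0 // ltW.
  move=> l; rewrite !mxE sq ffunE.
  have /andP[] := floor_itv (x 0 l / 2 ^ s + 2^-1).
  set z := (Num.floor _)%:~R; rewrite intrD -/z mulr1z.
  have -> : x 0 l - 2 ^ s * z = 2 ^ s * (x 0 l / 2 ^ s - z) by field; rewrite gt_eqF.
  move=> h1 h2; rewrite normrM (gtr0_norm s0); apply: ler_wpM2l; first exact: ltW.
  by rewrite ler_norml; apply/andP; split; move: h1 h2; move: z (x 0 l / _) => z w; lra.
exists q; split=> //; split=> /=.
  rewrite sq (_ : 8 * A * 2 ^ s = 2 * (2 * A * 2 ^ (s + 1))); last first.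
    by rewrite expfzDr ?pnatr_eq0 // expr1z; ring.
  apply: slow ys _; first by rewrite mulr_gt0 // exprz_gt0.
  rewrite distrC; apply: le_trans xq _.
  rewrite (_ : e * _ = 2 * (e * A) * 2 ^ (s + 1)); last by ring.
  rewrite eA expfzDr ?pnatr_eq0 // expr1z.
  by move: (2 ^ s) s0=> w w0; lra.
rewrite sq => adm; apply: ns.
rewrite -mulrA; apply: slow adm _; first by rewrite mulr_gt0.
apply: le_trans xq _; rewrite mulrA eA.
by move: (2 ^ s) s0=> w w0; lra.
Qed.

End Cubes.

(** * A partition of unity by squares *)

Section Partition.
Variables (R : realType) (n : nat) (a g : R) (k : nat).
Local Notation V := 'rV[R]_n.
Hypotheses (a0 : 0 < a) (a1 : a <= 1).
Hypothesis hk : (k == 2)%N || (k == 3)%N.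
Hypothesis hg : k%:R + a = 2 + 2 * g.

Let g0 : 0 < g. Proof. by case: (gap_exponent a0 a1 hk hg). Qed.
Let g1 : g <= 1. Proof. by case: (gap_exponent a0 a1 hk hg). Qed.
Let gk : (k == 2)%N -> g <= a. Proof. by case: (gap_exponent a0 a1 hk hg). Qed.

Variables (I : Type) (D : seq 'I_n -> I -> V -> R).
Variables (A e : R).
Hypotheses (A0 : 0 < A) (e0 : 0 < e) (eA : e * A = 4).
Hypothesis slow : forall i x y (r : R), 0 < r -> admissible g D i x r -> `|y - x| <= e * r ->
  admissible g D i y (2 * r).

Definition scube := {q : cube n I | selected g D A q}.
Implicit Types q : scube.
Local Notation base q := ((sval q).1.1).

Definition same_color c i q := base q = i /\ color (sval q) = c.

Definition selector c i (x : V) : option scube :=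
  match pselect (exists q, same_color c i q /\ cell (sval q) x) with
  | left h => Some (projT1 (cid h))
  | right _ => None
  end.

Lemma selector_some c i x q : selector c i x = Some q -> same_color c i q /\ cell (sval q) x.
Proof.
by rewrite /selector; case: pselect => // h [<-]; exact: (projT2 (cid h)).
Qed.

Lemma selector_uniq c i x q : same_color c i q -> cell (sval q) x -> selector c i x = Some q.
Proof.
move=> sc qx; rewrite /selector; case: pselect => [h|[]]; last by exists q.
case: (projT2 (cid h)); move: (projT1 (cid h)) => q' [b' c'] qx'; congr Some.
case: sc => b c''.
have : sval q' = sval q.
  apply: (cell_disjoint a0 a1 hk hg A0 e0 eA slow (svalP q') (svalP q) _ _ qx' qx).
  - by rewrite b b'.
  - by rewrite c' c''.
case: q q' {h b' c' qx' b c'' qx} => [q sq] [q' sq'] /= qq.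
by move: sq'; rewrite qq => sq'; rewrite (Prop_irrelevance sq' sq).
Qed.

Variable bump : V -> R.
Hypotheses (bump0 : forall x, ~ oball 1 x -> bump x = 0)
  (bump1 : forall x, `|x| <= 1 / 2 -> bump x = 1)
  (bumpC : Cka g setT 1 (fun _ : unit => bump)).

Definition cell_bump (q : scube) (x : V) := bump ((side R (sval q))^-1 *: (x - center R (sval q))).
Definition color_bump c : I -> V -> R := glue (selector c) (fun _ => cell_bump).
(** Coordinates in which the admissible scale 8 A side is the unit length; the cell becomes the ball
    of radius 1 / (8 A). *)
Definition place (q : scube) (z : V) : V := center R (sval q) + (8 * A * side R (sval q)) *: z.

Let s0 q : 0 < side R (sval q). Proof. exact: side_gt0. Qed.

Lemma bump_jet : exists (p : 'I_n -> V -> R) (M : R), [/\ 0 <= M,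
  (forall x y, `|bump y - bump x - lin (fun l => p l x) (y - x)| <= M * (`|y - x| * `|y - x| `^ g)),
  (forall x, `|bump x| <= M /\ forall l, `|p l x| <= M),
  (forall l x y, `|p l y - p l x| <= M * `|y - x| `^ g) &
  forall l x, ~ oball 1 x -> p l x = 0].
Proof.
have [p [M [hp' M0 bM tM]]] := bumpC.
have hp : forall l, Cka g setT 0 (p l) := hp'.
have [N N0 bN] := Cka_bnd_fin hp.
have [L L0 hL] : exists2 L : R, 0 <= L & forall l, holder_on g setT (p l) L.
  apply: fin_unif => [l L L' LL h i x y Ux Uy|l].
    by apply: le_trans (h i x y Ux Uy) _; apply: ler_wpM2r; rewrite ?powR_ge0.
  exact: (Cka0_holder g0 g1 (hp l)).
exists (fun l => p l tt), (M + N + L); split.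
- by rewrite !addr_ge0.
- move=> x y; apply: le_trans (tM tt x y Logic.I Logic.I) _.
  by apply: ler_wpM2r; rewrite ?mulr_ge0 ?powR_ge0 // -addrA lerDl addr_ge0.
- move=> x; split=> [|l].
    by apply: le_trans (bM tt x Logic.I) _; rewrite -addrA lerDl addr_ge0.
  by apply: le_trans (bN l tt x Logic.I) _; rewrite addrAC lerDr addr_ge0.
- move=> l x y; apply: le_trans (hL l tt x y Logic.I Logic.I) _.
  by apply: ler_wpM2r; rewrite ?powR_ge0 // lerDr addr_ge0.
move=> l x xB; apply: (taylor_grad0 g0 M0 tM Logic.I) => [|d d0]; first exact: bump0.
have x1 : 1 <= `|x| by move: xB; rewrite /oball /= => /negP; rewrite -leNgt.
have xs : `|x| < `|x| + 1 by rewrite ltrDl.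
have [t [t0 td _ tB]] := @oball_step R n 1 (`|x| + 1) d x l xs x1 d0.
by exists t; split=> //; exact: bump0.
Qed.

(** Twice the image of the cell; the margin serves to extend local functions by zero. *)
Let U : set V := oball (1 / (4 * A)).

Let place_near q z : U z -> `|place q z - center R (sval q)| <= 2 * side R (sval q).
Proof.
rewrite /U /oball /= => zU; rewrite /place addrAC subrr add0r normrZ.
have s8 : 0 < 8 * A * side R (sval q) by rewrite !mulr_gt0.
rewrite (gtr0_norm s8); apply: (le_trans (_ : _ <= 8 * A * side R (sval q) * (1 / (4 * A)))).
  by apply: ler_wpM2l; exact: ltW.
by rewrite (_ : _ * (1 / _) = 2 * side R (sval q)) //; field; rewrite gt_eqF.
Qed.

Let ratio_le q q' : base q' = base q -> (exists2 z, U z & cell (sval q') (place q z)) ->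
  (side R (sval q'))^-1 * (8 * A * side R (sval q)) <= 1 + 128 * A.
Proof.
move=> bb [z zU zc].
have h : (sval q).1.2 < (sval q').1.2 + 5.
  apply: (selected_comparable a0 a1 hk hg A0 eA slow (svalP q') (svalP q) bb (x := place q z)).
    by apply: le_trans (ltW zc) _; rewrite ler_peMl ?ler1n // ltW.
  exact: place_near.
have h16 : side R (sval q) <= 16 * side R (sval q').
  rewrite /side (_ : 16 = 2 ^ 4%:Z :> R); last by rewrite -exprnP -natrX.
  rewrite -expfzDr ?pnatr_eq0 //; apply: ler_weXz2l; first by rewrite ler1n.
  by move: h; move: (sval q).1.2 (sval q').1.2; clear => u v; lia.
rewrite mulrC ler_pdivrMr //.
apply: (le_trans (_ : _ <= 8 * A * (16 * side R (sval q')))).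
  by apply: ler_wpM2l => //; rewrite mulr_ge0 // ltW.
rewrite (_ : 8 * A * _ = 128 * A * side R (sval q')); last by ring.
by apply: ler_wpM2r; rewrite ?lerDr // ltW.
Qed.

(** In the coordinates of [q], the bump of another cell is rescaled by the ratio of sizes. Only
    cells meeting [U] matter; their exponents fall at most 4 below that of [q], so the ratio is at
    most 2^4 times 8 A, with one constant for all [q]. *)
Lemma color_bump_Cka c : Cka g U 1 (fun q z => color_bump c (base q) (place q z)).
Proof.
have [p [M [M0 tM bM hM p0]]] := bump_jet.
pose K := 1 + 128 * A.
have K1 : 1 <= K by rewrite lerDl mulr_ge0 // ltW.
have K0 : 0 <= K by exact: le_trans K1.
pose kap q q' := (side R (sval q'))^-1 * (8 * A * side R (sval q)).
have kap0 q q' : 0 <= kap q q' by rewrite !mulr_ge0 ?invr_ge0 // ltW.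
pose pos q q' z := (side R (sval q'))^-1 *: (place q z - center R (sval q')).
have posB q q' x y : pos q q' y - pos q q' x = kap q q' *: (y - x).
  rewrite /pos -scalerBr opprB addrA subrK /place opprD addrACA subrr add0r -scalerBr.
  by rewrite scalerA.
pose mem q q' := same_color c (base q) q'.
pose B q q' := [set z | cell (sval q') (place q z)].
pose sel q z := selector c (base q) (place q z).
have ss q z q' : sel q z = Some q' -> mem q q' /\ B q q' z by exact: selector_some.
have su q z q' : mem q q' -> B q q' z -> sel q z = Some q' by exact: selector_uniq.
have offB q q' z : ~ B q q' z -> ~ oball 1 (pos q q' z).
  rewrite /B /cell /oball /= /pos normrZ gtr0_norm ?invr_gt0 // => h1 h2; apply: h1.
  by move: h2; rewrite mulrC ltr_pdivrMr // mul1r.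
have kapK q q' : (mem q q' /\ exists2 z, U z & B q q' z) -> kap q q' <= K.
  by move=> [[bb _] ex]; exact: ratio_le.
have dist q q' x y : kap q q' <= K -> `|pos q q' y - pos q q' x| <= K * `|y - x| /\
    `|pos q q' y - pos q q' x| `^ g <= K * `|y - x| `^ g.
  move=> kk; have h : `|pos q q' y - pos q q' x| <= K * `|y - x|.
    by rewrite posB normrZ ger0_norm //; apply: ler_wpM2r.
  split=> //; apply: le_trans (powR_mono g0 _ h) _ => //; exact: powR_scale.
pose u q q' z := bump (pos q q' z).
pose dp l q q' z := kap q q' * p l (pos q q' z).
have u0 q q' z : mem q q' -> ~ B q q' z -> u q q' z = 0.
  by move=> _ /offB; exact: bump0.
have dp0 l q q' z : mem q q' -> ~ B q q' z -> dp l q q' z = 0.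
  by move=> _ /offB h; rewrite /dp p0 // mulr0.
have KM : 0 <= K * M by rewrite mulr_ge0.
apply: (@Cka_eq _ _ _ _ _ _ (glue sel u)); first by [].
exists (fun l => glue sel (dp l)), (M + 2 * (K * K * M)); split.
- move=> l; exists (K * M + 2 * (K * (K * M))); split.
  + by rewrite addr_ge0 // mulr_ge0 // mulr_ge0.
  + have h : bounded_on U (glue sel (dp l)) (K * M).
      apply: (glue_bounded (mem := mem) (B := B)) => // q q' z qq _.
      rewrite /dp normrM ger0_norm //; apply: ler_pM => //; first exact: kapK.
      by case: (bM (pos q q' z)).
    by move=> q z zU; apply: le_trans (h q z zU) _; rewrite lerDl mulr_ge0 // mulr_ge0.
  + have h : holder_on g U (glue sel (dp l)) (2 * (K * (K * M))).
      apply: (glue_holder (mem := mem) (B := B) ss su _ (dp0 l)); first by rewrite !mulr_ge0.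
      move=> q q' x y qq _ _; have [_ d] := dist q q' x y (kapK _ _ qq).
      rewrite /dp -mulrBr normrM ger0_norm //.
      rewrite (_ : K * (K * M) * _ = K * (M * (K * `|y - x| `^ g))); last by ring.
      apply: (ler_pM (kap0 q q') (normr_ge0 _) (kapK _ _ qq)).
      by apply: le_trans (hM l _ _) _; exact: ler_wpM2l.
    move=> q x y xU yU; apply: le_trans (h q x y xU yU) _.
    by apply: ler_wpM2r; rewrite ?powR_ge0 // lerDr.
- by rewrite addr_ge0 // !mulr_ge0.
- have h : bounded_on U (glue sel u) M.
    apply: (glue_bounded (mem := mem) (B := B)) => // q q' z _ _.
    by case: (bM (pos q q' z)).
  by move=> q z zU; apply: le_trans (h q z zU) _; rewrite lerDl !mulr_ge0.
have h : taylor_on g U (glue sel u) (fun l => glue sel (dp l)) (2 * (K * K * M)).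
  apply: (glue_taylor (mem := mem) (B := B) ss su _ u0 dp0); first by rewrite !mulr_ge0.
  move=> q q' x y qq _ _; have [d1 d2] := dist q q' x y (kapK _ _ qq).
  have := tM (pos q q' x) (pos q q' y); rewrite {1}posB linZr -linZl => h.
  apply: le_trans h _; rewrite (_ : K * K * M * _ = M * ((K * `|y - x|) * (K * `|y - x| `^ g))); last by ring.
  by apply: ler_wpM2l => //; apply: ler_pM.
move=> q x y xU yU; apply: le_trans (h q x y xU yU) _.
by apply: ler_wpM2r; [rewrite mulr_ge0 ?powR_ge0|rewrite lerDr].
Qed.

(* Sine and cosine of an angle, as rational functions of the tangent b of its half:
   csin 0 = 0, ccos 1 = 0 and csin^2 + ccos^2 = 1, hence the products
   csin (b c) * prod_(c' < c) ccos (b c') have squares that telescope to 1 where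
   some b c is 1. *)
Definition csin (b : R) := 2 * b / (1 + b * b).
Definition ccos (b : R) := (1 - b * b) / (1 + b * b).

Lemma csin_ccos b : csin b ^+ 2 + ccos b ^+ 2 = 1.
Proof.
have b2 : 0 <= b * b by rewrite -expr2 sqr_ge0.
by rewrite /csin /ccos; field; rewrite gt_eqF // ltr_pwDl.
Qed.

Lemma csin_ccos_Cka J (W : set V) (u : J -> V -> R) : Cka g W 1 u ->
  Cka g W 1 (fun j x => csin (u j x)) /\ Cka g W 1 (fun j x => ccos (u j x)).
Proof.
move=> hu; have cst (z : R) : Cka g W 1 (fun (_ : J) (_ : V) => z).
  by apply: (@Cka_cst _ _ _ _ _ _ (fun=> z) `|z|).
have huu : Cka g W 1 (fun j x => u j x * u j x) by exact: Cka_mul.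
have hi : Cka g W 1 (fun j x => (1 + u j x * u j x)^-1).
  apply: (@Cka_inv _ _ _ _ _ g0 g1 _ 1) => //; last exact: Cka_add.
  by move=> j x _; apply: le_trans (ler_norm _); rewrite lerDl -expr2 sqr_ge0.
split; apply: Cka_mul => //; first exact: Cka_mul.
exact: Cka_sub2.
Qed.

(** The factor [csin] uses the bump of [q] itself, which vanishes off its cell, and not
    [color_bump], which also lives on other cells of the same colour. On the cell of [q] they agree
    if c is its colour. *)
Definition weight c q z := csin (bump ((8 * A) *: z)) *
  \prod_(c' < c) ccos (color_bump c' (base q) (place q z)).

Lemma weight_Cka c : Cka g U 1 (weight c).
Proof.
apply: Cka_mul => //; last first.
  apply: (Cka_prod g0 g1 (index_enum 'I_c) (P := xpredT) (f := fun c' q z => ccos (color_bump c' (base q) (place q z)))) => c' _.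
  by apply: (proj2 (csin_ccos_Cka _)); exact: color_bump_Cka.
apply: (proj1 (csin_ccos_Cka _)).
have hb := Cka_diag_affine (I := scube) (U := setT) (W := U) (D := fun=> const_mx (8 * A)) (v := fun=> 0)
  (K := 8 * A) g0 g1 _ _ (Cka_reindex (fun=> tt) bumpC).
apply: Cka_eq (hb _ _) => //.
  move=> q z _; congr bump; apply/rowP => l; by rewrite !mxE addr0.
by move=> _; apply: norm_le_coord => [|l]; rewrite ?mxE ?ger0_norm // mulr_ge0 // ltW.
Qed.

Lemma weight_off c q z : ~ oball (1 / (8 * A)) z -> weight c q z = 0.
Proof.
move=> zB; rewrite /weight bump0 /csin ?mulr0 ?mul0r // /oball /= normrZ.
have A8 : 0 < 8 * A by rewrite mulr_gt0.
rewrite (gtr0_norm A8) => h; apply: zB; rewrite /oball /=.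
by rewrite ltr_pdivlMr // mulrC.
Qed.

(** Some selected cube has bump 1 at [x]; [ccos] vanishes for its colour and kills the product left
    by the telescoping. *)
Lemma partition_of_unity i x : 0 < D [::] i x ->
  \sum_(c < #|color_type n|) (csin (color_bump c i x) * \prod_(c' < c) ccos (color_bump c' i x)) ^+ 2 = 1.
Proof.
move=> fx; rewrite (@telescope_squares _ (fun c => csin (color_bump c i x)) (fun c => ccos (color_bump c i x))); last first.
  by move=> c; exact: csin_ccos.
have [q [qi sq xq]] := selected_cover a0 a1 hk hg A0 eA slow fx.
pose q' : scube := exist _ q sq.
have sx : selector (color q) i x = Some q'.
  apply: selector_uniq; first by split.
  apply: le_lt_trans xq _; rewrite ltr_pdivrMr // ltr_pMr ?ltr1n //; exact: side_gt0.
rewrite (bigD1 (Ordinal (color_lt q))) //= (_ : ccos _ = 0) ?expr0n ?mul0r ?subr0 //.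
rewrite /color_bump /glue sx /cell_bump bump1 /ccos ?mulr1 ?subrr ?mul0r //=.
have sp := side_gt0 R q.
by rewrite normrZ gtr0_norm ?invr_gt0 // mulrC ler_pdivrMr // mulrAC mul1r.
Qed.

End Partition.

(** * Rescaled pieces glued over one colour *)

Section Patch.
Variables (R : realType) (n : nat) (a g : R) (k : nat).
Local Notation V := 'rV[R]_n.
Hypotheses (a0 : 0 < a) (a1 : a <= 1).
Hypothesis hk : (k == 2)%N || (k == 3)%N.
Hypothesis hg : k%:R + a = 2 + 2 * g.

Let g0 : 0 < g. Proof. by case: (gap_exponent a0 a1 hk hg). Qed.

Variables (I : Type) (D : seq 'I_n -> I -> V -> R).
Variables (A e : R).
Hypotheses (A0 : 0 < A) (e0 : 0 < e) (eA : e * A = 4).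
Hypothesis slow : forall i x y (r : R), 0 < r -> admissible g D i x r -> `|y - x| <= e * r ->
  admissible g D i y (2 * r).
Local Notation scube := (scube g D A).
Implicit Types q : scube.

Definition radius q : R := 8 * A * side R (sval q).
Definition local_position q (x : V) : V := (radius q)^-1 *: (x - center R (sval q)).

(* The factor [radius q `^ (1 + g)] makes the Taylor constant of the piece on [q]
   independent of [q]. *)
Definition patch (W : scube -> V -> R) c : I -> V -> R :=
  glue (selector g D A c) (fun _ q x => radius q `^ (1 + g) * W q (local_position q x)).

Lemma radius_gt0 q : 0 < radius q.
Proof. by rewrite !mulr_gt0 // side_gt0. Qed.

Lemma local_position_cell q x : cell (sval q) x <-> oball (1 / (8 * A)) (local_position q x).
Proof.
rewrite /cell /oball /local_position /= normrZ gtr0_norm ?invr_gt0 ?radius_gt0 //.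
rewrite mulrC ltr_pdivrMr ?radius_gt0 // (_ : 1 / _ * _ = side R (sval q)) //.
by rewrite /radius; field; rewrite gt_eqF.
Qed.

Lemma place_local_position q x : place q (local_position q x) = x.
Proof.
rewrite /place /local_position scalerA /radius divff ?scale1r; first by rewrite addrCA subrr addr0.
by rewrite gt_eqF // radius_gt0.
Qed.

Lemma patch_taylor (W : scube -> V -> R) c :
  (forall q z, ~ oball (1 / (8 * A)) z -> W q z = 0) -> Cka g setT 1 W ->
  taylor_family g (patch W c).
Proof.
move=> W0 [p [M [_ M0 _ tM]]].
have p0 l q z : ~ oball (1 / (8 * A)) z -> p l q z = 0.
  move=> zB; apply: (taylor_grad0 g0 M0 tM Logic.I) => [|d d0]; first exact: W0.
  have z1 : 1 / (8 * A) <= `|z| by move: zB; rewrite /oball /= => /negP; rewrite -leNgt.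
  have zs : `|z| < `|z| + 1 by rewrite ltrDl.
  have [t [t0 td _ tB]] := @oball_step R n _ (`|z| + 1) d z l zs z1 d0.
  by exists t; split=> //; exact: W0.
have off q x : ~ cell (sval q) x -> ~ oball (1 / (8 * A)) (local_position q x).
  by move=> h h'; apply: h; apply/local_position_cell.
exists (fun l => glue (selector g D A c) (fun _ q x => radius q `^ (1 + g) * (radius q)^-1 * p l q (local_position q x))), (2 * M).
split; first by rewrite mulr_ge0.
apply: (glue_taylor (mem := same_color c) (B := fun _ q => cell (sval q))) => //.
- by move=> i x q; exact: selector_some.
- by move=> i x q; exact: (selector_uniq a0 a1 hk hg A0 e0 eA slow).
- by move=> i q x _ /off h; rewrite W0 ?mulr0.
- by move=> l i q x _ /off h; rewrite p0 ?mulr0.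
move=> i q x y _ _ _; have r0 := radius_gt0 q.
have P0 : 0 < radius q `^ (1 + g) by exact: powR_gt0.
have dxy : local_position q y - local_position q x = (radius q)^-1 *: (y - x).
  by rewrite -scalerBr opprB addrA subrK.
have := tM q (local_position q x) (local_position q y) Logic.I Logic.I.
rewrite dxy linZr normrZ (gtr0_norm (_ : 0 < (radius q)^-1)) ?invr_gt0 // => h.
rewrite linZl -mulrBr -mulrA -mulrBr normrM (gtr0_norm P0).
apply: le_trans (ler_wpM2l (ltW P0) h) _.
have h1 : radius q `^ (1 + g) = radius q * radius q `^ g.
  by rewrite powRD ?powRr1 ?(ltW r0) //; apply/implyP => _; rewrite gt_eqF.
have h2 : ((radius q)^-1 * `|y - x|) `^ g = `|y - x| `^ g / radius q `^ g.
  by rewrite powRM ?invr_ge0 ?(ltW r0) // -powR_inv1 ?(ltW r0) // -powRrM mulN1r powRN mulrC.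
have g0' : 0 < radius q `^ g by exact: powR_gt0.
rewrite h1 h2 [leLHS](_ : _ = M * (`|y - x| * `|y - x| `^ g)) //.
by field; rewrite !gt_eqF.
Qed.

End Patch.

(** * The induction step on the number of variables *)

Section Step.
Variables (R : realType) (n : nat) (a g : R) (k : nat).
Local Notation V := 'rV[R]_n.
Hypotheses (a0 : 0 < a) (a1 : a <= 1).
Hypothesis hk : (k == 2)%N || (k == 3)%N.
Hypothesis hg : k%:R + a = 2 + 2 * g.

Let g0 : 0 < g. Proof. by case: (gap_exponent a0 a1 hk hg). Qed.
Let g1 : g <= 1. Proof. by case: (gap_exponent a0 a1 hk hg). Qed.
Let gk : (k == 2)%N -> g <= a. Proof. by case: (gap_exponent a0 a1 hk hg). Qed.

(** Failure at r / 8 means that one quantity exceeds its threshold. Relative to scale r the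
    thresholds are 8^-(2 + 2 g) and 8^-(2 g), and the smaller one serves both. *)
Lemma rescale_not_admissible (I : Type) (D : seq 'I_n -> I -> V -> R) (q : I * V * R) :
  0 < q.2 -> ~ admissible g D q.1.1 q.1.2 (q.2 / 8) ->
  (8 `^ (2 + 2 * g))^-1 <= rescale g D [::] q 0 \/
  exists l, (8 `^ (2 + 2 * g))^-1 <= rescale g D [:: l; l] q 0.
Proof.
move=> r0 nadm.
have P0 : 0 < q.2 `^ (2 + 2 * g) by exact: powR_gt0.
have g2 : 0 < q.2 `^ (2 * g) by exact: powR_gt0.
have div8 (b : R) : (q.2 / 8) `^ b = q.2 `^ b / 8 `^ b.
  by rewrite powRM ?invr_ge0 ?ltW // -powR_inv1 // -powRrM mulN1r powRN.
have [h|] := boolP (D [::] q.1.1 q.1.2 <= (q.2 / 8) `^ (2 + 2 * g)); last first.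
  rewrite -ltNge div8 => h; left; rewrite /rescale scaler0 addr0 /= expr0 div1r.
  by rewrite [leRHS]mulrC ler_pdivlMr // mulrC ltW.
have [[l hl]|hn] := pselect (exists l, ~ D [:: l; l] q.1.1 q.1.2 <= (q.2 / 8) `^ (2 * g)); last first.
  by case: nadm; split=> // l; apply: contrapT => hl; apply: hn; exists l.
right; exists l; move: hl => /negP; rewrite -ltNge div8 => /ltW hl.
rewrite /rescale scaler0 addr0 /= (powR_split g r0) invfM mulrA divff ?mul1r ?expf_neq0 ?gt_eqF //.
rewrite [leRHS]mulrC ler_pdivlMr //; apply: le_trans hl; rewrite mulrC; apply: ler_wpM2l; first exact: ltW.
rewrite lef_pV2 ?posrE ?powR_gt0 //.
by apply: ler_powR; rewrite ?ler1n // lerDr.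
Qed.

Lemma sos_step m j : sos n a g k m j -> sos n a g k #|{: 'I_#|color_type n| * 'I_m.+1}| j.+1.
Proof.
move=> IH I T f cardT [D [Df jD tD]]; rewrite -{}Df => nonneg indT.
have [e1 e10 slow1] := admissible_slow a0 a1 hk hg jD tD nonneg.
(* The local decomposition is applied once, to the family of all normalisations at good scales, so
   that its radius and constants do not depend on the cube. *)
pose good (q : I * V * R) := [/\ 0 < q.2, admissible g D q.1.1 q.1.2 q.2 & ~ admissible g D q.1.1 q.1.2 (q.2 / 8)].
pose J := {q | good q}.
have qpos (q : J) : 0 < (sval q).2 by case: (svalP q).
have qadm (q : J) : admissible g D (sval q).1.1 (sval q).1.2 (sval q).2 by case: (svalP q).
have c0 : 0 < ((8 : R) `^ (2 + 2 * g))^-1 by rewrite invr_gt0 powR_gt0.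
have [e2 e20 [G [GC Gsq]]] := local_decomposition a0 a1 g0 g1 hk gk
  (rescale_jets g jD (fun q : J => sval q)) (rescale_top_holder hg tD qpos)
  (fun w => rescale_bounded a0 hk hg jD tD nonneg qpos qadm (w := w))
  (rescale_ge0 g nonneg (fun q : J => sval q))
  (fun q => rescale_indep g indT (q := fun q : J => sval q) (j := q)) IH
  (fun q => cardT (sval q).1.1) c0
  (fun q : J => let: And3 h1 _ h3 := svalP q in rescale_not_admissible h1 h3).
(* [e1] is what [slow] requires; [e2] makes 1 / (4 A) = e / 16 smaller than the radius of the local
   decomposition. *)
pose e := Num.min e1 e2; have e0 : 0 < e by rewrite lt_min e10.
pose A := 4 / e; have A0 : 0 < A by rewrite divr_gt0.
have eA : e * A = 4 by rewrite mulrC divfK // gt_eqF.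
have slow i (x y : V) (r : R) : 0 < r -> admissible g D i x r -> `|y - x| <= e * r -> admissible g D i y (2 * r).
  move=> r0 adm h; apply: slow1 adm _ => //; apply: le_trans h _.
  by apply: ler_wpM2r; [exact: ltW|rewrite ge_min lexx].
have Ae : 1 / (4 * A) < e2.
  have ee2 : e <= e2 by rewrite ge_min lexx orbT.
  apply: lt_le_trans ee2; rewrite (_ : 1 / _ = e / 16); last by rewrite /A; field; rewrite gt_eqF.
  by rewrite ltr_pdivrMr // ltr_pMr // ltr1n.
have A84 : 1 / (8 * A) < 1 / (4 * A).
  rewrite !div1r; have A4 : 0 < 4 * A by rewrite mulr_gt0.
  have A8 : 0 < 8 * A by rewrite mulr_gt0.
  by rewrite ltf_pV2 ?posrE // ltr_pM2r // ltr_nat.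
have sub2 : oball (R := R) (n := n) (1 / (4 * A)) `<=` cball e2.
  by move=> x xA; apply: ltW; exact: lt_trans Ae.
have [bump [_ bump1 bump0 bumpC]] := bump_exists n (ltr01 (R := R)).
have emb_good (q : scube g D A) : good ((sval q).1.1, center R (sval q), radius q).
  have [h1 h2] := svalP q; split=> //=; first exact: radius_gt0.
  by rewrite (_ : _ / 8 = A * side R (sval q)) // /radius; field.
pose emb (q : scube g D A) : J := exist _ _ (emb_good q).
pose W c s (q : scube g D A) z := G s (emb q) z * weight bump c q z.
have W0 c s q z : ~ oball (1 / (8 * A)) z -> W c s q z = 0.
  by move=> zB; rewrite /W (weight_off A0 bump0) ?mulr0.
have WC c s : Cka g setT 1 (W c s).
  apply: (Cka_extend_ball g0 A84 (W0 c s)); apply: Cka_mul => //.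
    by apply: (Cka_sub sub2); apply: (Cka_reindex emb (GC s)).
  exact: (weight_Cka a0 a1 hk hg A0 e0 eA slow bump0 (bumpC _ _ _ g0 g1 _)).
pose part (cs : 'I_#|color_type n| * 'I_m.+1) := patch (W cs.1 cs.2) cs.1.
exists (fun t => part (enum_val t)); split.
  move=> t; rewrite /part; move: (enum_val t) => cs.
  exact: (patch_taylor a0 a1 hk hg A0 e0 eA slow cs.1 (W0 cs.1 cs.2) (WC cs.1 cs.2)).
move=> i x; set u := fun c => color_bump g D A bump c i x.
(* On a cell of colour c the local squares add up to f / radius^(2 + 2 g), and the squared factor of
   [patch] restores f. Off these cells both sides vanish, as csin 0 = 0. *)
have key c : \sum_(s < m.+1) patch (W c s) c i x ^+ 2 =
    (csin (u c) * \prod_(c' < c) ccos (u c')) ^+ 2 * D [::] i x.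
  case sx: (selector g D A c i x) => [q|]; last first.
    have u0 : csin (u c) = 0 by rewrite /u /color_bump /glue sx /csin mulr0 mul0r.
    rewrite u0 mul0r expr0n mul0r big1 // => s _.
    by rewrite /patch /glue sx expr0n.
  have [[qi _] xq] := selector_some sx; have zB := (local_position_cell A0 q x).1 xq.
  have r0 := radius_gt0 A0 q; set z := local_position q x in zB.
  have zp : place q z = x by exact: place_local_position.
  have bz : bump ((8 * A) *: z) = u c.
    rewrite /u /color_bump /glue sx /cell_bump /z /local_position scalerA; congr (bump (_ *: _)).
    by rewrite /radius; field; rewrite !gt_eqF // side_gt0.
  have -> : D [::] i x = radius q `^ (2 + 2 * g) * \sum_(s < m.+1) G s (emb q) z ^+ 2.
    rewrite -Gsq; last by apply: sub2; exact: lt_trans zB A84.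
    rewrite /rescale /= expr0 div1r mulrA divff ?mul1r ?gt_eqF ?powR_gt0 //.
    by move: zp; rewrite /place -/(radius q) => ->; rewrite qi.
  rewrite mulrA mulr_sumr; apply: eq_bigr => s _.
  rewrite /patch /glue sx -/z /W /weight bz zp qi -/u !exprMn.
  rewrite (_ : 2 + 2 * g = (1 + g) * 2); last by ring.
  by rewrite powRrM powR_mulrn ?powR_ge0 //; ring.
rewrite -(big_enum_val (A := {: 'I_#|color_type n| * 'I_m.+1}) (fun cs => part cs i x ^+ 2)) /=.
rewrite -(pair_big xpredT xpredT (fun c s => patch (W (nat_of_ord c) s) c i x ^+ 2)) /=.
under eq_bigr => c _ do rewrite key.
(* The cubes cover only the set f > 0; at a zero of f both sides are zero. *)
rewrite -mulr_suml; have [fx|fx] := boolP (0 < D [::] i x).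
  by rewrite (partition_of_unity a0 a1 hk hg A0 e0 eA slow bump1 fx) mul1r.
by rewrite (_ : D [::] i x = 0) ?mulr0 //; apply/eqP; rewrite eq_le nonneg andbT leNgt.
Qed.
End Step.

(** * From jets to the Hölder spaces *)

(** With no variable left each [f i] is constant. Its root need not be bounded uniformly in [i],
    which [taylor_family] allows. *)
Lemma sos_base (R : realType) n (a g : R) k : sos n a g k 1 0.
Proof.
move=> I T f cardT _ nonneg indT; exists (fun _ i _ => Num.sqrt (f i 0)); split.
  move=> _; exists (fun _ _ _ => 0), 0; split=> // i x y _ _.
  by rewrite subrr lin0l subr0 normr0 mul0r.
move=> i x; rewrite big_ord1 sqr_sqrtr //; apply: indT => l lT.
have := cardT i; rewrite leqn0 cards_eq0 => /eqP/setP/(_ l).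
by rewrite !inE lT.
Qed.

(** Each colour contributes the roots of the previous level and one more, the gap root or the direct
    square root. *)
Fixpoint square_count n j : nat :=
  if j is j'.+1 then #|{: 'I_#|color_type n| * 'I_(square_count n j').+1}| else 1%N.

Lemma square_count_gt0 n j : (0 < square_count n j)%N.
Proof.
case: j => //= j; rewrite card_prod !card_ord muln_gt0 andbT.
by apply/card_gt0P; exists (ord0, [ffun=> true]).
Qed.

Lemma sos_all (R : realType) n (a g : R) k : 0 < a -> a <= 1 -> (k == 2)%N || (k == 3)%N ->
  k%:R + a = 2 + 2 * g -> forall j, sos n a g k (square_count n j) j.
Proof.
move=> a0 a1 hk hg; elim=> [|j ih]; first exact: sos_base.
exact: (sos_step a0 a1 hk hg ih).
Qed.

Section Spaces.
Variables (R : realType) (n : nat).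
Local Notation V := 'rV[R]_n.

Lemma continuous_distP (u : V -> R) (x : V) : {for x, continuous u} <->
  forall e : R, 0 < e -> exists2 d : R, 0 < d & forall z : V, `|z - x| <= d -> `|u z - u x| <= e.
Proof.
split=> [/cvgrPdist_le h e e0|h].
  have /nbhs_ballP [d /= d0 hd] := h e e0.
  exists (d / 2); first by rewrite divr_gt0.
  move=> z zx; rewrite distrC; apply: hd; rewrite -ball_normE /= distrC.
  by apply: le_lt_trans zx _; rewrite ltr_pdivrMr // ltr_pMr // ltr1n.
apply: (cvgrPdist_le (F := nbhs x) u (u x)).2 => e e0; have [d d0 hd] := h e e0.
apply/nbhs_ballP; exists d => // z; rewrite -ball_normE /= distrC => /ltW zx.
by rewrite distrC; exact: hd.
Qed.

Lemma norm_le_enorm (x : V) : `|x| <= enorm x.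
Proof.
apply: norm_le_coord => [|l]; first exact: sqrtr_ge0.
rewrite -sqrtr_sqr /enorm ler_sqrt; last by apply: sumr_ge0 => i _; exact: sqr_ge0.
by rewrite (bigD1 l) //= lerDl; apply: sumr_ge0 => i _; exact: sqr_ge0.
Qed.

Lemma enorm_le_norm (x : V) : enorm x <= Num.sqrt n%:R * `|x|.
Proof.
rewrite -[in leRHS](normr_id x) -sqrtr_sqr -sqrtrM // /enorm ler_sqrt ?mulr_ge0 ?sqr_ge0 //.
rewrite (_ : n%:R * _ = \sum_(i < n) `|x| ^+ 2); last by rewrite sumr_const card_ord mulr_natl.
apply: ler_sum => i _.
by rewrite -[x 0 i ^+ 2]ger0_norm ?sqr_ge0 // normrX; apply: lerXn2r; rewrite ?nnegrE // coord_le_norm.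
Qed.

Lemma enorm_gt0 (x : V) : x != 0 -> 0 < enorm x.
Proof. by move=> x0; apply: lt_le_trans (norm_le_enorm x); rewrite normr_gt0. Qed.

Lemma contdiff_is_derive k (f : V -> R) w (l : 'I_n) x : contdiff k f -> (size w < k)%N ->
  is_derive x 'e_l (pderivs w f) (pderivs (l :: w) f x).
Proof. by move=> [df _] wk; apply: derivableP; exact: df. Qed.

Lemma pderivs_swap k (f : V -> R) w (l m : 'I_n) : contdiff k f -> (size w + 2 <= k)%N ->
  pderivs [:: l, m & w] f = pderivs [:: m, l & w] f.
Proof.
rewrite addn2 => df wk; have wk' := ltnW wk; apply: funext => x.
apply: (@schwarz _ _ (pderivs w f) (pderivs (m :: w) f) (pderivs (l :: w) f)
  (pderivs [:: l, m & w] f) (pderivs [:: m, l & w] f) x m l) => [z|z|z|z|e e0];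
  try by apply: (contdiff_is_derive (k := k)).
case: df => _ cf.
have [d1 d10 h1] := (continuous_distP _ _).1 (cf [:: l, m & w] wk x) e e0.
have [d2 d20 h2] := (continuous_distP _ _).1 (cf [:: m, l & w] wk x) e e0.
exists (Num.min d1 d2); first by rewrite lt_min d10.
by move=> z; rewrite le_min => /andP[z1 z2]; split; [exact: h1|exact: h2].
Qed.

Lemma pderivs_front k (f : V -> R) (l : 'I_n) w1 w2 : contdiff k f ->
  (size (w1 ++ l :: w2) <= k)%N -> pderivs (w1 ++ l :: w2) f = pderivs (l :: w1 ++ w2) f.
Proof.
move=> df; elim: w1 => //= m w1 ih wk.
have wk' := ltnW wk; rewrite -/(pderivs _ f) (ih wk').
apply: (pderivs_swap (w := w1 ++ w2) m l df).
by move: wk; rewrite !size_cat /=; lia.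
Qed.

(** [holder_space] constrains the top derivatives only along the words of multi-indices, whereas
    jets use all words; symmetry of continuous mixed derivatives bridges the two. *)
Lemma pderivs_perm k (f : V -> R) w w' : contdiff k f -> perm_eq w w' -> (size w <= k)%N ->
  pderivs w f = pderivs w' f.
Proof.
move=> df; elim: w w' => [|l w ih] w' ww' wk; first by move: ww'; rewrite perm_sym => /perm_nilP ->.
have lw : l \in w' by rewrite -(perm_mem ww') mem_head.
case/splitPr: lw ww' => p1 p2 ww'.
rewrite (pderivs_front df); last by rewrite -(perm_size ww').
rewrite /= -/(pderivs _ f) (ih (p1 ++ p2)) //; last exact: ltnW.
by rewrite -(perm_cons l) (perm_trans ww') // -(cat1s l p2) perm_catCA perm_refl.
Qed.

Definition word_of (b : multiindex n) := flatten [seq nseq (b i) i | i <- enum 'I_n].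

Lemma size_word_of b : size (word_of b) = mdegree b.
Proof.
rewrite size_flatten /shape -map_comp sumnE big_map big_enum /=.
by apply: eq_bigr => i _; rewrite /= size_nseq.
Qed.

Lemma perm_word_of w : perm_eq w (word_of [ffun i => count_mem i w]).
Proof.
apply/allP => i _ /=; rewrite count_flatten -map_comp sumnE big_map big_enum /=.
rewrite (bigD1 i) //= count_nseq /= eqxx mul1n ffunE big1 ?addn0 //.
by move=> j ji; rewrite count_nseq /= (negbTE ji).
Qed.

(** The factor sqrt(n)^a pays for passing from the Euclidean norm to the sup norm. *)
Lemma holder_seminorm_bound (a : R) (u : V -> R) : 0 < a -> (holder_seminorm a u < +oo)%E ->
  exists2 M : R, 0 <= M & forall x y, `|u y - u x| <= M * `|y - x| `^ a.
Proof.
move=> a0 hu; pose M0 := Num.max 0 (fine (holder_seminorm a u)).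
have M00 : 0 <= M0 by rewrite le_max lexx.
exists (M0 * Num.sqrt n%:R `^ a); first by rewrite mulr_ge0 // powR_ge0.
move=> x y; have [->|xy] := eqVneq y x.
  by rewrite !subrr normr0 mulr_ge0 ?powR_ge0 // mulr_ge0 // powR_ge0.
have e0 : 0 < enorm (y - x) by apply: enorm_gt0; rewrite subr_eq0.
have h : ((`|u y - u x| / enorm (y - x) `^ a)%:E <= holder_seminorm a u)%E.
  by apply: ereal_sup_ubound; exists (y, x).
have {}h : `|u y - u x| / enorm (y - x) `^ a <= M0.
  move: h hu; rewrite /M0; case: (holder_seminorm a u) => //= r; rewrite lee_fin => h _.
  by apply: le_trans h _; rewrite le_max lexx orbT.
move: h; rewrite ler_pdivrMr ?powR_gt0 // => h; apply: le_trans h _.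
rewrite -mulrA; apply: ler_wpM2l => //; rewrite -powRM ?sqrtr_ge0 //.
by apply: powR_mono => //; [exact: ltW|exact: enorm_le_norm].
Qed.

Lemma holder_space_family k (a : R) (f : V -> R) : 0 < a -> holder_space R n k a f ->
  holder_family a k (fun _ : unit => f).
Proof.
move=> a0 [df hf]; exists (fun w _ => pderivs w f); split=> //.
  by move=> w l _ x wk; exact: (contdiff_is_derive l x df wk).
move=> w wk; have wb := perm_word_of w.
have [M M0 hM] : exists2 M : R, 0 <= M & forall x y, `|pderivs w f y - pderivs w f x| <= M * `|y - x| `^ a.
  apply: (holder_seminorm_bound a0).
  rewrite (pderivs_perm df wb) ?wk //; apply: hf.
  by rewrite -size_word_of -(perm_size wb).
by exists M => // _ x y _ _; exact: hM.
Qed.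

Lemma taylor_family_space (g : R) (G : unit -> V -> R) : 0 < g -> g <= 1 ->
  taylor_family g G -> holder_space R n 1 g (G tt).
Proof.
move=> g0 g1 [p [M [M0 tM]]]; have hp := taylor_grad_holder g0 g1 M0 tM.
have dG l x : is_derive x 'e_l (G tt) (p l tt x) by exact: (taylor_on_is_derive tt x l g0 M0 tM).
have pG l : pderivs [:: l] (G tt) = p l tt by apply: funext => x; apply: derive_val.
split; last first.
  move=> b; rewrite -size_word_of /mderiv -/(word_of b); case: (word_of b) => [|l [|//]] // _.
  rewrite pG; apply: (@le_lt_trans _ _ (6 * M)%:E); last by rewrite ltry.
  apply: ge_ereal_sup => _ [[x y] /= xy <-]; rewrite lee_fin.
  have e0 : 0 < enorm (x - y) by apply: enorm_gt0; rewrite subr_eq0.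
  rewrite ler_pdivrMr ?powR_gt0 //; apply: le_trans (hp l tt y x Logic.I Logic.I) _.
  apply: ler_wpM2l; first by rewrite mulr_ge0.
  by apply: powR_mono => //; exact: norm_le_enorm.
split=> [[|//] l x _|[|l [|//]] _ x]; first by have [] := dG l x.
  apply/continuous_distP => e e0 /=.
  pose K := \sum_l `|p l tt x|; have K0 : 0 <= K by apply: sumr_ge0 => l _; exact: normr_ge0.
  have pK l : `|p l tt x| <= K by rewrite /K (bigD1 l) //= lerDl; apply: sumr_ge0 => m _; exact: normr_ge0.
  have M1 : 0 < M + 1 by rewrite ltr_wpDl.
  have K1 : 0 < n%:R * K + 1 by rewrite ltr_wpDl // mulr_ge0.
  have e2 : 0 < e / 2 by rewrite divr_gt0.
  have [d d0 hd] := powR_small g0 (divr_gt0 e2 M1).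
  exists (Num.min (Num.min 1 d) (e / 2 / (n%:R * K + 1))); first by rewrite !lt_min ltr01 d0 divr_gt0.
  move=> z; rewrite !le_min -andbA => /and3P[z1 zd ze].
  have {}hd : `|z - x| `^ g <= e / 2 / (M + 1) by rewrite hd // normr_ge0.
  have h := tM tt x z Logic.I Logic.I; have h2 := lin_le (z - x) K0 pK.
  rewrite (_ : _ - _ = (G tt z - G tt x - lin (fun l => p l tt x) (z - x)) + lin (fun l => p l tt x) (z - x)); last by ring.
  apply: le_trans (ler_normD _ _) _; rewrite [leRHS](splitr e); apply: lerD.
    apply: le_trans h _; apply: (le_trans (_ : _ <= M * (1 * (e / 2 / (M + 1))))).
      by apply: ler_wpM2l => //; apply: ler_pM => //; exact: powR_ge0.
    by rewrite mul1r mulrCA ler_piMr ?(ltW e2) // ler_pdivrMr // mul1r lerDl.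
  apply: le_trans h2 _; apply: (le_trans (_ : _ <= n%:R * K * (e / 2 / (n%:R * K + 1)))).
    by apply: ler_wpM2l => //; rewrite mulr_ge0.
  by rewrite mulrCA ler_piMr ?(ltW e2) // ler_pdivrMr // mul1r lerDl.
rewrite pG; apply/continuous_distP => e e0.
have M1 : 0 < 6 * M + 1 by rewrite ltr_wpDl // mulr_ge0.
have [d d0 hd] := powR_small g0 (divr_gt0 e0 M1).
exists d => // z zx; apply: le_trans (hp l tt x z Logic.I Logic.I) _.
have {}hd := hd `|z - x| ; rewrite zx normr_ge0 in hd.
apply: le_trans (ler_wpM2l _ (hd isT)) _; first by rewrite mulr_ge0.
by rewrite mulrCA ler_piMr ?(ltW e0) // ler_pdivrMr // mul1r lerDl.
Qed.

End Spaces.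

Lemma nonneg_sum_squares (R : realType) n k (a g : R) (f : 'rV[R]_n -> R) : 0 < a -> a <= 1 ->
  (k == 2)%N || (k == 3)%N -> k%:R + a = 2 + 2 * g ->
  holder_space R n k a f -> (forall x, 0 <= f x) ->
  exists G : 'I_(square_count n n) -> 'rV[R]_n -> R,
    (forall j, holder_space R n 1 g (G j)) /\ forall x, f x = \sum_(j < square_count n n) G j x ^+ 2.
Proof.
move=> a0 a1 hk hg hf f0; have [g0 g1 _] := gap_exponent a0 a1 hk hg.
have cardT (i : unit) : (#|~: (finset.set0 : {set 'I_n})| <= n)%N.
  by apply: leq_trans (max_card _) _; rewrite card_ord.
have indT (i : unit) : indep (finset.set0 : {set 'I_n}) f.
  by move=> x y xy; congr f; apply/rowP => l; apply: xy; rewrite inE.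
have [G [GT Gsq]] := sos_all a0 a1 hk hg cardT (holder_space_family a0 hf) (fun _ => f0) indT.
exists (fun j => G j tt); split=> [j|x]; last exact: (Gsq tt).
exact: (taylor_family_space (G := G j) g0 g1 (GT j)).
Qed.

Theorem theorem3p1 (n : nat) (hn : (1 <= n)%N) :
  exists m : nat, (0 < m)%N /\
    forall (R : realType) (alpha : R), 0 < alpha -> alpha <= 1 ->
      (forall f : 'rV[R]_n -> R,
         holder_space R n 2 alpha f -> (forall x, 0 <= f x) ->
         exists g : 'I_m -> ('rV[R]_n -> R),
           (forall j, holder_space R n 1 (alpha / 2) (g j)) /\
           (forall x, f x = \sum_(j < m) g j x ^+ 2)) /\
      (forall f : 'rV[R]_n -> R,
         holder_space R n 3 alpha f -> (forall x, 0 <= f x) ->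
         exists g : 'I_m -> ('rV[R]_n -> R),
           (forall j, holder_space R n 1 ((1 + alpha) / 2) (g j)) /\
           (forall x, f x = \sum_(j < m) g j x ^+ 2)).
Proof.
exists (square_count n n); split; first exact: square_count_gt0.
move=> R alpha a0 a1; split=> f hf f0.
  by apply: (nonneg_sum_squares a0 a1 _ _ hf f0) => //; field.
by apply: (nonneg_sum_squares a0 a1 _ _ hf f0) => //; field.
Qed.
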